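(* Let $\alpha\ge 0$ and let $\Sigma_\sigma=[\sigma,+\infty[$, where $\sigma\ge 0$ if $\alpha>0$ and $\sigma\in\mathbb R$ if $\alpha=0$. Let $Q_\alpha(x)=x^2+2\alpha\log\frac1x$ on $\Sigma_\sigma$ (so $Q_\alpha(0)=+\infty$ when $\alpha>0$), and let $\nu^\sigma_\alpha$ be the equilibrium measure associated to $(\Sigma_\sigma,Q_\alpha)$. Then: (1) If $\sigma=0$ and $\alpha>0$, there is a unique $a_c=a(\alpha)>0$ and a unique $b_c=b(\alpha)$ with $b_c>\sqrt\alpha>a_c>0$ such that the equilibrium measure on $\Sigma_0$ is the measure $\nu^0_\alpha$ with support $[a_c,b_c]$ and density $$f_{\alpha,0}(x)=\frac1\pi\sqrt{(b_c-x)(x-a_c)}\Big(1+\frac{\alpha}{\sqrt{a_cb_c}}\frac1x\Big),$$ where $b_c=\frac23\Big(\sqrt{6(\alpha+1)-2a_c^2}-\frac{a_c}{2}\Big)$. (2) If $\alpha>0$ and $0<\sigma\le a_c$, then $\nu^\sigma_\alpha=\nu^0_\alpha$. (3) If $\alpha>0$ and $\sigma>a_c$, then $\nu^\sigma_\alpha$ is supported by $]\sigma,b]$ and has density $$f_{\alpha,\sigma}(x)=\frac1{2\pi}\sqrt{\frac{b-x}{x-\sigma}}\Big(2x+b-\sigma-2\alpha\sqrt{\frac\sigma b}\frac1x\Big),$$ where $b=b(\alpha,\sigma)$ is the unique solution $b>\sigma$ of $$\sigma+b-\frac{2\alpha}{\sqrt{\sigma b}}\ge 0,\qquad \frac34(b-\sigma)^2+\sigma(b-\sigma)+2\alpha\sqrt{\frac\sigma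 b}-2\alpha-2=0.$$ (4) If $\alpha=0$ and $\sigma\in\mathbb R$: (a) if $\sigma\ge-\sqrt2$, then $\nu^\sigma_0$ has support $]\sigma,b]$ with $b=\frac23\Big(\sqrt{\sigma^2+6}+\frac\sigma2\Big)$ and density $f_{0,\sigma}(x)=\frac1{2\pi}\sqrt{\frac{b-x}{x-\sigma}}\,(2x+b-\sigma)$; (b) if $\sigma\le-\sqrt2$, then $\nu^\sigma_0$ is the semicircle law with density $\frac1\pi\sqrt{2-x^2}$ on $[-\sqrt2,\sqrt2]$.
   Context: For a closed interval $\Sigma$ and a lower semicontinuous $Q:\Sigma\to(-\infty,+\infty]$ with $Q(x)-\log(1+x^2)\to+\infty$ as $|x|\to\infty$ (if $\Sigma$ is unbounded), the energy of a Borel probability measure $\mu$ on $\Sigma$ is $E_{Q,\Sigma}(\mu)=\iint\log\frac1{|x-y|}\,\mu(dx)\mu(dy)+\int Q\,d\mu$. The equilibrium measure associated to $(\Sigma,Q)$ is the unique probability measure on $\Sigma$ minimizing $E_{Q,\Sigma}$ (it has compact support). *)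

(* Defs.v *)
From HB Require Import structures.
From mathcomp Require Import all_boot all_order all_algebra.
From mathcomp Require Import all_classical all_reals all_analysis.
Set Implicit Arguments.
Unset Strict Implicit.
Unset Printing Implicit Defensive.
Import Order.TTheory GRing.Theory Num.Theory.
Import numFieldNormedType.Exports.
Local Open Scope classical_set_scope.
Local Open Scope ring_scope.

Section EquilibriumDefs.
Variable R : realType.

Definition log_kernel (x y : R) : \bar R :=
  if x == y then +oo%E else (- ln `|x - y|)%:E.

(* weighted kernel  log 1/|x-y| + Q(x)/2 + Q(y)/2 (bounded below) *)
Definition weighted_kernel (Q : R -> \bar R) (x y : R) : \bar R :=
  (log_kernel x y + Q x * (2^-1)%:E + Q y * (2^-1)%:E)%E.

Definition energy (Q : R -> \bar R) (mu : probability R R) : \bar R :=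
  (\int[mu \x mu]_z weighted_kernel Q z.1 z.2)%E.

Definition supported_on (S : set R) (mu : probability R R) : Prop :=
  mu (~` S) = 0%E.

Definition is_equilibrium_measure (Sig : set R) (Q : R -> \bar R)
    (mu : probability R R) : Prop :=
  supported_on Sig mu /\
  forall nu : probability R R, supported_on Sig nu -> (energy Q mu <= energy Q nu)%E.

Definition has_density (mu : probability R R) (S : set R) (f : R -> R) : Prop :=
  forall A : set R, measurable A ->
    mu A = (\int[lebesgue_measure]_(x in A `&` S) (f x)%:E)%E.

Definition equilibrium_has_density (Sig : set R) (Q : R -> \bar R)
    (S : set R) (f : R -> R) : Prop :=
  (exists mu, is_equilibrium_measure Sig Q mu) /\
  forall mu, is_equilibrium_measure Sig Q mu -> has_density mu S f.

Definition same_equilibrium (Sig1 Sig2 : set R) (Q : R -> \bar R) : Prop :=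
  (exists mu, is_equilibrium_measure Sig1 Q mu) /\
  (exists nu, is_equilibrium_measure Sig2 Q nu) /\
  forall mu nu, is_equilibrium_measure Sig1 Q mu ->
    is_equilibrium_measure Sig2 Q nu ->
    forall A : set R, measurable A -> mu A = nu A.

Definition Sigma (sigma : R) : set R := [set x | sigma <= x].

Definition Qalpha (alpha x : R) : \bar R :=
  if (alpha == 0) || (0 < x) then (x ^+ 2 - 2 * alpha * ln x)%:E else +oo%E.

Definition f_soft (alpha a b x : R) : R :=
  pi^-1 * Num.sqrt ((b - x) * (x - a)) * (1 + alpha / Num.sqrt (a * b) * x^-1).

Definition f_hard (alpha sigma b x : R) : R :=
  (2 * pi)^-1 * Num.sqrt ((b - x) / (x - sigma)) *
  (2 * x + b - sigma - 2 * alpha * Num.sqrt (sigma / b) * x^-1).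

Definition f_hard0 (sigma b x : R) : R :=
  (2 * pi)^-1 * Num.sqrt ((b - x) / (x - sigma)) * (2 * x + b - sigma).

Definition semicircle (x : R) : R := pi^-1 * Num.sqrt (2 - x ^+ 2).

End EquilibriumDefs.

(* Main.v *)
Require Import Defs.
From HB Require Import structures.
From mathcomp Require Import all_boot all_order all_algebra.
From mathcomp Require Import all_classical all_reals all_analysis.
From mathcomp Require Import measurable_realfun lebesgue_stieltjes_measure.
From mathcomp Require Import ring lra.
Import Order.TTheory GRing.Theory Num.Theory.
Import numFieldNormedType.Exports.
Local Open Scope classical_set_scope.
Local Open Scope ring_scope.

(** For probability measures with finite logarithmic energy,
    [-log |x - y|] is a superposition of tents [max (r - |x - y|) 0], and a tent
    integrated against a product measure is an integral of products of masses of
    sliding windows.  Hence the energy of a difference of two probability measures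
    is an integral of squares, vanishing only when they agree, and a measure
    satisfying the Euler-Lagrange conditions is the unique minimizer.

    The candidate with hard edge [sg] is a mixture, over [sg < s < b], of the
    arcsine laws of [[sg, s]] with signed weight
    [m s = (3 * s - sg) / 4 - al * sqrt sg / (2 * s * sqrt s)].
    The potential of an arcsine law is constant on [[sg, s]] and has derivative
    [1 / sqrt ((t - sg) * (t - s))] to the right of [s] and its opposite to the left
    of [sg], so the derivative of the potential of the mixture is an elementary
    integral in [s]: it equals [t - al / t] on []sg, b[], which is half the derivative
    of [Qalpha al], and differs from it elsewhere by a square root times
    [edge_slope t].
    The soft edge is the hard edge at which [edge_slope] vanishes: that makes
    [edge_slope t] nonpositive for [t < sg], so the Euler-Lagrange inequality also
    holds to the left of [sg]. *)

Set Implicit Arguments.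
Unset Strict Implicit.
Unset Printing Implicit Defensive.

(** The weight [m] solves an Abel equation. On the support the field at [t] comes only from the
    arcsine laws with [s < t], and [m] is the function whose integral against [1 / sqrt (t - s)]
    over [sg < s < t] equals [sqrt (t - sg) * (t - al / t)]. Neither the equation nor [m] involves
    [b]: the endpoint is only where the mixture stops, and the mass condition says that [m]
    integrates to 1 up to there. The obstacle is integrability, since [m] changes sign and the
    logarithm is unbounded in both directions. The signed mixture is therefore a difference of two
    nonnegative ones, the logarithm is made nonnegative by a majorant common to the two points
    compared, and only differences of potentials from the base point [sg] are computed, in which the
    additive constants of the arcsine potentials cancel. For competitors the confinement does this
    work: [Q] dominates a quadratic, so finite energy already forces an integrable logarithm, an
    integrable field and a null diagonal, which is what the expansion of the energy requires. *)

Section PointwiseDerivatives.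
Variable R : realType.
Implicit Types (f g : R -> R) (x a b : R).

(** * Pointwise derivatives and their automation *)

Lemma is_derive_addf f g x a b : is_derive x 1 f a -> is_derive x 1 g b ->
  is_derive x 1 (fun t => f t + g t) (a + b).
Proof. by move=> ? ?; exact: is_deriveD. Qed.

Lemma is_derive_oppf f x a : is_derive x 1 f a ->
  is_derive x 1 (fun t => - f t) (- a).
Proof. by move=> ?; exact: is_deriveN. Qed.

Lemma is_derive_mulf f g x a b : is_derive x 1 f a -> is_derive x 1 g b ->
  is_derive x 1 (fun t => f t * g t) (a * g x + f x * b).
Proof.
move=> fa gb; apply: (is_derive_eq (is_deriveM fa gb)).
by rewrite /GRing.scale /= addrC [g x * a]mulrC.
Qed.

Lemma is_derive_compf f g x a b : is_derive (g x) 1 f a -> is_derive x 1 g b ->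
  is_derive x 1 (fun t => f (g t)) (a * b).
Proof. by move=> ? ?; exact: (@is_derive1_comp R f g). Qed.

Lemma is_derive_invf f x a : f x != 0 -> is_derive x 1 f a ->
  is_derive x 1 (fun t => (f t)^-1) (- a / (f x) ^+ 2).
Proof.
move=> fx fa; apply: (is_derive_eq (is_deriveV fx fa)).
by rewrite /GRing.scale /= mulrC mulrN mulNr.
Qed.

Lemma is_derive_expf f n x a : is_derive x 1 f a ->
  is_derive x 1 (fun t => f t ^+ n.+1) (n.+1%:R * a * f x ^+ n).
Proof.
move=> fa; have := @is_derive_compf (fun u => u ^+ n.+1) f x
  (n.+1%:R * f x ^+ n) a _ fa.
rewrite mulrAC; apply; apply: DeriveDef; first exact: exprn_derivable.
by rewrite exp_derive /GRing.scale /= mulr1.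
Qed.

Lemma is_derive_lnf f x a : 0 < f x -> is_derive x 1 f a ->
  is_derive x 1 (fun t => ln (f t)) ((f x)^-1 * a).
Proof. by move=> fx ?; apply: is_derive_compf => //; exact: is_derive1_ln. Qed.

Lemma is_derive_sqrtf f x a : 0 < f x -> is_derive x 1 f a ->
  is_derive x 1 (fun t => Num.sqrt (f t)) ((2 * Num.sqrt (f x))^-1 * a).
Proof. by move=> fx ?; apply: is_derive_compf => //; exact: is_derive1_sqrt. Qed.

Lemma is_derive_sinf f x a : is_derive x 1 f a ->
  is_derive x 1 (fun t => sin (f t)) (cos (f x) * a).
Proof. by move=> ?; exact: is_derive_compf. Qed.

Lemma is_derive_cosf f x a : is_derive x 1 f a ->
  is_derive x 1 (fun t => cos (f t)) (- sin (f x) * a).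
Proof. by move=> ?; exact: is_derive_compf. Qed.

Lemma is_derive_atanf f x a : is_derive x 1 f a ->
  is_derive x 1 (fun t => atan (f t)) ((1 + (f x) ^+ 2)^-1 * a).
Proof. by move=> ?; exact: is_derive_compf. Qed.

Lemma is_derive_cstf (c : R) x : is_derive x 1 (fun=> c) 0.
Proof. exact: is_derive_cst. Qed.

Lemma is_derive_idf x : is_derive x 1 (fun t => t) 1.
Proof. exact: is_derive_id. Qed.

Lemma is_derive_eqf f x a b : is_derive x 1 f a -> a = b -> is_derive x 1 f b.
Proof. by move=> fa <-. Qed.

End PointwiseDerivatives.

(** The derivative is an evar filled in along the shape of the function; the conditions on inverses,
    logarithms and square roots are left as goals. [notypeclasses refine] keeps instance search on
    [is_derive] from choosing another form. *)
Ltac derive :=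
  lazymatch goal with
  | |- is_derive ?x _ (fun t => t) _ =>
      notypeclasses refine (@is_derive_idf _ x)
  | |- is_derive ?x _ (fun t => @?f t + @?g t) _ =>
      notypeclasses refine (@is_derive_addf _ f g x _ _ _ _); derive
  | |- is_derive ?x _ (fun t => - @?f t) _ =>
      notypeclasses refine (@is_derive_oppf _ f x _ _); derive
  | |- is_derive ?x _ (fun t => @?f t * @?g t) _ =>
      notypeclasses refine (@is_derive_mulf _ f g x _ _ _ _); derive
  | |- is_derive ?x _ (fun t => (@?f t)^-1) _ =>
      notypeclasses refine (@is_derive_invf _ f x _ _ _); [|derive]
  | |- is_derive ?x _ (fun t => (@?f t) ^+ ?n.+1) _ =>
      notypeclasses refine (@is_derive_expf _ f n x _ _); derive
  | |- is_derive ?x _ (fun t => ln (@?f t)) _ =>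
      notypeclasses refine (@is_derive_lnf _ f x _ _ _); [|derive]
  | |- is_derive ?x _ (fun t => Num.sqrt (@?f t)) _ =>
      notypeclasses refine (@is_derive_sqrtf _ f x _ _ _); [|derive]
  | |- is_derive ?x _ (fun t => sin (@?f t)) _ =>
      notypeclasses refine (@is_derive_sinf _ f x _ _); derive
  | |- is_derive ?x _ (fun t => cos (@?f t)) _ =>
      notypeclasses refine (@is_derive_cosf _ f x _ _); derive
  | |- is_derive ?x _ (fun t => atan (@?f t)) _ =>
      notypeclasses refine (@is_derive_atanf _ f x _ _); derive
  | |- is_derive ?x _ (fun=> ?c) _ =>
      first [notypeclasses refine (@is_derive_cstf _ c x) | idtac]
  | |- _ => idtac
  end.

Ltac derive_to := notypeclasses refine (@is_derive_eqf _ _ _ _ _ _ _); [derive|rewrite /=].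

(** * The fundamental theorem of calculus on closed and open intervals *)

Section FundamentalTheorem.
Variable R : realType.
Implicit Types (F f : R -> R) (a b : R).

Lemma is_derive_continuous f (x : R) a : is_derive x 1 f a -> {for x, continuous f}.
Proof.
by move=> [df _]; apply: differentiable_continuous; exact/derivable1_diffP.
Qed.

End FundamentalTheorem.

Ltac derive_continuous :=
  notypeclasses refine (@is_derive_continuous _ _ _ _ _); derive.

Section FundamentalTheorem.
Variable R : realType.
Implicit Types (F f : R -> R) (a b : R).
Local Notation leb := (@lebesgue_measure R).

Lemma FTC_cc F f a b : a <= b ->
  (forall x, a <= x <= b -> is_derive x 1 F (f x)) ->
  (forall x, a <= x <= b -> {for x, continuous f}) ->
  (\int[leb]_(x in `[a, b]) (f x)%:E = (F b - F a)%:E)%E.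
Proof.
rewrite le_eqVlt => /predU1P[<- _ _|ab dF cf].
  by rewrite set_itv1 integral_set1 subrr.
rewrite EFinB; apply: continuous_FTC2 => //.
- apply: continuous_in_subspaceT => x; rewrite inE/= in_itv/=; exact: cf.
- split.
  + move=> x; rewrite in_itv/= => /andP[ax xb].
    have h : a <= x <= b by rewrite !ltW.
    by have [] := dF x h.
  + apply: cvg_at_right_filter.
    by apply: (@is_derive_continuous _ F a (f a)); apply: dF; rewrite lexx ltW.
  + apply: cvg_at_left_filter.
    by apply: (@is_derive_continuous _ F b (f b)); apply: dF; rewrite lexx ltW.
- move=> x; rewrite in_itv/= => /andP[ax xb].
  have h : a <= x <= b by rewrite !ltW.
  by rewrite derive1E; have [_ ->] := dF x h.
Qed.

(** The integrand may blow up at the endpoints, as inverse square roots do, while its primitive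
    stays continuous there. Monotone convergence along an exhaustion by closed intervals reduces
    this to [FTC_cc]. *)
Lemma ge0_FTC_oo F f a b : a < b ->
  (forall x, a < x < b -> is_derive x 1 F (f x)) ->
  (forall x, a < x < b -> {for x, continuous f}) ->
  (forall x, a < x < b -> 0 <= f x) ->
  {for a, continuous F} -> {for b, continuous F} ->
  (\int[leb]_(x in `]a, b[) (f x)%:E = (F b - F a)%:E)%E.
Proof.
move=> ab dF cf f0 Fa Fb.
(* Starting the denominators at 3 keeps [a + e n] below [b - e n] from [n = 0] on. *)
pose e (n : nat) := (b - a) / n.+3%:R.
have ba0 : 0 < b - a by rewrite subr_gt0.
have e0 n : 0 < e n by rewrite divr_gt0.
have e3 n : e n * 3 <= b - a.
  by rewrite /e mulrAC ler_pdivrMr// ler_pM2l// ler_nat.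
have ecvg : e n @[n --> \oo] --> (0 : R).
  rewrite -(mulr0 (b - a)); apply: cvgMr.
  have := @cvg_harmonic R; rewrite -(cvg_shiftn 2) => h.
  by apply: cvg_trans h; apply: near_eq_cvg; near=> n; rewrite /= addn2.
pose I n := `[a + e n, b - e n]%classic.
have IU : `]a, b[%classic = \bigcup_n I n.
  apply/seteqP; split => x /=.
    rewrite in_itv/= => /andP[ax xb].
    have d0 : 0 < Num.min (x - a) (b - x) by rewrite lt_min !subr_gt0 ax.
    have /cvgrPdist_lt /(_ _ d0) [n _ /(_ n (leqnn n))] := ecvg.
    rewrite sub0r normrN gtr0_norm// lt_min => /andP[h1 h2].
    by exists n => //; rewrite /I/= in_itv/=; apply/andP; split; lra.
  move=> [n _]; rewrite /I/= !in_itv/= => /andP[h1 h2].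
  by have := e0 n; have := e3 n => h3 h4; apply/andP; split; lra.
have Isub n x : a + e n <= x <= b - e n -> a < x < b.
  by have := e0 n => h3 /andP[h1 h2]; apply/andP; split; lra.
have en n : a + e n <= b - e n by have := e3 n; have := e0 n; lra.
have h : (\int[leb]_(x in I n) (f x)%:E)%E @[n --> \oo] -->
         (\int[leb]_(x in `]a, b[) (f x)%:E)%E.
  rewrite IU; apply: ge0_nondecreasing_set_cvg_integral.
  - move=> m n mn; apply/subsetPset => x; rewrite /I/= !in_itv/= => /andP[h1 h2].
    have h3 : e n <= e m.
      by rewrite /e ler_pM2l// lef_pV2 ?posrE// ler_nat !ltnS.
    by apply/andP; split; lra.
  - by move=> n; exact: measurable_itv.
  - move=> n; apply/measurable_EFinP.
    have cI : {within I n, continuous f}.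
      apply: continuous_in_subspaceT => x; rewrite inE /I/= in_itv/= => hx.
      by apply: cf; exact: Isub hx.
    apply: subspace_continuous_measurable_fun; last exact: cI.
    exact: measurable_itv.
  - move=> n x; rewrite /I/= in_itv/= => hx.
    by rewrite lee_fin f0//; exact: Isub hx.
have h' : (\int[leb]_(x in I n) (f x)%:E)%E @[n --> \oo] --> (F b - F a)%:E.
  have Ie n : (\int[leb]_(x in I n) (f x)%:E =
      (F (b - e n) - F (a + e n))%:E)%E.
    exact: (FTC_cc (en n) (fun x hx => dF x (Isub n x hx))
      (fun x hx => cf x (Isub n x hx))).
  under eq_fun do rewrite Ie.
  apply: cvg_EFin; first exact: nearW.
  have hb : b - e n @[n --> \oo] --> b.
    by rewrite -[in X in _ --> X](subr0 b); apply: cvgB ecvg; exact: cvg_cst.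
  have ha : a + e n @[n --> \oo] --> a.
    by rewrite -[in X in _ --> X](addr0 a); apply: cvgD ecvg; exact: cvg_cst.
  apply: cvgB.
  - exact: (cvg_comp (fun n => b - e n) F hb Fb).
  - exact: (cvg_comp (fun n => a + e n) F ha Fa).
exact: (cvg_unique _ h h').
Unshelve. all: by end_near. Qed.

End FundamentalTheorem.

(** * Measurability of the elementary functions *)

Section RealMeasurability.
Context d (T : measurableType d) (R : realType).
Implicit Types (D : set T) (f g : T -> R).

Lemma measurable_sqrtr D f : measurable_fun D f ->
  measurable_fun D (fun x => Num.sqrt (f x)).
Proof.
move=> mf; apply: (measurableT_comp _ mf).
by apply: continuous_measurable_fun; exact: sqrt_continuous.
Qed.

Lemma measurable_invr D f : measurable_fun D f ->
  measurable_fun D (fun x => (f x)^-1).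
Proof.
move=> mf; apply: (measurableT_comp _ mf).
rewrite (_ : [set: R] = ([set 0] : set R) `|` ~` [set 0]); last by rewrite setUv.
have m0 : measurable ([set 0] : set R) by exact: measurable_set1.
apply/(measurable_funU _ m0 (measurableC m0)); split.
  exact: measurable_fun_set1.
apply: open_continuous_measurable_fun.
  rewrite (_ : ~` _ = [set x : R | x != 0]); first exact: open_neq.
  by apply/seteqP; split => x /= /eqP.
by move=> x; rewrite inE/= => /eqP x0; exact: inv_continuous.
Qed.

Lemma measurable_lnr D f : measurable_fun D f ->
  measurable_fun D (fun x => ln (f x)).
Proof. by move=> mf; apply: (measurableT_comp _ mf); exact: measurable_ln. Qed.

Lemma measurable_normr D f : measurable_fun D f ->
  measurable_fun D (fun x => `|f x|).
Proof. by move=> mf; apply: (measurableT_comp _ mf); exact: normr_measurable. Qed.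

Lemma measurable_sinr D f : measurable_fun D f ->
  measurable_fun D (fun x => sin (f x)).
Proof.
move=> mf; apply: (measurableT_comp _ mf).
by apply: continuous_measurable_fun; exact: continuous_sin.
Qed.

Lemma measurable_cosr D f : measurable_fun D f ->
  measurable_fun D (fun x => cos (f x)).
Proof.
move=> mf; apply: (measurableT_comp _ mf).
by apply: continuous_measurable_fun; exact: continuous_cos.
Qed.

End RealMeasurability.

(** * Affine changes of variables for Lebesgue measure *)

Section AffineSubstitution.
Variable R : realType.
Local Notation mR := (measurableTypeR R).
Local Notation leb := (@lebesgue_measure R).
Implicit Types (f : R -> \bar R) (c d : R).
Local Open Scope ereal_scope.

Let affine c d : mR -> mR := fun x : R => (c * x + d)%R.

Let measurable_affine c d : measurable_fun setT (affine c d).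
Proof.
apply: measurable_funD; last exact: measurable_cst.
by apply: measurable_funM; [exact: measurable_cst|exact: measurable_id].
Qed.

Let lebesgue_measure_unique_scale (P : {measure set mR -> \bar R}) (k : {nonneg R})
  (A : set R) : (forall X, ocitv X -> leb X = k%:num%:E * P X) -> measurable A ->
  leb A = k%:num%:E * P A.
Proof. by move=> h mA; exact: (@lebesgue_measure_unique R (mscale k P)). Qed.

(** By uniqueness of Lebesgue measure it is enough to treat intervals []a, b]]. A negative [c] turns
    them into intervals closed on the other side, which have the same length. *)
Lemma lebesgue_measure_affine c d (A : set R) : (c != 0)%R -> measurable A ->
  leb (affine c d @^-1` A) = `|c|^-1%:E * leb A.
Proof.
move=> c0 mA.
have c1 : (0 < `|c|)%R by rewrite normr_gt0.
pose k : {nonneg R} := NngNum (ltW c1).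
have -> : leb A = k%:num%:E * pushforward leb (affine c d) A; last first.
  by rewrite /= muleA -EFinM mulVf ?gt_eqF// mul1e.
apply: lebesgue_measure_unique_scale => //.
  move=> _ [[a b]] _ <-.
  rewrite /= /pushforward lebesgue_measure_itv/= lte_fin.
  have [ab|ab] := ltP a b; last first.
    rewrite (_ : _ @^-1` _ = set0) ?measure0 ?mule0//.
    apply/seteqP; split => x //=; rewrite /affine in_itv/= => /andP[h1 h2].
    by have := lt_le_trans h1 h2; rewrite ltNge ab.
  have [c2|c2] := ltP 0%R c.
    rewrite (_ : _ @^-1` _ = [set` `](a - d) / c, (b - d) / c]%R]).
      rewrite lebesgue_measure_itv/= lte_fin ltr_pM2r ?invr_gt0// ltrD2r ab.
      rewrite -EFinB -EFinM gtr0_norm//; congr EFin; field; exact/lt0r_neq0.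
    apply/seteqP; split => x/=; rewrite /affine !in_itv/=;
      by rewrite ltr_pdivrMr// ler_pdivlMr// ltrBlDr lerBrDr [(x * c)%R]mulrC.
  have c3 : (c < 0)%R by rewrite lt_neqAle c0.
  have c4 : (0 < - c)%R by rewrite oppr_gt0.
  rewrite (_ : _ @^-1` _ = [set` `[(b - d) / c, (a - d) / c[%R]).
    rewrite lebesgue_measure_itv/= lte_fin ltr_nM2r ?invr_lt0// ltrD2r ab.
    rewrite -EFinB -EFinM ltr0_norm//; congr EFin; field; exact/ltr0_neq0.
  apply/seteqP; split => x/=; rewrite /affine !in_itv/=;
    by rewrite ltr_ndivlMr// ler_ndivrMr// ltrBlDr lerBrDr [(x * c)%R]mulrC andbC.
Qed.

Lemma ge0_integral_affine f c d : (c != 0)%R -> measurable_fun setT f ->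
  (forall x, 0 <= f x) ->
  \int[leb]_x f (c * x + d)%R = `|c|^-1%:E * \int[leb]_x f x.
Proof.
move=> c0 mf f0.
have k0 : (0 <= `|c|^-1)%R by rewrite invr_ge0.
pose k : {nonneg R} := NngNum k0.
rewrite -(ge0_integral_mscale _ _ k)//.
have -> : \int[mscale k leb]_x f x = \int[pushforward leb (affine c d)]_x f x.
  apply: eq_measure_integral => A mA _.
  by rewrite /mscale/= /pushforward lebesgue_measure_affine.
rewrite (ge0_integral_pushforward (measurable_affine c d))//.
Qed.

End AffineSubstitution.

(** * Positive definiteness of the logarithmic kernel *)

Section Tents.
Variable R : realType.
Local Notation mR := (measurableTypeR R).
Local Notation leb := (@lebesgue_measure R).
Implicit Types (r u a b : R).

Definition tent r u : R := Num.max (r - u) 0.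

Lemma tent_ge0 r u : 0 <= tent r u.
Proof. by rewrite le_max lexx orbT. Qed.

Lemma tent_le r a b : a <= b -> tent r b <= tent r a.
Proof. by move=> ab; rewrite /tent ge_max !le_max lexx orbT andbT lerB. Qed.

Lemma measurable_tent d (T : measurableType d) (f g : T -> R) :
  measurable_fun setT f -> measurable_fun setT g ->
  measurable_fun setT (fun x => tent (f x) (g x)).
Proof.
move=> mf mg; apply: measurable_maxr; last exact: measurable_cst.
exact: measurable_funB.
Qed.

(** The integrand vanishes below [a], is [1 / r - a / r ^+ 2] on [[a, b]] and [(b - a) / r ^+ 2]
    beyond [b]. The last two pieces contribute [ln b - ln a + a / b - 1] and [1 - a / b]. *)
Lemma integral_tentB a b : 0 < a -> a <= b ->
  (\int[leb]_r (r^-1 ^+ 2 * (tent r a - tent r b))%:E = (ln b - ln a)%:E)%E.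
Proof.
move=> a0 ab; have b0 := lt_le_trans a0 ab.
pose f r := r^-1 ^+ 2 * (tent r a - tent r b).
have f0 r : 0 <= f r by rewrite mulr_ge0 ?sqr_ge0// subr_ge0 tent_le.
have mf : measurable_fun [set: mR] (EFin \o (f : mR -> R)).
  apply/measurable_EFinP; apply: measurable_funM.
    by apply: measurable_funX; exact: measurable_invr.
  by apply: measurable_funB; apply: measurable_tent => //.
have -> : (\int[leb]_r (f r)%:E = \int[leb]_(r in `[a, +oo[) (f r)%:E)%E.
  rewrite [RHS]integral_mkcond; apply: eq_integral => r _.
  rewrite patchE; case: ifPn => //; rewrite notin_setE/= in_itv/= andbT.
  move=> /negP; rewrite -ltNge => ra.
  by rewrite /f /tent !max_r ?subrr ?mulr0//; lra.
rewrite (_ : `[a, +oo[%classic = `[a, b]%classic `|` `]b, +oo[%classic); last first.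
  by rewrite -itv_bndbnd_setU.
rewrite ge0_integral_setU//=; last 3 first.
  exact: measurable_funTS.
  by move=> r _; rewrite lee_fin f0.
  apply/disj_setPS => r /=; rewrite !in_itv/= andbT => -[/andP[_ h1] h2].
  by have := le_lt_trans h1 h2; rewrite ltxx.
rewrite integral_itv_obnd_cbnd; last exact: measurable_funTS.
have -> : (\int[leb]_(r in `[a, b]) (f r)%:E = (ln b - ln a + a / b - 1)%:E)%E.
  transitivity (\int[leb]_(r in `[a, b]) (r^-1 - a * r^-1 ^+ 2)%:E)%E.
    apply: eq_integral => r; rewrite inE/= in_itv/= => /andP[ar rb]; congr EFin.
    have r0 : r != 0 by rewrite gt_eqF// (lt_le_trans a0).
    rewrite /f /tent max_l ?subr_ge0// max_r ?subr_le0//; by field.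
  apply: (etrans (@FTC_cc _ (fun r => ln r + a * r^-1) _ _ _ ab _ _)).
  - move=> r /andP[ar rb]; have r0 : 0 < r by exact: lt_le_trans ar.
    have rn : r != 0 by rewrite gt_eqF.
    by derive_to => //; field.
  - move=> r /andP[ar rb]; have r0 : 0 < r by exact: lt_le_trans ar.
    have rn : r != 0 by rewrite gt_eqF.
    by derive_continuous.
  - by congr EFin; field; rewrite !gt_eqF.
have -> : (\int[leb]_(r in `[b, +oo[) (f r)%:E = (1 - a / b)%:E)%E.
  transitivity (\int[leb]_(r in `[b, +oo[) ((b - a) * r^-1 ^+ 2)%:E)%E.
    apply: eq_integral => r; rewrite inE/= in_itv/= andbT => br; congr EFin.
    have r0 : r != 0 by rewrite gt_eqF// (lt_le_trans b0).
    rewrite /f /tent max_l ?max_l ?subr_ge0//; [by field|exact: le_trans ab br].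
  have d (x : R) : 0 < x -> is_derive x 1 (fun r => - (b - a) * r^-1) ((b - a) * x^-1 ^+ 2).
    move=> x0; have xn : x != 0 by rewrite gt_eqF.
    by derive_to => //; field.
  transitivity (0%:E - (- (b - a) * b^-1)%:E)%E; last first.
    by rewrite sub0e -EFinN; congr EFin; field; rewrite gt_eqF.
  pose F := fun r : R => - (b - a) * r^-1.
  have cf : {within `[b, +oo[, continuous (fun r : R => (b - a) * r^-1 ^+ 2)}.
    apply: continuous_in_subspaceT => x; rewrite inE/= in_itv/= andbT => bx.
    have x0 : 0 < x by exact: lt_le_trans bx.
    have xn : x != 0 by rewrite gt_eqF.
    by derive_continuous.
  have F0 : F x @[x --> +oo] --> (0 : R).
    rewrite -[X in _ --> X](mulr0 (- (b - a))); apply: cvgMr.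
    by apply/gtr0_cvgV0; [exists 0; split|exact: cvg_id].
  have dF (x : R) : b < x -> derivable F x 1.
    by move=> bx; have [] := d x (lt_trans b0 bx).
  have Fb : F x @[x --> b^'+] --> F b.
    by apply: cvg_at_right_filter; exact: is_derive_continuous (d b b0).
  have F' : {in `]b, +oo[, derive1 F =1 (fun r : R => (b - a) * r^-1 ^+ 2)}.
    move=> x; rewrite in_itv/= andbT => bx; rewrite derive1E.
    by have [_ ->] := d x (lt_trans b0 bx).
  apply: (ge0_continuous_FTC2y _ cf F0 dF Fb F') => x _.
  by rewrite mulr_ge0 ?subr_ge0// sqr_ge0.
by rewrite -EFinD; congr EFin; ring.
Qed.

(** Its integral over [r] is [- ln u] for [u > 0]; the term [tent r 1] makes the
    integral converge at infinity. *)
Definition log_tent r u : R := r^-1 ^+ 2 * (tent r u - tent r 1).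

Lemma measurable_log_tent d (T : measurableType d) (f g : T -> R) :
  measurable_fun setT f -> measurable_fun setT g ->
  measurable_fun setT (fun x => log_tent (f x) (g x)).
Proof.
move=> mf mg; apply: measurable_funM.
  by apply: measurable_funX; exact: measurable_invr.
by apply: measurable_funB; apply: measurable_tent => //.
Qed.

(** For fixed [u] the sign of [log_tent r u] is the same for all [r], so the absolute integral is
    the absolute value of the integral. This second part is the bound that Fubini needs later. *)
Lemma integral_log_tent u : 0 < u ->
  (\int[leb]_r (log_tent r u)%:E = (- ln u)%:E)%E /\
  (\int[leb]_r `|(log_tent r u)%:E| = `|ln u|%:E)%E.
Proof.
move=> u0; have [u1|u1] := leP u 1.
  have := integral_tentB u0 u1; rewrite ln1 sub0r => h; split => //.
  rewrite ler0_norm ?ln_le0// -h; apply: eq_integral => r _.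
  by rewrite gee0_abs// lee_fin mulr_ge0 ?sqr_ge0// subr_ge0 tent_le.
have := integral_tentB ltr01 (ltW u1); rewrite ln1 subr0 => h.
have e r : log_tent r u = - (r^-1 ^+ 2 * (tent r 1 - tent r u)).
  by rewrite /log_tent -mulrN opprB.
have p r : 0 <= r^-1 ^+ 2 * (tent r 1 - tent r u).
  by rewrite mulr_ge0 ?sqr_ge0// subr_ge0 tent_le// ltW.
split.
  under eq_integral do rewrite e EFinN.
  by rewrite integral_ge0N ?h ?EFinN// => r _; rewrite lee_fin.
rewrite ger0_norm ?ln_ge0 ?(ltW u1)// -h; apply: eq_integral => r _.
by rewrite e EFinN abseN gee0_abs// lee_fin.
Qed.

End Tents.

Section TentEnergy.
Context d (T : measurableType d) (R : realType) (P : probability T R).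
Local Notation mR := (measurableTypeR R).
Local Notation leb := (@lebesgue_measure R).
Variable phi : T -> R.
Hypotheses (mphi : measurable_fun setT phi) (phi0 : forall z, 0 <= phi z).

Lemma integrable_tent r : P.-integrable setT (fun z => (tent r (phi z))%:E).
Proof.
have mt : measurable_fun setT (EFin \o (fun z => tent r (phi z))).
  by apply/measurable_EFinP; apply: measurable_tent => //; exact: measurable_cst.
have := @finite_measure_integrable_cst _ _ _ P setT `|r| measurableT.
apply: le_integrable => // z _ /=.
rewrite lee_fin ger0_norm ?tent_ge0// ger0_norm ?normr_ge0// ge_max normr_ge0 andbT.
by rewrite (le_trans _ (ler_norm r))// lerBlDr lerDl.
Qed.

Definition mean_tent r : R := fine (\int[P]_z (tent r (phi z))%:E)%E.

Lemma integral_tentE r : (\int[P]_z (tent r (phi z))%:E = (mean_tent r)%:E)%E.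
Proof. by rewrite fineK//; apply: integrable_fin_num => //; exact: integrable_tent. Qed.

Lemma integral_log_tentE r :
  (\int[P]_z (log_tent r (phi z))%:E = (r^-1 ^+ 2 * (mean_tent r - tent r 1))%:E)%E.
Proof.
have i1 := integrable_tent r.
have i2 := @finite_measure_integrable_cst _ _ _ P setT (tent r 1) measurableT.
under eq_integral do rewrite /log_tent EFinM EFinB.
rewrite integralZl//; last exact: integrableB.
rewrite integralB//= integral_tentE integral_cst//.
rewrite (_ : (tent r 1)%:E * _ = (tent r 1)%:E)%E -?EFinB -?EFinM//.
by rewrite -[RHS]mule1; congr (_ * _)%E; exact: probability_setT.
Qed.

Hypotheses (phin0 : P [set z | phi z = 0] = 0%E)
  (lnphi : P.-integrable setT (fun z => (ln (phi z))%:E)).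

Let mlt : measurable_fun setT (fun w : T * mR => (log_tent w.2 (phi w.1))%:E).
Proof.
apply/measurable_EFinP; apply: measurable_log_tent; first exact: measurable_snd.
by apply: (measurableT_comp mphi); exact: measurable_fst.
Qed.

Let ae_phi : {ae P, forall z, 0 < phi z}.
Proof.
exists [set z | phi z = 0]; split => //.
  rewrite (_ : [set z | phi z = 0] = setT `&` phi @^-1` [set 0]); last first.
    by rewrite setTI.
  by apply: mphi => //; exact: measurable_set1.
by move=> z /= /negP; rewrite lt_neqAle phi0 andbT negbK => /eqP ->.
Qed.

(** Integrating the absolute value in [r] first leaves [|ln (phi z)|], which is integrable by
    hypothesis; the points with [phi z = 0], where [ln] has a default value, form a null set. *)
Lemma integrable_log_tent :
  (P \x leb)%E.-integrable setT (fun w : T * mR => (log_tent w.2 (phi w.1))%:E).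
Proof.
apply/(integrable12ltyP _ _ mlt).
have /integrableP[mln] := lnphi; apply: le_lt_trans.
apply: ae_ge0_le_integral => //.
- by move=> z _; exact: integral_ge0.
- apply: (@measurable_fun_fubini_tonelli_F _ _ _ _ _ leb
    (fun w : T * mR => `|(log_tent w.2 (phi w.1))%:E|%E)).
    exact: measurableT_comp mlt.
  by move=> ?; exact: abse_ge0.
- exact: measurableT_comp.
- apply: filterS ae_phi => z z0 _ /=.
  by have [_ ->] := integral_log_tent z0.
Qed.

(** One double integral in its two orders: over [r] first it gives [- ln (phi z)], over [z] first it
    gives averages of tents. *)
Lemma log_energy_tent :
  leb.-integrable setT (fun r => (r^-1 ^+ 2 * (mean_tent r - tent r 1))%:E) /\
  (\int[leb]_r (r^-1 ^+ 2 * (mean_tent r - tent r 1))%:E =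
   - \int[P]_z (ln (phi z))%:E)%E.
Proof.
have e : (fun r => (r^-1 ^+ 2 * (mean_tent r - tent r 1))%:E) =
         (fun r => \int[P]_z (log_tent r (phi z))%:E)%E.
  by apply/funext => r; rewrite integral_log_tentE.
rewrite e; split.
  apply/integrableP; split; first exact: (measurable_fubini_G integrable_log_tent).
  apply: le_lt_trans ((integrable21ltyP _ _ mlt).1 integrable_log_tent).
  have mabs : measurable_fun setT
      (fun w : T * mR => `|(log_tent w.2 (phi w.1))%:E|%E) by exact: measurableT_comp mlt.
  apply: ge0_le_integral => //=.
  - apply: measurableT_comp => //.
    exact: (measurable_fubini_G integrable_log_tent).
  - apply: (@measurable_fun_fubini_tonelli_G _ _ _ _ _ P
      (fun w : T * mR => `|(log_tent w.2 (phi w.1))%:E|%E)) => //.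
  - move=> r _; apply: le_abse_integral => //.
    by apply/measurable_EFinP; apply: measurable_log_tent.
have := Fubini integrable_log_tent => /= <-.
rewrite -integralN/=; last exact: integrable_add_def.
apply: ae_eq_integral => //=.
- exact: (measurable_fubini_F integrable_log_tent).
- by apply/measurable_EFinP; apply: measurable_funN; exact: measurable_lnr.
- by apply: filterS ae_phi => z z0 _ /=; have [-> _] := integral_log_tent z0.
Qed.

End TentEnergy.

Section PositiveDefinite.
Variable R : realType.
Local Notation mR := (measurableTypeR R).
Local Notation leb := (@lebesgue_measure R).
Implicit Types P Q : probability R R.

Definition dist (z : R * R) : R := `|z.1 - z.2|.

Lemma measurable_dist : measurable_fun setT dist.
Proof.
by apply: measurable_normr; apply: measurable_funB;
  [exact: measurable_fst|exact: measurable_snd].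
Qed.

(** Two windows of length [r] overlap on a set of measure [tent r `|x - y|]. *)
Definition window (r z x : R) : R := ((z - r <= x <= z)%R)%:R.

Lemma window_ge0 r z x : 0 <= window r z x. Proof. by rewrite /window ler0n. Qed.

Lemma window_le1 r z x : window r z x <= 1.
Proof. by rewrite /window; case: (_ && _) => //; rewrite ler01. Qed.

Lemma measurable_window d (T : measurableType d) r (f g : T -> R) :
  measurable_fun setT f -> measurable_fun setT g ->
  measurable_fun setT (fun x => window r (f x) (g x)).
Proof.
move=> mf mg; rewrite /window.
have -> : (fun x => ((f x - r <= g x <= f x)%R)%:R) =
          (fun x => ((f x - r <= g x)%R)%:R * ((g x <= f x)%R)%:R) :> (T -> R).
  by apply/funext => x; rewrite -natrM mulnb.
have mb (b : T -> bool) : measurable_fun setT b ->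
    measurable_fun setT (fun x => (b x)%:R : R).
  move=> mb; have -> : (fun x => (b x)%:R) = (fun x => if b x then 1 else 0) :> (T -> R).
    by apply/funext => x; case: (b x).
  by apply: measurable_fun_ifT => //; exact: measurable_cst.
apply: measurable_funM; apply: mb; apply: measurable_fun_ler => //.
by apply: measurable_funB => //; exact: measurable_cst.
Qed.

Definition mass P (r z : R) : R := fine (\int[P]_x (window r z x)%:E)%E.

Lemma integral_window P r z : (\int[P]_x (window r z x)%:E = (mass P r z)%:E)%E.
Proof.
rewrite fineK//; apply: integrable_fin_num => //.
have mt : measurable_fun setT (EFin \o (window r z)).
  apply/measurable_EFinP; apply: measurable_window => //; exact: measurable_cst.
have := @finite_measure_integrable_cst _ _ _ P setT 1 measurableT.
apply: le_integrable => // x _ /=.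
by rewrite lee_fin ger0_norm ?window_ge0// normr1 window_le1.
Qed.

Lemma massE P r z : P `[z - r, z]%classic = (mass P r z)%:E.
Proof.
rewrite -integral_window (_ : (fun x => _) = (fun x => (\1_(`[z - r, z]%classic) x)%:E)).
  by rewrite integral_indic// setIT.
by apply/funext => x; rewrite indicE /window mem_setE in_itv.
Qed.

Lemma mass_ge0 P r z : 0 <= mass P r z.
Proof. by rewrite -lee_fin -massE measure_ge0. Qed.

Lemma measurable_mass P r : measurable_fun [set: mR] (mass P r).
Proof.
apply/measurable_EFinP; rewrite (_ : _ \o _ = fun z => (\int[P]_x (window r z x)%:E)%E).
  apply: (@measurable_fun_fubini_tonelli_F _ _ mR R R P
    (fun w : mR * R => (window r w.1 w.2)%:E)).
    by apply/measurable_EFinP; apply: measurable_window;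
      [exact: measurable_fst|exact: measurable_snd].
  by move=> w; rewrite lee_fin window_ge0.
by apply/funext => z; rewrite integral_window.
Qed.

Lemma tent_window r x y :
  (\int[leb]_z (window r z x * window r z y)%:E = (tent r `|x - y|)%:E)%E.
Proof.
have -> : (fun z => (window r z x * window r z y)%:E) =
    (fun z => (\1_(`[Num.max x y, Num.min x y + r]%classic) z)%:E).
  apply/funext => z; rewrite indicE /window -natrM mulnb mem_setE in_itv/=.
  congr (_%:R%:E); congr nat_of_bool.
  rewrite ge_max -lerBlDr le_min !andbA.
  by case: (z - r <= x); case: (z - r <= y); case: (x <= z); case: (y <= z).
rewrite integral_indic//= setIT lebesgue_measure_itv/= lte_fin.
have -> : tent r `|x - y| = Num.max (Num.min x y + r - Num.max x y) 0.
  rewrite /tent; congr Num.max; have [xy|xy] := leP x y.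
    by rewrite ler0_norm ?subr_le0//; ring.
  by rewrite gtr0_norm ?subr_gt0//; ring.
set M := Num.max x y; set m := Num.min x y.
case: (ltP M (m + r)) => h; first by rewrite -EFinB max_l// subr_ge0 ltW.
by rewrite max_r// subr_le0.
Qed.

Lemma tent_mass P Q r :
  (\int[P \x Q]_z (tent r (dist z))%:E = \int[leb]_z (mass P r z * mass Q r z)%:E)%E.
Proof.
have mt : measurable_fun setT (fun z => (tent r (dist z))%:E).
  apply/measurable_EFinP; apply: measurable_tent; first exact: measurable_cst.
  exact: measurable_dist.
rewrite (@fubini_tonelli1 _ _ _ _ _ P Q)//; last first.
  by move=> z; rewrite lee_fin tent_ge0.
rewrite /fubini_F /dist /=.
under eq_integral => x _ do under eq_integral => y _ do rewrite -tent_window.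
have inner x : (\int[Q]_y \int[leb]_z (window r z x * window r z y)%:E =
    \int[leb]_z (window r z x * mass Q r z)%:E)%E.
  have := @fubini_tonelli _ _ R mR R Q leb
    (fun w : R * mR => (window r w.2 x * window r w.2 w.1)%:E) => /= ->.
  - apply: eq_integral => z _.
    under eq_integral do rewrite EFinM.
    rewrite ge0_integralZl//=.
    + by rewrite integral_window.
    + apply/measurable_EFinP; apply: measurable_window => //; exact: measurable_cst.
    + by move=> y _; rewrite lee_fin window_ge0.
    + by rewrite lee_fin window_ge0.
  - apply/measurable_EFinP; apply: measurable_funM; apply: measurable_window.
    + exact: measurable_snd.
    + exact: measurable_cst.
    + exact: measurable_snd.
    + exact: measurable_fst.
  - by move=> w; rewrite lee_fin mulr_ge0// window_ge0.
under eq_integral do rewrite inner.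
have := @fubini_tonelli _ _ R mR R P leb
    (fun w : R * mR => (window r w.2 w.1 * mass Q r w.2)%:E) => /= ->.
- apply: eq_integral => z _.
  under eq_integral do rewrite EFinM.
  rewrite ge0_integralZr//=.
  + by rewrite integral_window.
  + apply/measurable_EFinP; apply: measurable_window => //; exact: measurable_cst.
  + by move=> y _; rewrite lee_fin window_ge0.
  + by rewrite lee_fin mass_ge0.
- apply/measurable_EFinP; apply: measurable_funM.
    by apply: measurable_window; [exact: measurable_snd|exact: measurable_fst].
  by apply: (measurableT_comp (measurable_mass Q r)); exact: measurable_snd.
- by move=> w; rewrite lee_fin mulr_ge0// ?window_ge0 ?mass_ge0.
Qed.

Lemma measure_dist0 P Q : (forall x, Q [set x] = 0%E) ->
  (P \x Q)%E [set z | dist z = 0] = 0%E.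
Proof.
move=> Q0; rewrite /product_measure1 integral0_eq// => x _ /=.
rewrite (_ : xsection _ x = [set x])//; apply/seteqP; split => y /=.
  by rewrite /xsection/= inE/= /dist/= => /normr0_eq0/eqP; rewrite subr_eq0 => /eqP.
by move=> ->; rewrite /xsection/= inE/= /dist/= subrr normr0.
Qed.

Section Pair.
Variables P Q : probability R R.
Let PQ : probability (R * R)%type R := [the probability _ _ of (P \x Q)%E].

(** Since [ln 0 = 0], integrability alone would overlook mass on the diagonal, where the logarithmic
    kernel is infinite; the second clause excludes it. *)
Definition log_integrable :=
  PQ.-integrable setT (fun z => (ln (dist z))%:E) /\ PQ [set z | dist z = 0] = 0%E.

(** The sign is that of [ln], opposite to the usual logarithmic energy. *)
Definition log_energy : R := fine (\int[PQ]_z (ln (dist z))%:E)%E.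

Definition overlap (r : R) : R := mean_tent PQ dist r.

Lemma overlapE r : (\int[leb]_z (mass P r z * mass Q r z)%:E = (overlap r)%:E)%E.
Proof.
rewrite -tent_mass /overlap -integral_tentE//; first exact: measurable_dist.
by move=> z; exact: normr_ge0.
Qed.

Lemma log_energy_overlap : log_integrable ->
  leb.-integrable setT (fun r => (r^-1 ^+ 2 * (overlap r - tent r 1))%:E) /\
  (\int[leb]_r (r^-1 ^+ 2 * (overlap r - tent r 1))%:E = (- log_energy)%:E)%E.
Proof.
move=> [il d0].
have [i e] := log_energy_tent measurable_dist (fun z => normr_ge0 _) d0 il.
split => //; rewrite e EFinN /log_energy fineK//; exact: integrable_fin_num.
Qed.

End Pair.

Lemma overlapC P Q r : overlap P Q r = overlap Q P r.
Proof.
apply: (@EFin_inj R); rewrite -!overlapE; apply: eq_integral => z _.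
by rewrite mulrC.
Qed.

Lemma ae_exists (A : R -> Prop) a b : a < b -> {ae leb, forall x, A x} ->
  exists2 x, a < x < b & A x.
Proof.
move=> ab [N [mN N0 sN]]; apply: contrapT => h.
have : (leb `]a, b[%classic <= leb N)%E.
  apply: le_measure; rewrite ?inE//.
  move=> x /=; rewrite in_itv/= => xab; apply: sN => /= Ax; apply: h.
  by exists x.
by rewrite N0 lebesgue_measure_itv/= lte_fin ab -EFinB lee_fin subr_le0 leNgt ab.
Qed.

Let gap P Q r := overlap P P r + overlap Q Q r - 2 * overlap P Q r.

(** [gap] is the squared L2 distance between the two window-mass functions. Its three terms are
    separately finite, so the square may be expanded under the integral. *)
Let gapE P Q r : 0 <= gap P Q r /\
  (gap P Q r = 0 -> {ae leb, forall z, mass P r z = mass Q r z}).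
Proof.
have mf P' Q' : measurable_fun [set: mR] (EFin \o (fun z => mass P' r z * mass Q' r z)).
  by apply/measurable_EFinP; apply: measurable_funM; exact: measurable_mass.
have ip P' Q' : leb.-integrable setT (EFin \o (fun z => mass P' r z * mass Q' r z)).
  apply/integrableP; split => //=.
  under eq_integral do rewrite ger0_norm ?mulr_ge0 ?mass_ge0//.
  by rewrite overlapE ltry.
have e : (\int[leb]_z ((mass P r z - mass Q r z) ^+ 2)%:E = (gap P Q r)%:E)%E.
  transitivity (\int[leb]_z ((mass P r z * mass P r z)%:E + (mass Q r z * mass Q r z)%:E
     - 2%:E * (mass P r z * mass Q r z)%:E))%E.
    apply: eq_integral => z _.
    have h : (mass P r z - mass Q r z) ^+ 2 = mass P r z * mass P r z +
      mass Q r z * mass Q r z - 2 * (mass P r z * mass Q r z) by ring.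
    exact: (congr1 EFin h).
  rewrite integralB//=; last 2 first.
    by apply: integrableD => //; exact: ip.
    by apply: integrableZl => //; exact: ip.
  rewrite integralD//=; [|exact: ip|exact: ip].
  by rewrite integralZl//= ?overlapE//; exact: ip.
split; first by rewrite -lee_fin -e integral_ge0// => z _; rewrite lee_fin sqr_ge0.
move=> g0; move: e; rewrite g0 => e.
have mg : measurable_fun [set: mR] (EFin \o (fun z => (mass P r z - mass Q r z) ^+ 2)).
  apply/measurable_EFinP; apply: measurable_funX; apply: measurable_funB;
    exact: measurable_mass.
have /(ae_eq_integral_abs leb measurableT mg) : (\int[leb]_z
    `|((mass P r z - mass Q r z) ^+ 2)%:E| = 0)%E.
  by under eq_integral do rewrite gee0_abs ?lee_fin ?sqr_ge0//.
apply: filterS => z /(_ I) /= [/eqP].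
by rewrite sqrf_eq0 subr_eq0 => /eqP.
Qed.

Let nat_gt (y : R) : exists n : nat, y < n%:R.
Proof.
by exists (Num.bound `|y|); rewrite (le_lt_trans (ler_norm y))// archi_boundP.
Qed.

Lemma probability_eq P Q :
  (forall x, P `]-oo, x]%classic <= Q `]-oo, x]%classic)%E ->
  (forall x, Q `]-oo, x]%classic <= P `]-oo, x]%classic)%E ->
  forall A, measurable A -> P A = Q A.
Proof.
move=> PQ QP; have PQE x : P `]-oo, x]%classic = Q `]-oo, x]%classic.
  by apply/eqP; rewrite eq_le PQ QP.
have mE : @measurable _ R = <<s @RGenOInfty.G R >> by exact: RGenOInfty.measurableE.
apply: (@measure_unique _ R R _ (fun k => `](- k%:R)%R, +oo[%classic) mE _ _ _ P Q).
- move=> _ _ [x ->] [y ->]; exists (Num.max x y).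
  by apply/seteqP; split => z /=; rewrite !in_itv/= !andbT gt_max;
    [move=> [-> ->]|move=> /andP].
- by move=> k; eexists; reflexivity.
- rewrite -subTset => x _; have [k kx] := nat_gt (- x).
  by exists k => //=; rewrite in_itv/= andbT ltrNl.
- have PC P' x : P' `]x, +oo[%classic = (1 - P' `]-oo, x]%classic)%E.
    by rewrite -setCitvl probability_setC.
  move=> _ [x ->]; transitivity (1 - P `]-oo, x]%classic)%E; first exact: PC.
  by rewrite PQE; apply/esym; exact: PC.
- by move=> k; rewrite (le_lt_trans (probability_le1 _ _))// ltry.
Qed.

Let cvg_ray P (x : R) : P `[x - n%:R, x]%classic @[n --> \oo] --> P `]-oo, x]%classic.
Proof.
have -> : `]-oo, x]%classic = \bigcup_n `[x - n%:R, x]%classic.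
  apply/seteqP; split => z /=; rewrite ?in_itv/=.
    move=> zx; have [n nz] := nat_gt (x - z).
    by exists n => //=; rewrite in_itv/= zx andbT; lra.
  by move=> [n _] /=; rewrite in_itv/= => /andP[].
apply: nondecreasing_cvg_mu.
- by move=> n; exact: measurable_itv.
- by apply: bigcup_measurable => n _; exact: measurable_itv.
- move=> m n mn; apply/subsetPset => z /=; rewrite !in_itv/= => /andP[h ->].
  by rewrite andbT (le_trans _ h)// lerB// ler_nat.
Qed.

Let cvg_ray_right P (x : R) :
  P `]-oo, x + n.+1%:R^-1]%classic @[n --> \oo] --> P `]-oo, x]%classic.
Proof.
have -> : `]-oo, x]%classic = \bigcap_n `]-oo, x + n.+1%:R^-1]%classic.
  apply/seteqP; split => z /=; rewrite ?in_itv/=.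
    by move=> zx n _; rewrite /= in_itv/= (le_trans zx)// lerDl.
  move=> h; rewrite leNgt; apply/negP => xz.
  have /ltr_add_invr[k hk] := xz.
  by have := h k I; rewrite /= in_itv/= leNgt hk.
apply: nonincreasing_cvg_mu.
- by rewrite (le_lt_trans (probability_le1 _ _))// ltry.
- by move=> n; exact: measurable_itv.
- by apply: bigcap_measurable => // n _; exact: measurable_itv.
- move=> m n mn; apply/subsetPset => z /=; rewrite !in_itv/= => h.
  by rewrite (le_trans h)// lerD2l lef_pV2 ?posrE// ler_nat ltnS.
Qed.

(** Window masses agree for almost every [r > 0] and then almost every [z]. Choosing such an [r] in
    []n + e, n + e + 1[] and such a [z] in []x, x + e[] places the window between [[x - n, x]] and
    the ray up to [x + e]. Let [n] tend to infinity, then [e] to 0 by right continuity of the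
    distribution function. *)
Let gap_null_le P Q : {ae leb, forall r, 0 < r -> gap P Q r = 0} ->
  forall x, (P `]-oo, x]%classic <= Q `]-oo, x]%classic)%E.
Proof.
move=> g0 x.
have step (e : R) : 0 < e -> (P `]-oo, x]%classic <= Q `]-oo, (x + e)%R]%classic)%E.
  move=> e0; rewrite -(cvg_lim _ (@cvg_ray P x))//; apply: lime_le.
    by apply/cvg_ex; eexists; exact: cvg_ray.
  apply: nearW => n.
  have [|r /andP[nr _] gr] := @ae_exists _ (n%:R + e) (n%:R + e + 1) _ g0.
    by rewrite ltrDl.
  have n0 : 0 <= n%:R :> R by rewrite ler0n.
  have r0 : 0 < r by lra.
  have [_ /(_ (gr r0)) hz] := gapE P Q r.
  have [|z /andP[xz ze] mz] := @ae_exists _ x (x + e) _ hz; first by rewrite ltrDl.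
  apply: (@le_trans _ _ (P `[z - r, z]%classic)).
    apply: le_measure; rewrite ?inE//; try exact: measurable_itv.
    by move=> y /=; rewrite !in_itv/= => /andP[h1 h2]; apply/andP; split; lra.
  rewrite massE mz -massE; apply: le_measure; rewrite ?inE//; try exact: measurable_itv.
  by move=> y /=; rewrite !in_itv/= => /andP[h1 h2]; lra.
rewrite -[leRHS](cvg_lim _ (@cvg_ray_right Q x))//; apply: lime_ge.
  by apply/cvg_ex; eexists; exact: cvg_ray_right.
by apply: nearW => n; apply: step.
Qed.

Theorem log_energy_pos_def P Q :
  log_integrable P P -> log_integrable Q Q -> log_integrable P Q ->
  0 <= 2 * log_energy P Q - log_energy P P - log_energy Q Q /\
  (2 * log_energy P Q - log_energy P P - log_energy Q Q <= 0 ->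
   forall A, measurable A -> P A = Q A).
Proof.
move=> /log_energy_overlap[iPP ePP] /log_energy_overlap[iQQ eQQ]
  /log_energy_overlap[iPQ ePQ].
(* The normalizing terms [tent r 1] cancel because the coefficients [1 + 1 - 2] sum to zero, that
   is, because the two measures have the same total mass. *)
have gap_split r : r^-1 ^+ 2 * gap P Q r = r^-1 ^+ 2 * (overlap P P r - tent r 1) +
    r^-1 ^+ 2 * (overlap Q Q r - tent r 1)
    - 2 * (r^-1 ^+ 2 * (overlap P Q r - tent r 1)) by rewrite /gap; ring.
have e : (\int[leb]_r (r^-1 ^+ 2 * gap P Q r)%:E =
    (2 * log_energy P Q - log_energy P P - log_energy Q Q)%:E)%E.
  transitivity (\int[leb]_r ((r^-1 ^+ 2 * (overlap P P r - tent r 1))%:E +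
     (r^-1 ^+ 2 * (overlap Q Q r - tent r 1))%:E
     - 2%:E * (r^-1 ^+ 2 * (overlap P Q r - tent r 1))%:E))%E.
    by apply: eq_integral => r _; exact: (congr1 EFin (gap_split r)).
  rewrite integralB//=; last 2 first.
    exact: integrableD.
    exact: integrableZl.
  rewrite integralD//= integralZl//= ePP eQQ ePQ.
  have h : - log_energy P P + - log_energy Q Q - 2 * - log_energy P Q =
    2 * log_energy P Q - log_energy P P - log_energy Q Q by ring.
  exact: (congr1 EFin h).
have p0 r : 0 <= r^-1 ^+ 2 * gap P Q r.
  by rewrite mulr_ge0 ?sqr_ge0//; have [] := gapE P Q r.
split; first by rewrite -lee_fin -e integral_ge0// => r _; rewrite lee_fin.
move=> h0.
have mg : measurable_fun [set: mR] (EFin \o (fun r => r^-1 ^+ 2 * gap P Q r)).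
  rewrite (_ : _ \o _ = fun r => (r^-1 ^+ 2 * (overlap P P r - tent r 1))%:E +
     (r^-1 ^+ 2 * (overlap Q Q r - tent r 1))%:E
     - 2%:E * (r^-1 ^+ 2 * (overlap P Q r - tent r 1))%:E)%E.
    apply: emeasurable_funB.
      by apply: emeasurable_funD; [case/integrableP: iPP|case/integrableP: iQQ].
    by apply: measurable_funeM; case/integrableP: iPQ.
  by apply/funext => r; exact: (congr1 EFin (gap_split r)).
have g0 : {ae leb, forall r, 0 < r -> gap P Q r = 0}.
  have /(ae_eq_integral_abs leb measurableT mg) :
      (\int[leb]_r `|(r^-1 ^+ 2 * gap P Q r)%:E| = 0)%E.
    under eq_integral do rewrite gee0_abs ?lee_fin//.
    apply/eqP; rewrite eq_le integral_ge0 ?andbT; last by move=> r _; rewrite lee_fin.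
    by rewrite e lee_fin.
  apply: filterS => r /(_ I) /= [/eqP] + r0.
  by rewrite mulf_eq0 sqrf_eq0 invr_eq0 gt_eqF//= => /eqP.
apply: probability_eq; apply: gap_null_le => //.
rewrite (_ : gap Q P = gap P Q)//; apply/funext => r.
by rewrite /gap (overlapC Q P); ring.
Qed.

End PositiveDefinite.

Lemma integral_probability_cst d (T : measurableType d) (R : realType)
  (P : probability T R) (r : R) : (\int[P]_x r%:E = r%:E)%E.
Proof.
rewrite (integral_cst P measurableT) -[RHS]mule1.
by congr (_ * _)%E; exact: probability_setT.
Qed.

(** * The energy functional and the Euler-Lagrange criterion *)

Section Equilibrium.
Variable R : realType.
Implicit Types (P nu mu : probability R R) (Q : R -> \bar R).

Lemma ln_le_self (x : R) : 0 < x -> ln x <= x.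
Proof. by move=> x0; exact/ltW/ln_sublinear. Qed.

Lemma norm_ln_le (x : R) : 0 < x -> `|ln x| <= - ln x + 2 * x.
Proof.
move=> x0; have [l0|l0] := leP (ln x) 0; first by rewrite ler0_norm//; lra.
by rewrite gtr0_norm//; have := ln_le_self x0; lra.
Qed.

Lemma integral_prod_fst P P' (f : R -> \bar R) : measurable_fun setT f ->
  (forall x, 0 <= f x)%E -> (\int[P \x P']_z f z.1 = \int[P]_x f x)%E.
Proof.
move=> mf f0; rewrite (@fubini_tonelli1 _ _ _ _ _ P P' (fun z => f z.1))//; last first.
  by apply: (measurableT_comp mf); exact: measurable_fst.
rewrite /fubini_F; apply: eq_integral => x _ /=.
rewrite (integral_cst _ measurableT)//.
by rewrite -[RHS]mule1; congr (_ * _)%E; exact: probability_setT.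
Qed.

Lemma integral_prod_snd P P' (f : R -> \bar R) : measurable_fun setT f ->
  (forall x, 0 <= f x)%E -> (\int[P \x P']_z f z.2 = \int[P']_x f x)%E.
Proof.
move=> mf f0; rewrite (@fubini_tonelli1 _ _ _ _ _ P P' (fun z => f z.2))//; last first.
  by apply: (measurableT_comp mf); exact: measurable_snd.
rewrite /fubini_F /= (integral_cst P measurableT).
by rewrite -[RHS]mule1; congr (_ * _)%E; exact: probability_setT.
Qed.

Lemma measurable_log_kernel :
  measurable_fun setT (fun z : R * R => log_kernel z.1 z.2).
Proof.
rewrite /log_kernel; apply: measurable_fun_ifT.
- by apply: measurable_fun_eqr; [exact: measurable_fst|exact: measurable_snd].
- exact: measurable_cst.
- apply/measurable_EFinP; apply: measurable_funN; apply: measurable_lnr.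
  exact: measurable_dist.
Qed.

Section Energy.
Variables (Q : R -> \bar R) (c : R).
Hypotheses (mQ : measurable_fun setT Q)
  (Qc : forall x, ((x ^+ 2 / 2 - c)%:E <= Q x)%E).

Let Qshift x : \bar R := (Q x + c%:E)%E.

Let Qshift_ge0 x : (0 <= Qshift x)%E.
Proof.
rewrite /Qshift -leeBlDr// sub0e -EFinN (le_trans _ (Qc x))// lee_fin.
by rewrite lerDr ?lerBrDr ?addNr divr_ge0// sqr_ge0.
Qed.

Let measurable_Qshift : measurable_fun setT Qshift.
Proof. by apply: emeasurable_funD. Qed.

Let mWK : measurable_fun setT (fun z : R * R => weighted_kernel Q z.1 z.2).
Proof.
have mf : measurable_fun setT (fun z : R * R => Q z.1).
  by apply: (measurableT_comp mQ); exact: measurable_fst.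
have ms : measurable_fun setT (fun z : R * R => Q z.2).
  by apply: (measurableT_comp mQ); exact: measurable_snd.
rewrite /weighted_kernel; apply: emeasurable_funD; last first.
  by apply: emeasurable_funM => //.
apply: emeasurable_funD; first exact: measurable_log_kernel.
by apply: emeasurable_funM => //.
Qed.

(** Half of the confinement absorbs the logarithm at large distances. For [d = |x - y|],
    [|ln d| <= - ln d + 2 * d] and [d <= |x| + |y|], while [(Q t + c) / 4 >= t ^+ 2 / 8 >= 2 * |t| -
    8] for [t = x] and for [t = y]; the two 8 make up the 16. *)
Let weighted_kernel_ge (z : R * R) :
  (`|(ln (dist z))%:E| + Qshift z.1 * (4^-1)%:E + Qshift z.2 * (4^-1)%:E <=
   weighted_kernel Q z.1 z.2 + (c + 16)%:E)%E.
Proof.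
case: z => x y /=; rewrite /weighted_kernel /log_kernel /Qshift /dist/=.
have h2 : (0 < (2^-1 : R)%:E)%E by rewrite lte_fin invr_gt0.
have := Qc x; have := Qc y.
case: (Q x) => [qx| |]; case: (Q y) => [qy| |] //= hy hx; case: (eqVneq x y) => xy;
  rewrite ?gt0_mulye ?gt0_mulNye//= ?addey ?addye// ?leey//.
rewrite -!EFinM -!EFinD lee_fin.
move: hx hy; rewrite !lee_fin => hx hy.
have d0 : 0 < `|x - y| by rewrite normr_gt0 subr_eq0.
have h := norm_ln_le d0; have ht := ler_normB x y.
have sq t : 0 <= t ^+ 2 / 8 - 2 * `|t| + 8 :> R.
  rewrite -[t ^+ 2](real_normK (num_real t)).
  have := sqr_ge0 (`|t| - 8); set s := `|t|; nra.
have := sq x; have := sq y; lra.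
Qed.

(** The kernel is bounded below, so energy below [+oo] makes it integrable, and then
    [weighted_kernel_ge] dominates the logarithm and the field separately. *)
Lemma finite_energyP nu : (energy Q nu < +oo)%E ->
  log_integrable nu nu /\ nu.-integrable setT Q.
Proof.
pose W z := weighted_kernel Q z.1 z.2.
pose NN : probability (R * R)%type R := [the probability _ _ of (nu \x nu)%E].
rewrite /energy -/W => E.
have mW : measurable_fun setT W by exact: mWK.
pose h z := (`|(ln (dist z))%:E| + Qshift z.1 * (4^-1)%:E + Qshift z.2 * (4^-1)%:E)%E.
have h0 z : (0 <= h z)%E by rewrite /h !adde_ge0// mule_ge0.
have hW z : (h z <= W z + (c + 16)%:E)%E by exact: weighted_kernel_ge.
have ml : measurable_fun setT (fun z : R * R => (ln (dist z))%:E).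
  by apply/measurable_EFinP; apply: measurable_lnr; exact: measurable_dist.
have m1 : measurable_fun setT (fun z : R * R => Qshift z.1 * (4^-1)%:E)%E.
  by apply: emeasurable_funM => //; apply: (measurableT_comp measurable_Qshift);
    exact: measurable_fst.
have m2 : measurable_fun setT (fun z : R * R => Qshift z.2 * (4^-1)%:E)%E.
  by apply: emeasurable_funM => //; apply: (measurableT_comp measurable_Qshift);
    exact: measurable_snd.
have mh : measurable_fun setT h.
  apply: emeasurable_funD => //; apply: emeasurable_funD => //.
  exact: measurableT_comp.
have Wneg : (\int[NN]_z W^\- z < +oo)%E.
  apply: (@le_lt_trans _ _ (\int[NN]_z `|c + 16|%:E)%E).
    apply: ge0_le_integral => //=.
    - exact: measurable_funeneg.
    - move=> z _; rewrite funenegE ge_max lee_fin normr_ge0 andbT.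
      have := le_trans (h0 z) (hW z); case: (W z) => [w| |] //=; rewrite ?leNye//.
      by rewrite !lee_fin => hw; rewrite (le_trans _ (ler_norm _))//; lra.
  by rewrite integral_probability_cst ltry.
have iW : NN.-integrable setT W.
  apply/integrableP; split => //.
  have -> : (\int[NN]_z `|W z| = \int[NN]_z (W^\+ z + W^\- z))%E.
    by apply: eq_integral => z _; rewrite -[LHS]/((abse \o W) z) fune_abse.
  rewrite ge0_integralD//=; [|exact: measurable_funepos|exact: measurable_funeneg].
  rewrite lte_add_pinfty//.
  have E' : (\int[NN]_z W^\+ z - \int[NN]_z W^\- z < +oo)%E.
    by rewrite -integralE; exact: E.
  have n0 : (0 <= \int[NN]_z W^\- z)%E by exact: integral_ge0.
  move: E' Wneg n0; case: (\int[NN]_z W^\- z)%E => [r| |]//.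
  suff : (\int[NN]_z W^\+ z - r%:E < +oo)%E -> (\int[NN]_z W^\+ z < +oo)%E.
    by move=> h1 h2 _ _; exact: h1 h2.
  by case: (\int[NN]_z W^\+ z)%E => [p _| |]//=; rewrite ltry.
have iK : NN.-integrable setT (fun z => W z + (c + 16)%:E)%E.
  by apply: integrableD => //; exact: finite_measure_integrable_cst.
have ih : NN.-integrable setT h.
  apply: le_integrable iK => // z _ /=.
  by rewrite !gee0_abs// (le_trans (h0 z)).
have hq z : (Qshift z.1 * (4^-1)%:E <= h z)%E.
  by rewrite /h -addeA addeCA leeDl// adde_ge0// mule_ge0.
split; [split|].
- apply: le_integrable ih => // z _ /=.
  rewrite (gee0_abs (h0 z)) /h -addeA leeDl// adde_ge0// mule_ge0//.
(* On the diagonal the kernel is [+oo], and an integrable function is finite almost everywhere. *)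
- have [N [mN N0 sN]] := integrable_ae measurableT iW.
  apply/eqP; rewrite eq_le measure_ge0 andbT -[leRHS]N0 le_measure// ?inE//.
    rewrite (_ : [set z | _] = setT `&` (@dist R) @^-1` [set 0]); last by rewrite setTI.
    by apply: measurable_dist => //; exact: measurable_set1.
  move=> z /= d0; apply: sN => /= /(_ I); rewrite /W /weighted_kernel.
  have -> : log_kernel z.1 z.2 = +oo%E.
    move: d0; rewrite /dist/log_kernel => /normr0_eq0/eqP.
    by rewrite subr_eq0 => ->.
  have h2 : (0 < (2^-1 : R)%:E)%E by rewrite lte_fin invr_gt0.
  have := Qc z.1; have := Qc z.2.
  by case: (Q z.1) => [qx| |]; case: (Q z.2) => [qy| |] //= _ _;
    rewrite ?gt0_mulye.
- have iQs : nu.-integrable setT Qshift.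
    apply/integrableP; split => //.
    under eq_integral do rewrite gee0_abs//.
    have : (\int[NN]_z (Qshift z.1 * (4^-1)%:E) < +oo)%E.
      case/integrableP: ih => _; apply: le_lt_trans.
      apply: ge0_le_integral => //=.
      - by move=> z _; rewrite mule_ge0.
      - exact: measurableT_comp.
      - by move=> z _; rewrite gee0_abs//; exact: hq.
    rewrite (@integral_prod_fst nu nu (fun x => Qshift x * (4^-1)%:E)%E)//; last 2 first.
      by apply: emeasurable_funM.
      by move=> x; rewrite mule_ge0.
    rewrite ge0_integralZr//.
    have := integral_ge0 nu (fun x _ => Qshift_ge0 x) (D := setT).
    case: (\int[nu]_x Qshift x)%E => [r| |]//= _; first by rewrite !ltry.
    by rewrite gt0_mulye// lte_fin invr_gt0.
  have -> : Q = (fun x => Qshift x - c%:E)%E.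
    apply/funext => x; rewrite /Qshift; case: (Q x) => [q| |]//=.
    by rewrite -EFinD addrK.
  by apply: integrableB => //; exact: finite_measure_integrable_cst.
Qed.

Definition mean_field nu : R := fine (\int[nu]_x Q x)%E.

Lemma energyE nu : log_integrable nu nu -> nu.-integrable setT Q ->
  (energy Q nu = (mean_field nu - log_energy nu nu)%:E)%E.
Proof.
move=> [il d0] iQ.
pose NN : probability (R * R)%type R := [the probability _ _ of (nu \x nu)%E].
(* The reduction to a marginal is by Tonelli, hence for nonnegative functions: it is applied to
   [Qshift], and [c] is subtracted afterwards. *)
have half_shift (p : R * R -> R) : measurable_fun setT p ->
    (\int[NN]_z Qshift (p z) = \int[nu]_x Qshift x)%E ->
    NN.-integrable setT (fun z => Q (p z)) /\
    (\int[NN]_z Q (p z) = (mean_field nu)%:E)%E.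
  move=> mp e.
  have iQs : nu.-integrable setT Qshift.
    by apply: integrableD => //; exact: finite_measure_integrable_cst.
  have mQp : measurable_fun setT (fun z => Qshift (p z)).
    exact: (measurableT_comp measurable_Qshift).
  have iQp : NN.-integrable setT (fun z => Qshift (p z)).
    apply/integrableP; split => //.
    under eq_integral do rewrite gee0_abs//.
    by rewrite e; case/fin_numPlt/andP : (integrable_fin_num measurableT iQs).
  have Qe : Q = (fun x => Qshift x - c%:E)%E.
    apply/funext => x; rewrite /Qshift; case: (Q x) => [q| |]//=.
    by rewrite -EFinD addrK.
  have -> : (fun z => Q (p z)) = (fun z => Qshift (p z) - c%:E)%E.
    by apply/funext => z; rewrite {1}Qe.
  split; first by apply: integrableB => //; exact: finite_measure_integrable_cst.
  have iC := finite_measure_integrable_cst NN c measurableT.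
  have iC' := finite_measure_integrable_cst nu c measurableT.
  rewrite integralB// e integral_probability_cst /Qshift integralD//.
  rewrite integral_probability_cst addeK// /mean_field fineK//; exact: integrable_fin_num.
have [i1 e1] := half_shift fst measurable_fst
  (integral_prod_fst nu nu measurable_Qshift Qshift_ge0).
have [i2 e2] := half_shift snd measurable_snd
  (integral_prod_snd nu nu measurable_Qshift Qshift_ge0).
have inl : NN.-integrable setT (fun z => (- ln (dist z))%:E).
  move: (il) => /integrableP[ml il']; apply/integrableP; split.
    by apply/measurable_EFinP; apply: measurable_funN; exact/measurable_EFinP.
  by under eq_integral do rewrite EFinN abseN; exact: il'.
transitivity (\int[NN]_z ((- ln (dist z))%:E + Q z.1 * (2^-1)%:E + Q z.2 * (2^-1)%:E))%E.
  have mnl : measurable_fun setT (fun z : R * R => (- ln (dist z))%:E).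
    by case/integrableP : inl.
  rewrite /energy; apply: (@ae_eq_integral _ _ _ NN) => //.
    apply: emeasurable_funD; last by apply: emeasurable_funM => //; case/integrableP : i2.
    by apply: emeasurable_funD => //; apply: emeasurable_funM => //; case/integrableP : i1.
  exists [set z | dist z = 0]; split => //.
    rewrite (_ : [set z | _] = setT `&` (@dist R) @^-1` [set 0]); last by rewrite setTI.
    by apply: measurable_dist => //; exact: measurable_set1.
  move=> z /=; apply: contra_notP => dz _; rewrite /weighted_kernel /log_kernel.
  case: eqP => // zz; exfalso; apply: dz.
  by rewrite /dist zz subrr normr0.
rewrite integralD//=; last 2 first.
  by apply: integrableD => //; exact: integrableZr.
  exact: integrableZr.
rewrite integralD//=; last exact: integrableZr.
rewrite !integralZr// e1 e2.
have -> : (\int[NN]_z (- ln (dist z))%:E = (- log_energy nu nu)%:E)%E.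
  transitivity (- \int[NN]_z (ln (dist z))%:E)%E.
    by rewrite -integralN//; exact: integrable_add_def.
  by rewrite EFinN /log_energy fineK//; exact: integrable_fin_num.
by rewrite -!EFinM -!EFinD; congr EFin; field.
Qed.

End Energy.

(** Near-minimality is tested against an arbitrary [nu] by expanding
    [E nu - E mu] into a positive quadratic term and a linear term controlled by
    the Euler-Lagrange conditions. *)
Section Unicity.
Variables (Sig : set R) (Q : R -> \bar R) (c a b D C : R) (mu : probability R R).

(** With the sign of [ln], so that the effective potential in the Euler-Lagrange conditions is [Q]
    minus twice this. *)
Definition log_potential (P : probability R R) (x : R) : R :=
  fine (\int[P]_y (ln `|x - y|)%:E)%E.

Hypotheses (mSig : measurable Sig) (mQ : measurable_fun setT Q)
  (Qc : forall x, ((x ^+ 2 / 2 - c)%:E <= Q x)%E)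
  (muS : supported_on Sig mu) (mu1 : forall x, mu [set x] = 0%E)
  (muD : {ae mu, forall x, `|x| <= D})
  (b0 : 0 <= b)
  (potb : forall x, (\int[mu]_y `|(ln `|x - y|)%:E| <= (a + b * `|x|)%:E)%E)
  (EL_ge : forall x, Sig x -> (C%:E <= Q x - (2 * log_potential mu x)%:E)%E)
  (EL_eq : {ae mu, forall x, (Q x - (2 * log_potential mu x)%:E = C%:E)%E}).

Let mln : measurable_fun setT (fun z : R * R => (ln (dist z))%:E).
Proof. by apply/measurable_EFinP; apply: measurable_lnr; exact: measurable_dist. Qed.

Lemma integrable_log_slice x : mu.-integrable setT (fun y => (ln `|x - y|)%:E).
Proof.
apply/integrableP; split; last by rewrite (le_lt_trans (potb x))// ltry.
apply/measurable_EFinP; apply: measurable_lnr; apply: measurable_normr.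
exact: measurable_funB.
Qed.

Lemma log_potentialE x : (\int[mu]_y (ln `|x - y|)%:E = (log_potential mu x)%:E)%E.
Proof. by rewrite fineK//; apply: integrable_fin_num => //; exact: integrable_log_slice. Qed.

(** By [potb] the inner integral of [|ln |x - y||] grows at most linearly in [x], so a first moment
    of [nu] is enough for Fubini. The diagonal is null because [mu] has no atoms. *)
Lemma mutual_log_integrable nu : nu.-integrable setT (fun x => `|x|%:E) ->
  log_integrable nu mu /\
  nu.-integrable setT (fun x => (log_potential mu x)%:E) /\
  (\int[nu]_x (log_potential mu x)%:E = (log_energy nu mu)%:E)%E.
Proof.
move=> ix.
have il : (nu \x mu)%E.-integrable setT (fun z => (ln (dist z))%:E).
  apply/(integrable12ltyP _ _ mln).
  have iab : nu.-integrable setT (fun x => (a + b * `|x|)%:E).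
    exact: (integrableD measurableT (finite_measure_integrable_cst nu a measurableT)
      (integrableZl measurableT b ix)).
  case/integrableP: (iab) => mab; apply: le_lt_trans.
  apply: ge0_le_integral => //.
  - by move=> x _; exact: integral_ge0.
  - apply: (@measurable_fun_fubini_tonelli_F _ _ _ _ _ mu
      (fun z : R * R => `|(ln (dist z))%:E|%E)) => //.
    exact: measurableT_comp mln.
  - exact: measurableT_comp.
  - by move=> x _; rewrite (le_trans (potb x))// lee_fin ler_norm.
have il' : nu.-integrable setT (fun x => (log_potential mu x)%:E).
  have := integrable_fubini_F il; rewrite /fubini_F/=.
  by under eq_fun do rewrite log_potentialE.
split; [split => //; exact: measure_dist0|split => //].
transitivity (\int[nu \x mu]_z (ln (dist z))%:E)%E.
  rewrite -(integral12_prod_meas1 il) /fubini_F/=.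
  by apply: eq_integral => x _; rewrite log_potentialE.
by rewrite /log_energy fineK//; exact: (@integrable_fin_num _ _ _ (nu \x mu)%E).
Qed.

Let integrable_norm_mu : mu.-integrable setT (fun x => `|x|%:E).
Proof.
have mn : measurable_fun setT (fun x : R => `|x|%:E).
  by apply/measurable_EFinP; exact: measurable_normr.
apply/integrableP; split => //.
apply: (@le_lt_trans _ _ (\int[mu]_x `|D|%:E)%E).
  apply: ae_ge0_le_integral => //.
    exact: measurableT_comp.
  apply: filterS muD => x xD _.
  by rewrite abse_EFin normr_id lee_fin (le_trans xD)// ler_norm.
by rewrite integral_probability_cst ltry.
Qed.

(** Almost everywhere [Q] equals [C] plus twice the potential; this makes [Q] integrable, and
    integrating it gives the mean field. *)
Lemma mu_finite_energy :
  [/\ log_integrable mu mu, mu.-integrable setT Q &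
      mean_field Q mu = C + 2 * log_energy mu mu].
Proof.
have [il [ip ep]] := mutual_log_integrable integrable_norm_mu.
have i2 : mu.-integrable setT (fun x => C%:E + 2%:E * (log_potential mu x)%:E)%E.
  apply: integrableD => //; first exact: finite_measure_integrable_cst.
  exact: integrableZl.
have e : {ae mu, forall x, setT x -> Q x = (C%:E + 2%:E * (log_potential mu x)%:E)%E}.
  apply: filterS EL_eq => x + _.
  case: (Q x) => [q| |]//= [<-]; rewrite -EFinM -EFinD; congr EFin; ring.
have iQ : mu.-integrable setT Q.
  have/integrableP[m2 h2] := i2; apply/integrableP; split => //.
  apply: le_lt_trans h2; apply: ae_ge0_le_integral => //; try exact: measurableT_comp.
  by apply: filterS e => x h _; rewrite h.
split => //; rewrite /mean_field (ae_eq_integral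
    (fun x => C%:E + 2%:E * (log_potential mu x)%:E)%E Q measurableT _ _ e)//;
    last by case/integrableP: i2.
rewrite integralD//=; last 2 first.
  exact: finite_measure_integrable_cst.
  exact: integrableZl.
by rewrite integral_probability_cst integralZl// ep.
Qed.

(** Finite energy makes [Q], hence [x ^+ 2], hence [|x|] integrable, so the mutual energy with [mu]
    exists. Integrating [EL_ge] against [nu] gives the last inequality. *)
Lemma finite_energy_compare nu : supported_on Sig nu -> (energy Q nu < +oo)%E ->
  [/\ log_integrable nu nu, log_integrable nu mu,
      (energy Q nu = (mean_field Q nu - log_energy nu nu)%:E)%E &
      C <= mean_field Q nu - 2 * log_energy nu mu].
Proof.
move=> nuS E; have [il iQ] := finite_energyP mQ Qc E.
have ix : nu.-integrable setT (fun x => `|x|%:E).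
  have i1 : nu.-integrable setT (fun x => Q x + (c + 1)%:E)%E.
    by apply: integrableD => //; exact: finite_measure_integrable_cst.
  apply: le_integrable i1 => //.
    by apply/measurable_EFinP; exact: measurable_normr.
  move=> x _; rewrite abse_EFin normr_id.
  have h : `|x| <= x ^+ 2 / 2 + 1.
    rewrite -[x ^+ 2](real_normK (num_real x)).
    have := sqr_ge0 (`|x| - 1); set s := `|x|; nra.
  have := Qc x; case: (Q x) => [q| |]//=; rewrite ?leey// lee_fin => hq.
  by rewrite lee_fin (le_trans _ (ler_norm _))//; lra.
have [il' [ip ep]] := mutual_log_integrable ix.
split => //; first exact: energyE.
have i2 : nu.-integrable setT (fun x => 2%:E * (log_potential mu x)%:E)%E.
  exact: integrableZl.
have -> : mean_field Q nu - 2 * log_energy nu mu =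
    fine (\int[nu]_x (Q x - 2%:E * (log_potential mu x)%:E))%E.
  rewrite integralB// integralZl// ep.
  by rewrite -[in RHS](fineK (integrable_fin_num measurableT iQ)).
have iB : nu.-integrable setT (fun x => Q x - 2%:E * (log_potential mu x)%:E)%E.
  exact: integrableB.
rewrite -lee_fin fineK; last exact: integrable_fin_num.
have iC := finite_measure_integrable_cst nu C measurableT.
have mC : measurable (~` Sig) by exact: measurableC.
rewrite -(integral_probability_cst nu C).
rewrite (negligible_integral mC measurableT iC nuS).
rewrite (negligible_integral mC measurableT iB nuS) setTD setCK.
apply: le_integral => //.
- by apply: integrableS iC.
- by apply: integrableS iB.
- by move=> x; rewrite inE; exact: EL_ge.
Qed.

Theorem equilibrium_measure_unique :
  is_equilibrium_measure Sig Q mu /\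
  forall nu, is_equilibrium_measure Sig Q nu -> forall A, measurable A -> nu A = mu A.
Proof.
have [ilm iQm em] := mu_finite_energy.
have Emu := energyE mQ Qc ilm iQm.
(* With [L] for [log_energy] and [F] for [mean_field Q], the difference [E nu - E mu] is [(F nu - 2
   L(nu, mu) - C) + (2 L(nu, mu) - L(nu, nu) - L(mu, mu))], a sum of two nonnegative terms. If it is
   not positive, the second term vanishes and the measures agree. *)
have key nu : supported_on Sig nu -> (energy Q nu < +oo)%E ->
    (energy Q mu <= energy Q nu)%E /\
    ((energy Q nu <= energy Q mu)%E -> forall A, measurable A -> nu A = mu A).
  move=> nuS Enu; have [il il' en hC] := finite_energy_compare nuS Enu.
  have [p0 p1] := log_energy_pos_def il ilm il'.
  rewrite Emu en !lee_fin; split; first by lra.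
  by move=> h; apply: p1; lra.
have mu_eq : is_equilibrium_measure Sig Q mu.
  split => // nu nuS; have [h|] := ltP (energy Q nu) +oo%E; first by have [] := key nu nuS h.
  by rewrite leye_eq => /eqP ->; rewrite leey.
split => // nu [nuS numin]; have h := numin mu muS.
have Enu : (energy Q nu < +oo)%E by rewrite (le_lt_trans h)// Emu ltry.
by have [_ /(_ h)] := key nu nuS Enu.
Qed.

End Unicity.
End Equilibrium.

(** * Changes of variables and Tonelli for integrals over sets *)

Section Substitution.
Variable R : realType.
Local Notation mR := (measurableTypeR R).
Local Notation leb := (@lebesgue_measure R).
Implicit Types (f : R -> R) (A : set R) (a b c d : R).

Lemma ge0_integral_affine_set f A c d : c != 0 -> measurable A ->
  measurable_fun setT f -> (forall x, 0 <= f x) ->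
  (\int[leb]_(x in [set x | A (c * x + d)%R]) (f (c * x + d)%R)%:E =
   `|c|^-1%:E * \int[leb]_(x in A) (f x)%:E)%E.
Proof.
move=> c0 mA mf f0.
have mg : measurable_fun setT ((EFin \o f) \_ A).
  apply/(measurable_restrictT _ _).1 => //; apply: measurable_funTS.
  exact/measurable_EFinP.
rewrite [in RHS]integral_mkcond -(ge0_integral_affine d c0 mg); last first.
  by move=> x; apply: erestrict_ge0 => y _; rewrite lee_fin.
rewrite integral_mkcond; apply: eq_integral => x _; rewrite !patchE.
by rewrite (_ : (x \in [set x | A (c * x + d)]) = (c * x + d \in A))//;
  apply/idP/idP; rewrite !inE.
Qed.

Lemma ge0_integral_shift f a b d : measurable_fun setT f -> (forall x, 0 <= f x) ->
  (\int[leb]_(x in `]a, b[) (f (d + x)%R)%:E = \int[leb]_(x in `](d + a)%R, (d + b)%R[) (f x)%:E)%E.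
Proof.
move=> mf f0.
have := @ge0_integral_affine_set f `]d + a, d + b[%classic 1 d (oner_neq0 _).
rewrite normr1 invr1 mul1e => <- //.
rewrite (_ : [set x | _] = `]a, b[%classic).
  by apply: eq_integral => x _; rewrite mul1r addrC.
by apply/seteqP; split => x /=; rewrite !in_itv/= mul1r [x + d]addrC !ltrD2l.
Qed.

Lemma ge0_integral_reflect f a b d : measurable_fun setT f -> (forall x, 0 <= f x) ->
  (\int[leb]_(x in `]a, b[) (f (d - x)%R)%:E = \int[leb]_(x in `](d - b)%R, (d - a)%R[) (f x)%:E)%E.
Proof.
move=> mf f0.
have n1 : (- 1 : R) != 0 by rewrite oppr_eq0 oner_neq0.
have := @ge0_integral_affine_set f `]d - b, d - a[%classic (- 1) d n1.
rewrite normrN normr1 invr1 mul1e => <- //.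
rewrite (_ : [set x | _] = `]a, b[%classic).
  by apply: eq_integral => x _; rewrite mulN1r addrC.
apply/seteqP; split => x /=; rewrite !in_itv/= mulN1r [- x + d]addrC !ltrD2l !ltrN2.
  by rewrite andbC.
by rewrite andbC.
Qed.

Lemma ge0_integral_split f a b c : a <= b -> b <= c -> measurable_fun setT f ->
  (forall x, 0 <= f x) ->
  (\int[leb]_(x in `]a, c[) (f x)%:E =
   \int[leb]_(x in `]a, b[) (f x)%:E + \int[leb]_(x in `]b, c[) (f x)%:E)%E.
Proof.
move=> ab bc mf f0; have mfE : measurable_fun setT (EFin \o f) by exact/measurable_EFinP.
rewrite (@integral_itv_obnd_cbnd _ b (BLeft c)); last exact: measurable_funTS.
have [->|bc'] := eqVneq b c.
  by rewrite [X in (_ = _ + \int[_]_(x in X) _)%E]set_itv_ge ?integral_set0 ?adde0// bnd_simp ltxx.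
have [ab'|ab'] := eqVneq a b.
  rewrite ab' (@integral_itv_obnd_cbnd _ b (BLeft c)); last exact: measurable_funTS.
  by rewrite [in RHS]set_itv_ge ?integral_set0 ?add0e// bnd_simp ltxx.
have {}ab : a < b by rewrite lt_neqAle ab' ab.
have {}bc : b < c by rewrite lt_neqAle bc' bc.
rewrite -ge0_integral_setU//=.
- congr (integral _ _ _); by rewrite -itv_bndbnd_setU// bnd_simp// ltW.
- exact: measurable_funTS.
- by move=> x _; rewrite lee_fin.
- apply/disj_setPS => x /=; rewrite !in_itv/= => -[/andP[_ h1] /andP[h2 _]].
  by have := lt_le_trans h1 h2; rewrite ltxx.
Qed.

Lemma ge0_fubini_set (A B : set R) (K : R -> R -> R) :
  measurable A -> measurable B -> measurable_fun setT (fun w : mR * mR => K w.1 w.2) ->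
  (forall x y, A x -> B y -> 0 <= K x y) ->
  (\int[leb]_(x in A) \int[leb]_(y in B) (K x y)%:E =
   \int[leb]_(y in B) \int[leb]_(x in A) (K x y)%:E)%E.
Proof.
move=> mA mB mK K0.
pose G (w : mR * mR) := (K w.1 w.2 * \1_(A `*` B) w)%:E.
have mG : measurable_fun setT G.
  apply/measurable_EFinP; apply: measurable_funM => //.
  by apply: measurable_indic; exact: measurableX.
have G0 w : (0 <= G w)%E.
  rewrite lee_fin /indic; case: (w \in _) / idP => [|_]; last by rewrite mulr0.
  by rewrite inE => -[/= ? ?]; rewrite mulr1 K0.
have GE x y : G (x, y) = (K x y * (\1_A x * \1_B y))%:E.
  by rewrite /G/= !indicE in_setX/= -natrM mulnb.
have := @fubini_tonelli _ _ mR mR R leb leb G mG G0.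
under eq_integral => x _.
  under eq_integral => y _ do rewrite GE.
  over.
rewrite /=.
move=> h; transitivity (\int[leb]_x \int[leb]_y (K x y * (\1_A x * \1_B y))%:E)%E.
  rewrite integral_mkcond; apply: eq_integral => x _; rewrite patchE; case: ifPn => xA.
    rewrite integral_mkcond; apply: eq_integral => y _; rewrite patchE.
    by case: ifPn => yB; rewrite !indicE xA ?yB ?(negbTE yB) ?mulr1 ?mulr0.
  by rewrite integral0_eq// => y _; rewrite !indicE (negbTE xA) mul0r mulr0.
rewrite h integral_mkcond [in RHS]integral_mkcond; apply: eq_integral => y _; rewrite !patchE.
rewrite in_setT; case: ifPn => yB.
  rewrite [in RHS]integral_mkcond; apply: eq_integral => x _; rewrite patchE GE.
  by case: ifPn => xA; rewrite !indicE yB ?xA ?(negbTE xA) ?mulr1 ?mul0r ?mulr0.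
by rewrite integral0_eq// => x _; rewrite GE !indicE (negbTE yB) !mulr0.
Qed.

Lemma measurable_integral_param (A : set R) (K : R -> R -> R) :
  measurable A -> measurable_fun setT (fun w : mR * mR => K w.1 w.2) ->
  (forall x y, 0 <= K x y) ->
  measurable_fun setT (fun x => \int[leb]_(y in A) (K x y)%:E)%E.
Proof.
move=> mA mK K0; pose G (w : mR * mR) := (\1_A w.2 * K w.1 w.2)%:E.
rewrite (_ : (fun _ => _) = fun x => (\int[leb]_y G (x, y))%E); last first.
  apply/funext => x; rewrite integral_mkcond; apply: eq_integral => y _.
  by rewrite patchE /G/= indicE; case: ifPn => _; rewrite ?mul1r ?mul0r.
apply: (@measurable_fun_fubini_tonelli_F _ _ _ _ _ leb G).
  apply/measurable_EFinP; apply: measurable_funM => //.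
  by apply: (measurableT_comp (measurable_indic _)) => //; exact: measurable_snd.
by move=> w; rewrite lee_fin mulr_ge0.
Qed.

End Substitution.

(** * The integral of the logarithm of the sine *)

Section LogSine.
Variable R : realType.
Local Notation leb := (@lebesgue_measure R).
Local Notation halfpi := (pi / 2 : R).

Definition log_csc (t : R) : R := - ln `|sin t|.

Lemma log_csc_ge0 t : 0 <= log_csc t.
Proof. by rewrite oppr_ge0 ln_le0// ler_norml sin_le1 sin_geN1. Qed.

Lemma measurable_log_csc : measurable_fun setT log_csc.
Proof.
apply: measurable_funN; apply: measurable_lnr; apply: measurable_normr.
by apply: measurable_sinr; exact: measurable_id.
Qed.

Lemma log_cscN t : log_csc (- t) = log_csc t.
Proof. by rewrite /log_csc sinN normrN. Qed.

Lemma log_cscDpi t : log_csc (pi + t) = log_csc t.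
Proof. by rewrite /log_csc addrC sinDpi normrN. Qed.

Lemma halfpi_gt0 : 0 < halfpi. Proof. by rewrite divr_gt0// pi_gt0. Qed.

(** Apply [ln v <= v] to [v = 1 / sqrt u], using [ln u = 2 ln (sqrt u)]. The resulting bound is
    integrable at 0. *)
Lemma norm_ln_le_sqrt (u : R) : 0 < u -> `|ln u| <= 2 * (Num.sqrt u)^-1 + u.
Proof.
move=> u0; have su : 0 < Num.sqrt u by rewrite sqrtr_gt0.
have h1 := ln_le_self u0.
have := ln_le_self (_ : 0 < (Num.sqrt u)^-1); rewrite invr_gt0 => /(_ su).
rewrite lnV ?posrE//.
have e : ln u = ln (Num.sqrt u) *+ 2 by rewrite -lnXn// sqr_sqrtr// ltW.
rewrite e in h1 *.
have hi : 0 <= (Num.sqrt u)^-1 by rewrite invr_ge0 ltW.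
move: h1; set l := ln (Num.sqrt u); set i := (Num.sqrt u)^-1 in hi *.
by rewrite mulr2n => h1 h2; rewrite ler_norml; apply/andP; split; lra.
Qed.

(** The function [sin x - x cos x] has derivative [x sin x >= 0], so [x cos x <= sin x]. At
    [x = t / 2] the double-angle formula gives [sin t >= t cos (t / 2) ^+ 2], and
    [2 cos (t / 2) ^+ 2 = 1 + cos t >= 1]. *)
Lemma sin_ge_half (t : R) : 0 <= t <= halfpi -> t / 2 <= sin t.
Proof.
have key (x : R) : 0 <= x <= halfpi -> x * cos x <= sin x.
  move=> /andP[x0 xp]; rewrite -subr_ge0.
  have -> : sin x - x * cos x = (sin x - x * cos x) - (sin 0 - 0 * cos 0).
    by rewrite sin0 mul0r !subr0.
  have e : (\int[leb]_(y in `[0%R, x]) (y * sin y)%:E =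
      ((sin x - x * cos x) - (sin 0 - 0 * cos 0))%R%:E)%E.
    apply: (@FTC_cc _ (fun t => sin t - t * cos t)) => // y _; last by derive_continuous.
    by derive_to; ring.
  rewrite -lee_fin -e; apply: integral_ge0 => y /=; rewrite in_itv/= => /andP[y0 yx].
  rewrite lee_fin mulr_ge0// sin_ge0_pi// y0/= (le_trans yx)// (le_trans xp)//.
  by rewrite ler_pdivrMr// ler_peMr ?ler1n// ltW// pi_gt0.
move=> /andP[t0 tp].
have c0 : 0 <= cos (t / 2).
  by apply: cos_ge0_pihalf; have := halfpi_gt0; lra.
have h := key (t / 2) _.
have -> : sin t = 2 * sin (t / 2) * cos (t / 2).
  by rewrite [in LHS](_ : t = t / 2 + t / 2)?sinD; [ring|lra].
have hp := halfpi_gt0.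
have {}h := h (_ : 0 <= t / 2 <= halfpi).
have {}h : t / 2 * cos (t / 2) <= sin (t / 2) by apply: h; apply/andP; split; lra.
have c2 : 1 <= 2 * cos (t / 2) ^+ 2.
  have ct : 0 <= cos t by apply: cos_ge0_pihalf; apply/andP; split; lra.
  have : cos t = 2 * cos (t / 2) ^+ 2 - 1.
    rewrite [in LHS](_ : t = t / 2 + t / 2)?cosD; last lra.
    by rewrite -!expr2 sin2cos2; ring.
  by move=> e; lra.
apply: (@le_trans _ _ (2 * (t / 2 * cos (t / 2)) * cos (t / 2))); last first.
  by rewrite ler_wpM2r// ler_wpM2l.
have -> : 2 * (t / 2 * cos (t / 2)) * cos (t / 2) = t / 2 * (2 * cos (t / 2) ^+ 2) by ring.
by rewrite ler_peMr// divr_ge0.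
Qed.

Lemma log_csc_integrable :
  (\int[leb]_(t in `]0%R, (halfpi)%R[) (log_csc t)%:E < +oo)%E.
Proof.
have hp := halfpi_gt0.
apply: (@le_lt_trans _ _ (\int[leb]_(t in `]0%R, (halfpi)%R[) (4 * (Num.sqrt t)^-1 + 1)%R%:E)%E).
  apply: ge0_le_integral => //.
  - by move=> t _; rewrite lee_fin log_csc_ge0.
  - by apply: measurable_funTS; apply/measurable_EFinP; exact: measurable_log_csc.
  - apply: measurable_funTS; apply/measurable_EFinP; apply: measurable_funD => //.
    apply: measurable_funM => //; apply: measurable_invr; exact: measurable_sqrtr.
  - move=> t /=; rewrite in_itv/= => /andP[t0 tp]; rewrite lee_fin.
    have st : t / 2 <= sin t by apply: sin_ge_half; rewrite !ltW.
    have t2 : 0 < t / 2 by lra.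
    have s0 : 0 < sin t by exact: lt_le_trans st.
    rewrite /log_csc gtr0_norm//.
    have := norm_ln_le_sqrt s0; rewrite ler_norml => /andP[h _].
    have s1 := sin_le1 t.
    suff : 2 * (Num.sqrt (sin t))^-1 <= 4 * (Num.sqrt t)^-1 by lra.
    (* The weaker bound [sin t >= t / 4] suffices, and its square root is [sqrt t / 2]. *)
    have -> : 4 * (Num.sqrt t)^-1 = 2 * (Num.sqrt (t / 2 / 2))^-1.
      have -> : t / 2 / 2 = t / 2 ^+ 2 by field.
      rewrite sqrtrM ?(ltW t0)// sqrtrV// sqrtr_sqr normr_nat.
      by field; rewrite gt_eqF// sqrtr_gt0.
    rewrite ler_wpM2l// lef_pV2 ?posrE ?sqrtr_gt0//; last lra.
    by rewrite ler_wsqrtr//; lra.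
have cF (x : R) : {for x, continuous (fun t => 8 * Num.sqrt t + t)}.
  apply: cvgD; last exact: cvg_id.
  by apply: cvgMr; exact: sqrt_continuous.
have -> : (\int[leb]_(t in `]0%R, (halfpi)%R[) (4 * (Num.sqrt t)^-1 + 1)%R%:E =
    ((8 * Num.sqrt halfpi + halfpi) - (8 * Num.sqrt 0 + 0))%R%:E)%E; last by rewrite ltry.
apply: (@ge0_FTC_oo _ (fun t => 8 * Num.sqrt t + t) (fun t => 4 * (Num.sqrt t)^-1 + 1)
  0 halfpi hp _ _ _ (cF _) (cF _)).
- move=> x /andP[x0 _]; have sx : Num.sqrt x != 0 by rewrite gt_eqF// sqrtr_gt0.
  by derive_to => //; field.
- move=> x /andP[x0 _]; have sx : Num.sqrt x != 0 by rewrite gt_eqF// sqrtr_gt0.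
  by derive_continuous.
- by move=> x _; rewrite addr_ge0// mulr_ge0// invr_ge0 sqrtr_ge0.
Qed.

(** Classically [(pi / 2) ln 2]. It is kept symbolic: it enters every arcsine potential as the same
    additive constant. *)
Definition log_csc_mass : R := fine (\int[leb]_(t in `]0%R, (halfpi)%R[) (log_csc t)%:E)%E.

Lemma log_csc_massE :
  (\int[leb]_(t in `]0%R, (halfpi)%R[) (log_csc t)%:E = log_csc_mass%:E)%E.
Proof.
rewrite fineK// ge0_fin_numE; first exact: log_csc_integrable.
by apply: integral_ge0 => t _; rewrite lee_fin log_csc_ge0.
Qed.

(** Together the two terms integrate [log_csc] over []p - pi / 2, p + pi / 2[], a full period
    whatever [p] is. By periodicity and evenness this is twice the integral over []0, pi / 2[]. *)
Lemma integral_log_csc_sum (p : R) : 0 <= p <= halfpi ->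
  (\int[leb]_(t in `]0%R, (halfpi)%R[) (log_csc (p + t) + log_csc (p - t))%R%:E =
   (2 * log_csc_mass)%R%:E)%E.
Proof.
move=> /andP[p0 pp]; have hp := halfpi_gt0; have mp := measurable_log_csc.
have lp := log_csc_ge0.
have mps : measurable_fun setT (fun t : R => (log_csc (p + t))%:E).
  apply/measurable_EFinP; apply: (measurableT_comp mp); exact: measurable_funD.
have mpm : measurable_fun setT (fun t : R => (log_csc (p - t))%:E).
  apply/measurable_EFinP; apply: (measurableT_comp mp); exact: measurable_funB.
under eq_integral do rewrite EFinD.
rewrite ge0_integralD//=; last 4 first.
- by move=> t _; rewrite lee_fin.
- exact: measurable_funTS.
- by move=> t _; rewrite lee_fin.
- exact: measurable_funTS.
rewrite ge0_integral_shift// ge0_integral_reflect// addr0 subr0.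
rewrite addeC -ge0_integral_split//; [|lra|lra].
rewrite (@ge0_integral_split _ log_csc _ halfpi)//; [|lra|lra].
have -> : (\int[leb]_(x in `](halfpi)%R, (p + halfpi)%R[) (log_csc x)%:E =
    \int[leb]_(x in `](- halfpi)%R, (p - halfpi)%R[) (log_csc x)%:E)%E.
  have := @ge0_integral_shift R log_csc (- halfpi) (p - halfpi) pi mp lp.
  have -> : pi + - halfpi = halfpi by field.
  have -> : pi + (p - halfpi) = p + halfpi by field.
  by move=> <-; apply: eq_integral => x _; rewrite log_cscDpi.
rewrite addeC -ge0_integral_split//; [|lra|lra].
rewrite (@ge0_integral_split _ log_csc _ 0)//; [|lra|lra].
have -> : (\int[leb]_(x in `](- halfpi)%R, 0%R[) (log_csc x)%:E =
    \int[leb]_(x in `]0%R, (halfpi)%R[) (log_csc x)%:E)%E.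
  have := @ge0_integral_reflect R log_csc 0 halfpi 0 mp lp.
  rewrite sub0r subr0 => <-; apply: eq_integral => x _.
  by rewrite sub0r log_cscN.
by rewrite log_csc_massE -EFinD; congr EFin; ring.
Qed.

End LogSine.

(** * Arcsine laws *)

Section ArcsinePotential.
Variable R : realType.
Local Notation leb := (@lebesgue_measure R).
Local Notation halfpi := (@pi R / 2)%R.
Local Notation quarter := (`]0%R, (@pi R / 2)%R[%classic).
Implicit Types (v : R -> R) (x s sg t d : R).

Lemma sin_cos_gt0 t : quarter t -> 0 < sin t /\ 0 < cos t.
Proof.
rewrite /= in_itv/= => /andP[t0 tp]; split.
  by apply: sin_gt0_pi; rewrite t0/= (lt_le_trans tp)// ler_pdivrMr// ler_peMr ?ler1n// ltW// pi_gt0.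
by apply: cos_gt0_pihalf; rewrite tp andbT (lt_trans _ t0)// oppr_lt0 halfpi_gt0.
Qed.

Lemma measure_quarter : leb quarter = halfpi%:E.
Proof. by rewrite lebesgue_measure_itv/= lte_fin halfpi_gt0 sube0. Qed.

Lemma integral_quarter_cst (r : R) :
  (\int[leb]_(t in quarter) r%:E = (r * halfpi)%:E)%E.
Proof.
rewrite integral_cst//= EFinM; congr (_ * _)%E; exact: measure_quarter.
Qed.

Lemma integral_trig_inv (p q : R) : 0 < p -> 0 < q ->
  (\int[leb]_(t in quarter) ((p * cos t ^+ 2 + q * sin t ^+ 2)^-1)%:E =
   (halfpi / (Num.sqrt p * Num.sqrt q))%:E)%E.
Proof.
move=> p0 q0; set P := Num.sqrt p; set Q := Num.sqrt q.
have P0 : 0 < P by rewrite sqrtr_gt0.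
have Q0 : 0 < Q by rewrite sqrtr_gt0.
have pE : p = P ^+ 2 by rewrite sqr_sqrtr// ltW.
have qE : q = Q ^+ 2 by rewrite sqr_sqrtr// ltW.
pose D t := P * cos t ^+ 2 + Q * sin t ^+ 2.
pose E t := p * cos t ^+ 2 + q * sin t ^+ 2.
have comb (a b t : R) : 0 < a -> 0 < b -> 0 < a * cos t ^+ 2 + b * sin t ^+ 2.
  move=> a0 b0; have := cos2Dsin2 t.
  have := sqr_ge0 (cos t); have := sqr_ge0 (sin t).
  move: (cos t ^+ 2) (sin t ^+ 2) => c s s0 c0 e.
  have [ab|ab] := leP a b.
    by have := mulr_ge0 (_ : 0 <= b - a) s0; rewrite subr_ge0 => /(_ ab); nra.
  by have := mulr_ge0 (_ : 0 <= a - b) c0; rewrite subr_ge0 => /(_ (ltW ab)); nra.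
(* By the subtraction formula for the tangent, [t - atan (...)] is [atan ((Q / P) tan t)] written in
   a form that stays smooth at [pi / 2]. *)
pose F t := (P * Q)^-1 * (t - atan ((P - Q) * sin t * cos t * (D t)^-1)).
have dF t : is_derive t 1 F (E t)^-1.
  have D0 : D t != 0 by rewrite gt_eqF// comb.
  have E0 : E t != 0 by rewrite gt_eqF// comb.
  have PQ0 : P * Q != 0 by rewrite mulf_neq0// gt_eqF.
  rewrite /F /D; derive_to => //.
  rewrite -/(D t).
  set s := sin t; set c := cos t.
  have cs : c ^+ 2 + s ^+ 2 = 1 by rewrite cos2Dsin2.
  have e1 : D t ^+ 2 + ((P - Q) * s * c) ^+ 2 = E t.
    have : D t ^+ 2 + ((P - Q) * s * c) ^+ 2 = (c ^+ 2 + s ^+ 2) * E t.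
      by rewrite /D /E -/s -/c pE qE; ring.
    by rewrite cs mul1r.
  have e2 : 1 + ((P - Q) * s * c * (D t)^-1) ^+ 2 = E t / D t ^+ 2.
    by rewrite -e1; field.
  rewrite e2 invf_div.
  have e3 : (P - Q) * (c ^+ 2 - s ^+ 2) * D t - (P - Q) * s * c * (2 * (Q - P) * s * c) =
    E t - P * Q.
    have -> : (P - Q) * (c ^+ 2 - s ^+ 2) * D t - (P - Q) * s * c * (2 * (Q - P) * s * c) =
       (P - Q) * (P * c ^+ 2 - Q * s ^+ 2) * (c ^+ 2 + s ^+ 2).
      by rewrite /D -/s -/c; ring.
    have : E t - P * Q * (c ^+ 2 + s ^+ 2) = (P - Q) * (P * c ^+ 2 - Q * s ^+ 2).
      by rewrite /E -/s -/c pE qE; ring.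
    by rewrite cs !mulr1 => ->.
  transitivity ((P * Q)^-1 * (1 - ((P - Q) * (c ^+ 2 - s ^+ 2) * D t -
      (P - Q) * s * c * (2 * (Q - P) * s * c)) / E t)).
    move: (D t) (E t) D0 E0 => d e D0 E0 {e1 e2 e3}; field.
    by rewrite E0 D0 !gt_eqF.
  by rewrite e3; move: (E t) E0 => e E0; field; rewrite E0 !gt_eqF.
have cont t : {for t, continuous (fun t => (E t)^-1)}.
  by rewrite /E; derive_continuous; rewrite gt_eqF// comb.
rewrite -(@integral_itv_bndoo _ 0 halfpi _ true false); last first.
  apply/measurable_EFinP; apply: measurable_funTS.
  by apply: continuous_measurable_fun => t; exact: cont.
have -> : (halfpi / (P * Q)) = F halfpi - F 0.
  rewrite /F sin0 cos_pihalf !mulr0 !mul0r atan0 !subr0 mulr0 subr0; by rewrite mulrC.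
by apply: (@FTC_cc _ F (fun t => (E t)^-1) 0 halfpi _ (fun t _ => dF t) (fun t _ => cont t));
  exact/ltW/halfpi_gt0.
Qed.

(** Write [ln (X + v) - ln v] as the integral of [1 / (r + v)] over [0 < r < X] and exchange the
    integrals: logarithmic integrals reduce to the rational ones of [integral_trig_inv]. *)
Lemma integral_ln_shift v (h : R -> R) (X : R) : 0 <= X ->
  measurable_fun setT v -> {in quarter, forall t, 0 < v t} ->
  (forall r, 0 < r -> (\int[leb]_(t in quarter) ((r + v t)^-1)%:E = (h r)%:E)%E) ->
  (\int[leb]_(t in quarter) (ln (X + v t) - ln (v t))%:E =
   \int[leb]_(r in `]0%R, X[) (h r)%:E)%E.
Proof.
move=> X0 mv v0 hE.
transitivity (\int[leb]_(t in quarter) \int[leb]_(r in `]0%R, X[) (`|r + v t|^-1)%:E)%E.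
  apply: eq_integral => t tq; have vt := v0 t tq.
  transitivity (\int[leb]_(r in `[0%R, X]) (`|r + v t|^-1)%:E)%E; last first.
    apply: (@integral_itv_bndoo _ 0 X _ true false).
    apply/measurable_EFinP; apply: measurable_funTS; apply: measurable_invr.
    by apply: measurable_normr; exact: measurable_funD.
  transitivity (\int[leb]_(r in `[0%R, X]) ((r + v t)^-1)%:E)%E.
    have -> : (ln (X + v t) - ln (v t))%:E = (ln (X + v t) - ln (0 + v t))%:E by rewrite add0r.
    apply/esym; apply: (@FTC_cc _ (fun r => ln (r + v t))) => // r /andP[r0 _].
      by derive_to; [rewrite ltr_wpDl|rewrite addr0 ?mul1r ?mulr1].
    by derive_continuous; rewrite gt_eqF// ltr_wpDl.
  apply: eq_integral => r; rewrite inE/= in_itv/= => /andP[r0 _].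
  by rewrite ger0_norm// addr_ge0// ltW.
rewrite (@ge0_fubini_set _ quarter `]0%R, X[ (fun t r => `|r + v t|^-1))//=; last first.
  apply: measurable_invr; apply: measurable_normr.
  by apply: measurable_funD; [exact: measurable_snd|exact: measurableT_comp].
apply: eq_integral => r; rewrite inE/= in_itv/= => /andP[r0 _].
rewrite -hE//; apply: eq_integral => t tq.
by rewrite ger0_norm// addr_ge0 ?(ltW r0)// ltW// v0.
Qed.

Lemma quarter_ae_eq (f g : R -> R) (p : R) : measurable_fun setT f -> measurable_fun setT g ->
  (forall t, quarter t -> t != p -> f t = g t) ->
  (\int[leb]_(t in quarter) (f t)%:E = \int[leb]_(t in quarter) (g t)%:E)%E.
Proof.
move=> mf mg fg; apply: ae_eq_integral => //.
- by apply: measurable_funTS; exact/measurable_EFinP.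
- by apply: measurable_funTS; exact/measurable_EFinP.
exists [set p]; split; [exact: measurable_set1|exact: lebesgue_measure_set1|].
move=> t /= /not_implyP[tq] neq; apply/eqP; apply: contra_notT neq => tp.
by rewrite fg.
Qed.

Lemma measurable_ln_sin2 (z d : R) :
  measurable_fun setT (fun t : R => ln `|z - d * sin t ^+ 2|).
Proof.
apply: measurable_lnr; apply: measurable_normr; apply: measurable_funB => //.
apply: measurable_funM => //; apply: measurable_funX.
by apply: measurable_sinr; exact: measurable_id.
Qed.

(** [sin p ^+ 2 - sin t ^+ 2 = sin (p + t) * sin (p - t)]. *)
Lemma ln_sin2_decomp (z d : R) : 0 < d -> 0 <= z <= d ->
  exists2 p, 0 <= p <= halfpi & forall t, quarter t -> t != p ->
  ln `|z - d * sin t ^+ 2| = ln d - (log_csc (p + t) + log_csc (p - t)).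
Proof.
move=> d0 /andP[z0 zd]; have hp := halfpi_gt0 R.
have zd1 : Num.sqrt (z / d) <= 1 by rewrite -sqrtr1 ler_wsqrtr// ler_pdivrMr// mul1r.
have sz0 := sqrtr_ge0 (z / d).
pose p := asin (Num.sqrt (z / d)).
have sp : sin p = Num.sqrt (z / d) by rewrite asinK// in_itv/= zd1 andbT; lra.
have p1 : - halfpi <= p by rewrite asin_geNpi2// zd1 andbT; lra.
have p2 : p <= halfpi by rewrite asin_lepi2// zd1 andbT; lra.
have p0 : 0 <= p.
  rewrite leNgt; apply/negP => pn.
  have : sin (- p) > 0 by apply: sin_gt0_pi; apply/andP; split; lra.
  by rewrite sinN sp; lra.
exists p; first by rewrite p0.
move=> t tq tp; have [st ct] := sin_cos_gt0 tq.
move: tq; rewrite /= in_itv/= => /andP[t0 th].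
have zE : z = d * sin p ^+ 2 by rewrite sp sqr_sqrtr ?divr_ge0 ?(ltW d0)//; field; rewrite gt_eqF.
have -> : z - d * sin t ^+ 2 = d * (sin (p + t) * sin (p - t)).
  rewrite zE sinD sinB.
  have cp := cos2sin2 p; have ctt := cos2sin2 t.
  transitivity (d * (sin p ^+ 2 * cos t ^+ 2 - cos p ^+ 2 * sin t ^+ 2)); last by ring.
  by rewrite cp ctt; ring.
have s1 : sin (p + t) != 0 by rewrite gt_eqF// sin_gt0_pi//; apply/andP; split; lra.
have s2 : sin (p - t) != 0.
  have [pt|pt] := ltP t p; first by rewrite gt_eqF// sin_gt0_pi//; apply/andP; split; lra.
  have {}pt : p < t by rewrite lt_neqAle eq_sym tp.
  rewrite -opprB sinN oppr_eq0 gt_eqF// sin_gt0_pi//; apply/andP; split; lra.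
rewrite !normrM (gtr0_norm d0) !lnM ?posrE ?mulr_gt0 ?normr_gt0//.
by rewrite /log_csc; ring.
Qed.

Lemma measurable_log_cscD (p : R) :
  measurable_fun setT (fun t : R => log_csc (p + t) + log_csc (p - t)).
Proof.
apply: measurable_funD; apply: (measurableT_comp (@measurable_log_csc R)).
  exact: measurable_funD.
exact: measurable_funB.
Qed.

(** For [z = d sin p ^+ 2] the integrand is [ln d] minus the sum treated in [integral_log_csc_sum],
    whose integral does not depend on [p]: this is why the potential of an arcsine law is constant
    on its support. *)
Lemma arcsine_inside (z d : R) : 0 < d -> 0 <= z <= d ->
  (\int[leb]_(t in quarter) (ln `|z - d * sin t ^+ 2|)%:E =
    (ln d * halfpi - 2 * log_csc_mass R)%:E)%E /\
  (\int[leb]_(t in quarter) `|(ln `|z - d * sin t ^+ 2|)%:E| <=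
    (`|ln d| * halfpi + 2 * log_csc_mass R)%:E)%E.
Proof.
move=> d0 zd; have [p pp dec] := ln_sin2_decomp d0 zd.
pose L t := log_csc (p + t) + log_csc (p - t).
have L0 t : 0 <= L t by rewrite addr_ge0// log_csc_ge0.
have mL : measurable_fun setT L by exact: measurable_log_cscD.
have mLE : measurable_fun quarter (EFin \o L).
  by apply: measurable_funTS; exact/measurable_EFinP.
have LE := integral_log_csc_sum pp.
have iL : leb.-integrable quarter (EFin \o L).
  apply/integrableP; split => //.
  under eq_integral do rewrite gee0_abs ?lee_fin//.
  by rewrite LE ltry.
have ic (r : R) : leb.-integrable quarter (EFin \o cst r).
  apply/integrableP; split; first by apply/measurable_EFinP.
  rewrite (eq_integral (fun=> `|r|%:E)); last by move=> t _; rewrite abse_EFin.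
  by rewrite integral_quarter_cst ltry.
split.
  rewrite (@quarter_ae_eq _ (fun t => ln d - L t) p)//; last 2 first.
    exact: measurable_ln_sin2.
    exact: measurable_funB.
  transitivity (\int[leb]_(t in quarter) ((ln d)%:E - (L t)%:E))%E; first exact: eq_integral.
  rewrite (@integralB_EFin _ _ _ leb quarter (cst (ln d)) L)//=.
  by rewrite integral_quarter_cst LE EFinB.
apply: (@le_trans _ _ (\int[leb]_(t in quarter) (`|ln d| + L t)%:E)%E).
  rewrite (_ : (\int[leb]_(t in quarter) _ = \int[leb]_(t in quarter) `|ln d - L t|%:E)%E); last first.
    under eq_integral do rewrite abse_EFin.
    apply: (@quarter_ae_eq _ _ p).
    - by apply: measurable_normr; exact: measurable_ln_sin2.
    - by apply: measurable_normr; exact: measurable_funB.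
    - by move=> t tq tp; rewrite dec.
  apply: ge0_le_integral => //.
  - apply: measurable_funTS; apply/measurable_EFinP; apply: measurable_normr.
    exact: measurable_funB.
  - by apply: measurable_funTS; apply/measurable_EFinP; exact: measurable_funD.
  - by move=> t _; rewrite lee_fin (le_trans (ler_normB _ _))// (ger0_norm (L0 t)).
rewrite (@integralD_EFin _ _ _ leb quarter (measurable_itv _) (cst `|ln d|) L)//= integral_quarter_cst LE.
by rewrite EFinD.
Qed.

(** The arcsine law of [[sg, s]] is the image of the uniform law of [quarter]. *)
Definition arcsine_node (sg s t : R) := sg + (s - sg) * sin t ^+ 2.

(** Between [sg] and [s] the square root of a negative number is [0], and so is its
    inverse: the field vanishes there, as it should. *)
Definition arcsine_field (sg s t : R) := (Num.sqrt ((t - sg) * (t - s)))^-1.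

Lemma measurable_ln_node x sg s :
  measurable_fun setT (fun t : R => ln `|x - arcsine_node sg s t|).
Proof.
rewrite (_ : (fun _ => _) = (fun t => ln `|(x - sg) - (s - sg) * sin t ^+ 2|)).
  exact: measurable_ln_sin2.
by apply/funext => t; rewrite /arcsine_node opprD addrA.
Qed.

Let ln_abs_le (v w : R) : 0 < v -> 0 <= w -> `|ln (w + v)| <= `|ln v| + (w + v).
Proof.
move=> v0 w0; have wv : 0 < w + v by rewrite ltr_wpDl.
have h1 := ln_le_self wv.
have h2 : ln v <= ln (w + v) by rewrite ler_ln ?posrE// lerDr.
have h3 : - `|ln v| <= ln v by rewrite lerNl -normrN ler_norm.
have := normr_ge0 (ln v); move: h1 h2 h3; set A := `|ln v|.
move=> h1 h2 h3 h4; rewrite ler_norml; apply/andP; split; lra.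
Qed.

(** Both sides of the interval at once: [X] is the distance of the point to the interval, [z] the
    nearest endpoint ([0] or [d]), and [v t] the distance from that endpoint to the node,
    [d sin t ^+ 2] on the left and [d cos t ^+ 2] on the right. *)
Lemma arcsine_outside (d X : R) (v : R -> R) (z : R) : 0 < d -> 0 <= X -> 0 <= z <= d ->
  measurable_fun setT v ->
  (forall t, quarter t -> v t = `|z - d * sin t ^+ 2|) ->
  (forall t, quarter t -> 0 < v t <= d) ->
  (forall r, 0 < r -> (\int[leb]_(t in quarter) ((r + v t)^-1)%:E =
     (halfpi / (Num.sqrt r * Num.sqrt (r + d)))%:E)%E) ->
  (\int[leb]_(t in quarter) (ln (X + v t))%:E =
    (ln d * halfpi - 2 * log_csc_mass R)%:E +
    \int[leb]_(r in `]0%R, X[) (halfpi * (Num.sqrt (r * (r + d)))^-1)%:E)%E /\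
  (\int[leb]_(t in quarter) `|(ln (X + v t))%:E| <=
    (`|ln d| * halfpi + 2 * log_csc_mass R + (X + d) * halfpi)%:E)%E.
Proof.
move=> d0 X0 zd mv vE v0 hE; have [in1 in2] := arcsine_inside d0 zd.
have vin : {in quarter, forall t, 0 < v t} by move=> t; rewrite inE => /v0/andP[].
have mlX : measurable_fun setT (fun t => ln (X + v t)).
  by apply: measurable_lnr; exact: measurable_funD.
have mlv : measurable_fun setT (fun t => ln (v t)) by exact: measurable_lnr.
have le1 : (\int[leb]_(t in quarter) `|(ln (X + v t))%:E| <=
    (`|ln d| * halfpi + 2 * log_csc_mass R + (X + d) * halfpi)%:E)%E.
  apply: (@le_trans _ _ (\int[leb]_(t in quarter) (`|ln (v t)|%:E + (X + d)%:E))%E).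
    apply: ge0_le_integral => //.
    - by apply/measurable_funTS; apply: measurableT_comp => //; exact/measurable_EFinP.
    - apply: measurable_funTS; apply/measurable_EFinP; apply: measurable_funD => //.
      exact: measurable_normr.
    - move=> t tq; have /andP[vt vd] := v0 t tq; rewrite lee_fin.
      by rewrite (le_trans (ln_abs_le vt X0))// lerD2l lerD2l.
  rewrite ge0_integralD//; last 2 first.
  - by apply: measurable_funTS; apply/measurable_EFinP; exact: measurable_normr.
  - by move=> t _; rewrite lee_fin addr_ge0// ltW.
  rewrite integral_quarter_cst [leRHS]EFinD leeD2r//.
  rewrite (le_trans _ in2)// le_eqVlt; apply/orP; left; apply/eqP.
  by apply: eq_integral => t; rewrite inE => tq; rewrite vE// abse_EFin.
split=> //.
have iv : leb.-integrable quarter (EFin \o (fun t => ln (v t))).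
  apply/integrableP; split; first by apply: measurable_funTS; exact/measurable_EFinP.
  apply: le_lt_trans (ltry (`|ln d| * halfpi + 2 * log_csc_mass R)).
  rewrite (le_trans _ in2)// le_eqVlt; apply/orP; left; apply/eqP.
  by apply: eq_integral => t; rewrite inE => tq; rewrite /= vE// abse_EFin.
have iX : leb.-integrable quarter (EFin \o (fun t => ln (X + v t))).
  apply/integrableP; split; first by apply: measurable_funTS; exact/measurable_EFinP.
  exact: le_lt_trans le1 (ltry _).
have := @integralB_EFin _ _ _ leb quarter _ _ (measurable_itv _) iX iv.
under eq_integral do rewrite -EFinB.
rewrite (@integral_ln_shift v (fun r => halfpi / (Num.sqrt r * Num.sqrt (r + d))) X)//.
have -> : (\int[leb]_(x in quarter) (ln (v x))%:E = (ln d * halfpi - 2 * log_csc_mass R)%:E)%E.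
  by rewrite -in1; apply: eq_integral => t; rewrite inE => tq; rewrite vE.
have -> : (\int[leb]_(r in `]0%R, X[) (halfpi / (Num.sqrt r * Num.sqrt (r + d)))%:E =
  \int[leb]_(r in `]0%R, X[) (halfpi * (Num.sqrt (r * (r + d)))^-1)%:E)%E.
  by apply: eq_integral => r; rewrite inE/= in_itv/= => /andP[r0 _]; rewrite sqrtrM// ltW.
move=> ->; set I := (X in (X - _)%E); have -> : I = (\int[leb]_(t in quarter) (ln (X + v t))%:E)%E by [].
rewrite addeC; rewrite subeK//.
Qed.

Lemma sqrt_arcsine_field_inside (sg s t : R) : sg <= t <= s -> arcsine_field sg s t = 0.
Proof.
move=> /andP[h1 h2]; rewrite /arcsine_field ler0_sqrtr ?invr0//.
by rewrite mulr_ge0_le0// ?subr_ge0 ?subr_le0.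
Qed.

Lemma measurable_arcsine_field sg s : measurable_fun setT (arcsine_field sg s).
Proof.
apply: measurable_invr; apply: measurable_sqrtr; apply: measurable_funM.
  exact: measurable_funB.
exact: measurable_funB.
Qed.

Lemma arcsine_field_ge0 sg s t : 0 <= arcsine_field sg s t.
Proof. by rewrite invr_ge0 sqrtr_ge0. Qed.

(** Because [arcsine_field] vanishes on [[sg, s]], the formula that starts at [sg] covers the points
    inside the interval as well as those to its right. The last clause is a crude bound, linear in
    [|x|], for integrability. *)
Lemma arcsine_potential sg s x : sg < s ->
  [/\ sg <= x -> (\int[leb]_(t in quarter) (ln `|x - arcsine_node sg s t|)%:E =
       (ln (s - sg) * halfpi - 2 * log_csc_mass R)%:E +
       \int[leb]_(t in `]sg, x[) (halfpi * arcsine_field sg s t)%:E)%E,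
    x <= sg -> (\int[leb]_(t in quarter) (ln `|x - arcsine_node sg s t|)%:E =
       (ln (s - sg) * halfpi - 2 * log_csc_mass R)%:E +
       \int[leb]_(t in `]x, sg[) (halfpi * arcsine_field sg s t)%:E)%E &
    (\int[leb]_(t in quarter) `|(ln `|x - arcsine_node sg s t|)%:E| <=
      (`|ln (s - sg)| * halfpi + 2 * log_csc_mass R + (`|x| + `|sg| + `|s|) * halfpi)%:E)%E].
Proof.
move=> sgs; set d := s - sg; have d0 : 0 < d by rewrite subr_gt0.
have hp := halfpi_gt0 R.
have nodeE t : x - arcsine_node sg s t = (x - sg) - d * sin t ^+ 2.
  by rewrite /arcsine_node opprD addrA.
have mgam : measurable_fun setT (fun t => halfpi * arcsine_field sg s t).
  by apply: measurable_funM => //; exact: measurable_arcsine_field.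
have gam0 t : 0 <= halfpi * arcsine_field sg s t.
  by rewrite mulr_ge0 ?arcsine_field_ge0// ltW.
have in0 a b : sg <= a -> b <= s ->
    (\int[leb]_(t in `]a, b[) (halfpi * arcsine_field sg s t)%:E = 0)%E.
  move=> sga bs; apply: integral0_eq => t /=; rewrite in_itv/= => /andP[at_ tb].
  rewrite sqrt_arcsine_field_inside ?mulr0// (le_trans sga (ltW at_))/=.
  by rewrite (le_trans (ltW tb)).
have sq01 t : quarter t -> 0 < sin t ^+ 2 <= 1 /\ 0 < cos t ^+ 2 <= 1.
  move=> /sin_cos_gt0[st ct]; have := cos2Dsin2 t.
  have := exprn_gt0 2 st; have := exprn_gt0 2 ct.
  by move: (sin t ^+ 2) (cos t ^+ 2) => S C *; split; apply/andP; split; lra.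
have bnd (y : R) : y <= `|x| + `|sg| + `|s| ->
  ((`|ln d| * halfpi + 2 * log_csc_mass R + y * halfpi)%:E <=
   (`|ln d| * halfpi + 2 * log_csc_mass R + (`|x| + `|sg| + `|s|) * halfpi)%:E)%E.
  by move=> yle; rewrite lee_fin lerD2l ler_wpM2r// ltW.
have [x1 x2] := (ler_norm x, ler_norm (- x)); have [g1 g2] := (ler_norm sg, ler_norm (- sg)).
have [s1 s2] := (ler_norm s, ler_norm (- s)).
rewrite normrN in x2; rewrite normrN in g2; rewrite normrN in s2.
under eq_integral do rewrite nodeE.
under [X in [/\ _, _ & (X <= _)%E]]eq_integral do rewrite nodeE.
have [xsg|sgx] := leP x sg.
  pose X := sg - x.
  have X0 : 0 <= X by rewrite subr_ge0.
  have [||t tq|t tq|r r0|o1 o2] := @arcsine_outside d X (fun t => d * sin t ^+ 2) 0 d0 X0.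
  - by rewrite lexx ltW.
  - apply: measurable_funM => //; apply: measurable_funX.
    by apply: measurable_sinr; exact: measurable_id.
  - by rewrite sub0r normrN ger0_norm// mulr_ge0 ?(ltW d0)// sqr_ge0.
  - by have [/andP[S0 S1] _] := sq01 t tq; rewrite mulr_gt0//= ler_piMr// ltW.
  - rewrite -(integral_trig_inv r0 (addr_gt0 r0 d0)); apply: eq_integral => t _.
    by congr (_^-1)%:E; rewrite -[r in LHS]mulr1 -(cos2Dsin2 t); ring.
  have lnE t : quarter t -> ln `|x - sg - d * sin t ^+ 2| = ln (X + d * sin t ^+ 2).
    move=> tq; congr ln; rewrite -normrN ger0_norm; first by rewrite /X; ring.
    by rewrite opprB subr_ge0 (le_trans (_ : _ <= 0))// ?subr_le0// mulr_ge0 ?sqr_ge0// ltW.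
  have E1 : (\int[leb]_(t in quarter) (ln `|x - sg - d * sin t ^+ 2|)%:E =
     \int[leb]_(t in quarter) (ln (X + d * sin t ^+ 2))%:E)%E.
    by apply: eq_integral => t; rewrite inE => tq; rewrite lnE.
  have E2 : (\int[leb]_(t in quarter) `|(ln `|x - sg - d * sin t ^+ 2|)%:E| =
     \int[leb]_(t in quarter) `|(ln (X + d * sin t ^+ 2))%:E|)%E.
    by apply: eq_integral => t; rewrite inE => tq; rewrite lnE.
  have main : (\int[leb]_(r in `]0%R, X[) (halfpi / Num.sqrt (r * (r + d)))%:E =
      \int[leb]_(t in `]x, sg[) (halfpi * arcsine_field sg s t)%:E)%E.
    have := @ge0_integral_reflect R _ 0 X sg mgam gam0.
    rewrite subr0 (_ : sg - X = x); last by rewrite /X; ring.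
    move=> <-; apply: eq_integral => r _; congr (_ * _^-1)%:E; congr Num.sqrt.
    by rewrite /d; ring.
  rewrite E1 E2; split.
  - move=> sgx; rewrite o1; congr (_ + _)%E.
    by rewrite /X (_ : x = sg) ?subrr ?set_itvoo0 ?integral_set0//; apply/eqP; rewrite eq_le xsg.
  - by move=> _; rewrite o1 main.
  - by rewrite (le_trans o2)// bnd// /X /d; lra.
have [xs|sx] := leP x s.
  have zd : 0 <= x - sg <= d by rewrite subr_ge0 (ltW sgx)/= lerD2r.
  have [i1 i2] := arcsine_inside d0 zd; rewrite i1; split.
  - by move=> _; rewrite in0// adde0.
  - by [].
  - by rewrite (le_trans i2)// (le_trans _ (bnd 0 _))// ?addr_ge0// mul0r addr0.
pose X := x - s.
have X0 : 0 <= X by rewrite subr_ge0 ltW.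
have cs t : d - d * sin t ^+ 2 = d * cos t ^+ 2 by rewrite cos2sin2; ring.
have [||t tq|t tq|r r0|o1 o2] := @arcsine_outside d X (fun t => d * cos t ^+ 2) d d0 X0.
- by rewrite lexx ltW.
- apply: measurable_funM => //; apply: measurable_funX.
  by apply: measurable_cosr; exact: measurable_id.
- by rewrite cs ger0_norm// mulr_ge0 ?(ltW d0)// sqr_ge0.
- by have [_ /andP[S0 S1]] := sq01 t tq; rewrite mulr_gt0//= ler_piMr// ltW.
- rewrite [Num.sqrt r * _]mulrC -(integral_trig_inv (addr_gt0 r0 d0) r0).
  apply: eq_integral => t _.
  by congr (_^-1)%:E; rewrite -[r in LHS]mulr1 -(cos2Dsin2 t); ring.
have lnE t : ln `|x - sg - d * sin t ^+ 2| = ln (X + d * cos t ^+ 2).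
  congr ln; rewrite (_ : x - sg - d * sin t ^+ 2 = X + d * cos t ^+ 2).
    by rewrite ger0_norm// addr_ge0// mulr_ge0 ?sqr_ge0// ltW.
  by rewrite -cs /X /d; ring.
have main : (\int[leb]_(r in `]0%R, X[) (halfpi / Num.sqrt (r * (r + d)))%:E =
    \int[leb]_(t in `]sg, x[) (halfpi * arcsine_field sg s t)%:E)%E.
  rewrite (@ge0_integral_split R _ sg s x)// ?(ltW sgs) ?(ltW sx)// in0// add0e.
  have := @ge0_integral_shift R _ 0 X s mgam gam0.
  rewrite addr0 (_ : s + X = x); last by rewrite /X; ring.
  move=> <-; apply: eq_integral => r _; congr (_ * _^-1)%:E; congr Num.sqrt.
  by rewrite /d; ring.
under eq_integral do rewrite lnE.
under [X in [/\ _, _ & (X <= _)%E]]eq_integral do rewrite lnE.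
split.
- by move=> _; rewrite o1 main.
- by [].
- by rewrite (le_trans o2)// bnd// /X /d; lra.
Qed.

End ArcsinePotential.

(** * Probability measures with a prescribed density *)

Section DensityProbability.
Variable R : realType.
Local Notation mR := (measurableTypeR R).
Local Notation leb := (@lebesgue_measure R).

Lemma probability_of_density (D : R -> R) : measurable_fun setT D -> (forall x, 0 <= D x) ->
  (\int[leb]_x (D x)%:E = 1)%E ->
  exists mu : probability R R,
    (forall A : set R, measurable A -> mu A = \int[leb]_(x in A) (D x)%:E)%E /\
    (forall h : R -> \bar R, measurable_fun setT h -> (forall x, 0 <= h x)%E ->
      (\int[mu]_x h x = \int[leb]_x (h x * (D x)%:E))%E).
Proof.
move=> mD D0 D1.
pose nu (A : set mR) := (\int[leb]_(x in A) (D x)%:E)%E.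
have mDE : measurable_fun setT (EFin \o D) by exact/measurable_EFinP.
have nu0 : nu set0 = 0%E by rewrite /nu integral_set0.
have nu_ge0 A : (0 <= nu A)%E by apply: integral_ge0 => x _; rewrite lee_fin.
have nu_sigma : semi_sigma_additive nu.
  move=> A mA tA mUA; rewrite /nu ge0_integral_bigcup//=.
  - apply: is_cvg_ereal_nneg_natsum_cond => n _ _.
    by apply: integral_ge0 => x _; rewrite lee_fin.
  - exact: measurable_funTS.
  - by move=> x _; rewrite lee_fin.
have nuT : nu setT = 1%E by [].
pose m : {measure set mR -> \bar R} := HB.pack nu (isMeasure.Build _ _ _ nu nu0 nu_ge0 nu_sigma).
pose p : probability mR R := HB.pack (Measure.sort m) (Measure_isProbability.Build _ _ _ m nuT).
have dom : p `<< leb.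
  apply/null_content_dominatesP => A mA A0; rewrite /= /nu.
  by apply: null_set_integral => //; exact: measurable_funTS.
(* Integration against [p] is known through its Radon-Nikodym derivative, which agrees with [D]
   almost everywhere because both have the same integral over every measurable set. *)
have pE (h : mR -> \bar R) : measurable_fun setT h -> (forall x, 0 <= h x)%E ->
    (\int[p]_x h x = \int[leb]_x (h x * (D x)%:E))%E.
  move=> mh h0; rewrite -(Radon_Nikodym_SigmaFinite.change_of_variables dom)//.
  have fint := Radon_Nikodym_SigmaFinite.f_integrable dom.
  apply: ae_eq_integral => //.
  - by apply: emeasurable_funM => //; exact: measurable_int fint.
  - exact: emeasurable_funM.
  - apply: ae_eqe_mul2l; apply: integral_ae_eq => // E _ mE.
    by rewrite -(Radon_Nikodym_SigmaFinite.f_integral dom mE).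
(* So far the measure lives on the copy of [R] that carries Lebesgue measure; the identity map
   transports it to the measurable structure of [R] itself. *)
pose idR (x : mR) : R := x.
have mid : measurable_fun setT idR by exact: measurable_id.
pose X : {mfun mR >-> R} := HB.pack idR (isMeasurableFun.Build _ _ _ _ idR mid).
exists (distribution p X); split => [A mA|h mh h0]; first by [].
by rewrite ge0_integral_distribution// pE.
Qed.

End DensityProbability.

(** * Mixtures of arcsine laws *)

Section Mixture.
Variable R : realType.
Local Notation mR := (measurableTypeR R).
Local Notation leb := (@lebesgue_measure R).
Local Notation quarter := (`]0%R, (@pi R / 2)%R[%classic).
Implicit Types (n h : R -> R) (x y s sg t d : R).

Lemma measurable_node_pair sg :
  measurable_fun setT (fun w : mR * mR => arcsine_node sg w.1 w.2).
Proof.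
apply: measurable_funD => //; apply: measurable_funM.
  by apply: measurable_funB => //; exact: measurable_fst.
by apply: measurable_funX; apply: measurable_sinr; exact: measurable_snd.
Qed.

(** For fixed [t], substitute [y = arcsine_node sg s t], that is [s = sg + (y - sg) / sin t ^+ 2]
    with [ds = dy / sin t ^+ 2]. As [s] is at least [y], the variable [y] stays in []sg, b[], and
    the cut at [s = b] is carried by the vanishing of [n]. *)
Lemma arcsine_mixture n h sg b :
  measurable_fun setT n -> (forall s, 0 <= n s) ->
  measurable_fun setT h -> (forall y, 0 <= h y) ->
  (forall s, ~~ (sg < s < b) -> n s = 0) ->
  (\int[leb]_(s in `]sg, b[) \int[leb]_(t in quarter) (n s * h (arcsine_node sg s t))%:E =
   \int[leb]_(y in `]sg, b[) ((h y)%:E *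
      \int[leb]_(t in quarter) (n (sg + (y - sg) / sin t ^+ 2) / sin t ^+ 2)%:E))%E.
Proof.
move=> mn n0 mh h0 nv.
have ms2 : measurable_fun setT (fun w : mR * mR => sin w.2 ^+ 2).
  by apply: measurable_funX; apply: measurable_sinr; exact: measurable_snd.
have mi2 : measurable_fun setT (fun w : mR * mR => (sin w.2 ^+ 2)^-1) by exact: measurable_invr.
rewrite (@ge0_fubini_set _ `]sg, b[ quarter (fun s t => n s * h (arcsine_node sg s t)))//; first last.
- by move=> s t _ _; rewrite mulr_ge0.
- apply: measurable_funM; first by apply: measurableT_comp => //; exact: measurable_fst.
  exact: (measurableT_comp mh (measurable_node_pair sg)).
transitivity (\int[leb]_(t in quarter) \int[leb]_(y in `]sg, b[)
    (h y * (n (sg + (y - sg) / sin t ^+ 2) / sin t ^+ 2))%:E)%E.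
  apply: eq_integral => t; rewrite inE => tq; have [st _] := sin_cos_gt0 tq.
  set c := sin t ^+ 2; have c0 : 0 < c by rewrite exprn_gt0.
  have c1 : c <= 1 by have := cos2Dsin2 t; have := sqr_ge0 (cos t); rewrite /c; lra.
  pose f s := (n s * h (sg + (s - sg) * c)).
  have mf : measurable_fun setT (EFin \o f).
    apply/measurable_EFinP; apply: measurable_funM => //; apply: measurableT_comp => //.
    by apply: measurable_funD => //; apply: measurable_funM => //; exact: measurable_funB.
  have f0 s : (0 <= (EFin \o f) s)%E by rewrite lee_fin mulr_ge0.
  have ci : c^-1 != 0 by rewrite invr_eq0 gt_eqF.
  have := ge0_integral_affine (sg - sg / c) ci mf f0.
  rewrite (gtr0_norm (_ : 0 < c^-1)) ?invr_gt0// invrK => eqf.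
  have restr (g : R -> R) : (forall s, ~~ (sg < s < b) -> g s = 0) ->
      (\int[leb]_(s in `]sg, b[) (g s)%:E = \int[leb]_s (g s)%:E)%E.
    move=> gv; rewrite integral_mkcond; apply: eq_integral => s _; rewrite patchE.
    by case: ifPn => //; rewrite notin_setE/= in_itv/= => /negP/gv ->.
  rewrite (restr f); last by move=> s /nv ns; rewrite /f ns mul0r.
  rewrite restr; last first.
    move=> y yn; rewrite nv ?mul0r ?mulr0//; apply: contra yn => /andP[y1 y2].
    have y0 : 0 < y - sg by rewrite -(pmulr_lgt0 _ (_ : 0 < c^-1)) ?invr_gt0//; lra.
    have : (y - sg) <= (y - sg) / c by rewrite ler_pdivlMr// ler_piMr// ltW.
    by move=> h1; apply/andP; split; lra.
  transitivity ((c^-1)%:E * (c%:E * \int[leb]_x (EFin \o f) x))%E.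
    by rewrite muleA -EFinM mulVf ?gt_eqF// mul1e.
  rewrite -eqf -ge0_integralZl//; last 2 first.
  - apply: (measurableT_comp mf); apply: measurable_funD => //; exact: measurable_funM.
  - by rewrite lee_fin invr_ge0 ltW.
  apply: eq_integral => y _; rewrite /= /f -EFinM; congr EFin.
  have -> : c^-1 * y + (sg - sg / c) = sg + (y - sg) / c by field; rewrite gt_eqF.
  have -> : sg + (sg + (y - sg) / c - sg) * c = y by field; rewrite gt_eqF.
  by ring.
rewrite -(@ge0_fubini_set _ `]sg, b[ quarter (fun y t =>
   h y * (n (sg + (y - sg) / sin t ^+ 2) / sin t ^+ 2)))//; first last.
- by move=> y t _ _; rewrite mulr_ge0// mulr_ge0// invr_ge0 sqr_ge0.
- apply: measurable_funM; first by apply: measurableT_comp => //; exact: measurable_fst.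
  apply: measurable_funM => //; apply: measurableT_comp => //.
  apply: measurable_funD => //; apply: measurable_funM => //.
  by apply: measurable_funB => //; exact: measurable_fst.
apply: eq_integral => y _; rewrite -ge0_integralZl//.
- apply: measurable_funTS; apply/measurable_EFinP; apply: measurable_funM.
    apply: measurableT_comp => //; apply: measurable_funD => //; apply: measurable_funM => //.
    by apply: measurable_invr; apply: measurable_funX; apply: measurable_sinr; exact: measurable_id.
  by apply: measurable_invr; apply: measurable_funX; apply: measurable_sinr; exact: measurable_id.
- by move=> t _; rewrite lee_fin mulr_ge0// invr_ge0 sqr_ge0.
- by rewrite lee_fin.
Qed.

End Mixture.

(** * The hard edge *)

Section HardEdgeWeight.
Variable R : realType.
Local Notation mR := (measurableTypeR R).
Local Notation leb := (@lebesgue_measure R).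
Local Notation halfpi := (@pi R / 2)%R.
Local Notation quarter := (`]0%R, (@pi R / 2)%R[%classic).
Variables al sg b : R.
Hypothesis al0 : 0 <= al.
Hypothesis sg0 : al != 0 -> 0 < sg.
Hypothesis sgb : sg < b.

(** When [al = 0] the edge may be negative and the terms with a factor [al] contain
    junk square roots, which that factor annihilates. *)
Lemma scale_derive (F : R -> R) (x f : R) :
  (al != 0 -> is_derive x 1 F f) -> is_derive x 1 (fun t => al * F t) (al * f).
Proof.
have [->|al1] := eqVneq al 0 => H.
  rewrite mul0r (_ : (fun _ => _) = cst 0); first exact: is_derive_cst.
  by apply/funext => t; rewrite mul0r.
by have := is_derive_mulf (is_derive_cstf al x) (H isT); rewrite mul0r add0r.
Qed.

Lemma scale_continuous (F : R -> R) (x : R) :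
  (al != 0 -> {for x, continuous F}) -> {for x, continuous (fun t => al * F t)}.
Proof.
have [->|al1] := eqVneq al 0 => H.
  rewrite (_ : (fun _ => _) = cst 0); first exact: cst_continuous.
  by apply/funext => t; rewrite mul0r.
by apply: cvgMr; exact: H.
Qed.

(** The weight of interest has [k = 1] and [M = 0] but changes sign; with [M] large
    the weights for [k = 1] and [k = 0] are both nonnegative, and their difference is
    the signed weight. *)
Definition edge_weight (k M s : R) : R :=
  k * ((3 * s - sg) / 4 - al * (Num.sqrt sg / (2 * (s * Num.sqrt s)))) + M.

Lemma measurable_edge_weight k M : measurable_fun setT (edge_weight k M).
Proof.
apply: measurable_funD => //; apply: measurable_funM => //; apply: measurable_funB.
  by apply: measurable_funM => //; apply: measurable_funB => //; exact: measurable_funM.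
apply: measurable_funM => //; apply: measurable_funM => //; apply: measurable_invr.
apply: measurable_funM => //; apply: measurable_funM => //; exact: measurable_sqrtr.
Qed.

Lemma al_pos s : al != 0 -> sg <= s -> [/\ 0 < s, Num.sqrt s != 0 & Num.sqrt s ^+ 2 = s].
Proof.
by move=> al1 h; have s0 := lt_le_trans (sg0 al1) h; rewrite gt_eqF ?sqrtr_gt0// sqr_sqrtr// ltW.
Qed.

Lemma edge_weight_continuous k M s : sg <= s -> {for s, continuous (edge_weight k M)}.
Proof.
move=> sgs; apply: cvgD; last exact: cvg_cst.
have c1 : {for s, continuous (fun s : R => (3 * s - sg) / 4)} by derive_continuous.
move: (Num.sqrt sg) => r.
have c2 : {for s, continuous (fun s : R => al * (r / (2 * (s * Num.sqrt s))))}.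
  apply: scale_continuous => al1; have [s0 s1 s2] := al_pos al1 sgs.
  by derive_continuous => //; rewrite ?mulf_neq0// gt_eqF.
by apply: cvgMr; exact: (cvgB c1 c2).
Qed.

(** The [al] term decreases in [s], so its value at [sg] bounds it; the affine term is controlled by
    the two endpoints. *)
Lemma edge_weight_bounded : exists M : R, [/\ 0 <= M &
  forall s, sg < s < b -> forall k, 0 <= k <= 1 -> 0 <= edge_weight k M s <= 2 * M].
Proof.
pose M := `|sg| + `|b| + al * (Num.sqrt sg / (2 * (sg * Num.sqrt sg))).
have r0 : 0 <= al * (Num.sqrt sg / (2 * (sg * Num.sqrt sg))).
  have [->|al1] := eqVneq al 0; first by rewrite mul0r.
  by rewrite mulr_ge0// divr_ge0 ?sqrtr_ge0// !mulr_ge0 ?sqrtr_ge0// ltW// sg0.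
have M0 : 0 <= M by rewrite !addr_ge0.
exists M; split => // s /andP[s1 s2] k /andP[k0 k1].
have : `|(3 * s - sg) / 4 - al * (Num.sqrt sg / (2 * (s * Num.sqrt s)))| <= M.
  have [g1 g2] := (ler_norm sg, ler_norm (- sg)); rewrite normrN in g2.
  have [b1 b2] := (ler_norm b, ler_norm (- b)); rewrite normrN in b2.
  have h0 : 0 <= al * (Num.sqrt sg / (2 * (s * Num.sqrt s))).
    have [->|al1] := eqVneq al 0; first by rewrite mul0r.
    rewrite mulr_ge0// divr_ge0 ?sqrtr_ge0// !mulr_ge0 ?sqrtr_ge0// ltW//.
    by rewrite (lt_trans (sg0 al1)).
  have h1 : al * (Num.sqrt sg / (2 * (s * Num.sqrt s))) <=
      al * (Num.sqrt sg / (2 * (sg * Num.sqrt sg))).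
    have [->|al1] := eqVneq al 0; first by rewrite !mul0r.
    have g0 := sg0 al1; have s0 := lt_trans g0 s1.
    rewrite ler_wpM2l// ler_wpM2l ?sqrtr_ge0// lef_pV2 ?posrE ?mulr_gt0 ?sqrtr_gt0//.
    by rewrite ler_wpM2l// ler_pM ?sqrtr_ge0 ?(ltW g0) ?(ltW s1)// ler_wsqrtr// ltW.
  by rewrite ler_norml /M; apply/andP; split; lra.
rewrite /edge_weight; set m := (X in `|X|); rewrite ler_norml => /andP[m1 m2].
rewrite -/m; have h1 : 0 <= k * (m + M) by rewrite mulr_ge0//; lra.
have h2 : 0 <= k * (M - m) by rewrite mulr_ge0//; lra.
have h3 : 0 <= (1 - k) * M by rewrite mulr_ge0//; lra.
by apply/andP; split; lra.
Qed.

(** The left-hand side of the hypothesis is twice the integral of the signed weight, minus 2; it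
    thus says that the signed weight has mass 1. *)
Lemma edge_weight_mass k M :
  3 / 4 * (b - sg) ^+ 2 + sg * (b - sg) + 2 * al * Num.sqrt (sg / b) - 2 * al - 2 = 0 ->
  (\int[leb]_(s in `]sg, b[) (edge_weight k M s)%:E = (k + M * (b - sg))%:E)%E.
Proof.
move=> mass.
rewrite -(@integral_itv_bndoo _ sg b _ true false); last first.
  apply/measurable_EFinP; apply: measurable_funTS; exact: measurable_edge_weight.
pose F s := k * ((3 * s ^+ 2 / 2 - sg * s) / 4 + al * (Num.sqrt sg / Num.sqrt s)) + M * s.
have -> : k + M * (b - sg) = F b - F sg.
  suff e : (3 * b ^+ 2 / 2 - sg * b) / 4 - (3 * sg ^+ 2 / 2 - sg * sg) / 4 +
     al * (Num.sqrt sg / Num.sqrt b) - al * (Num.sqrt sg / Num.sqrt sg) = 1.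
    by rewrite -[in LHS](mulr1 k) -e /F; ring.
  have [a0|al1] := eqVneq al 0.
    by move: mass; rewrite a0 !mul0r !mulr0 !mul0r => mass; lra.
  have g0 := sg0 al1; have [_ s1 _] := al_pos al1 (lexx _).
  rewrite divff// -sqrtrV ?(ltW (lt_trans g0 sgb))// -sqrtrM ?(ltW g0)//.
  by move: (Num.sqrt (sg / b)) mass => r mass; lra.
apply: (@FTC_cc _ F (edge_weight k M) sg b (ltW sgb)) => s /andP[sgs _]; last first.
  exact: edge_weight_continuous.
  have [s0|s0] := eqVneq al 0.
    rewrite /F /edge_weight s0 mul0r subr0; under eq_fun do rewrite mul0r addr0.
    by derive_to => //; field.
  have [s1 s2 s3] := al_pos s0 sgs.
  rewrite /F /edge_weight; move: (Num.sqrt sg) => r; derive_to => //.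
  by move: (Num.sqrt s) s2 s3 => u u0 <-; field.
Qed.

Definition edge_weight0 (k M s : R) : R :=
  if sg < s < b then edge_weight k M s else 0.

Lemma measurable_edge_weight0 k M : measurable_fun setT (edge_weight0 k M).
Proof.
rewrite (_ : edge_weight0 k M = edge_weight k M \* \1_`]sg, b[).
  by apply: measurable_funM; [exact: measurable_edge_weight|exact: measurable_indic].
apply/funext => s; rewrite /edge_weight0 /= indicE mem_setE in_itv/=.
by case: ifP; rewrite ?mulr1 ?mulr0.
Qed.

(** A primitive, in [v = cos t / sin t], of the integrand of [edge_density]. *)
Let Lam (k M y v : R) :=
  k * ((2 * sg * v + 3 * (y - sg) * (v + v ^+ 3 / 3)) / 4 -
    al * (Num.sqrt sg / 2 * (v / (y * Num.sqrt (y + (y - sg) * v ^+ 2))))) + M * v.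

Let dLam (k M y v : R) : sg < y -> is_derive v 1 (Lam k M y) (edge_weight k M (y + (y - sg) * v ^+ 2)).
Proof.
move=> sgy; have v2 : 0 <= (y - sg) * v ^+ 2 by rewrite mulr_ge0 ?sqr_ge0// subr_ge0 ltW.
rewrite /Lam /edge_weight; move: (Num.sqrt sg) => r.
have d1 : is_derive v 1 (fun v => (2 * sg * v + 3 * (y - sg) * (v + v ^+ 3 / 3)) / 4)
    ((3 * (y + (y - sg) * v ^+ 2) - sg) / 4).
  by derive_to => //; field.
have d2 : is_derive v 1 (fun v => al * (r / 2 * (v / (y * Num.sqrt (y + (y - sg) * v ^+ 2)))))
   (al * (r / (2 * ((y + (y - sg) * v ^+ 2) * Num.sqrt (y + (y - sg) * v ^+ 2))))).
  apply: scale_derive => al1.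
  have y0 : 0 < y by rewrite (lt_trans (sg0 al1)).
  set w := y + (y - sg) * v ^+ 2.
  have w0 : 0 < w by rewrite ltr_wpDr.
  have wE : Num.sqrt w ^+ 2 = w by rewrite sqr_sqrtr// ltW.
  have u0 : Num.sqrt w != 0 by rewrite gt_eqF// sqrtr_gt0.
  have y1 : y != 0 by rewrite gt_eqF.
  derive_to; [by []|by rewrite mulf_neq0|by []|].
  rewrite -/w; have e : (y - sg) * v ^+ 2 = Num.sqrt w ^+ 2 - y by rewrite wE /w; ring.
  transitivity (r / 2 * ((Num.sqrt w ^+ 2 - (y - sg) * v ^+ 2) / (y * Num.sqrt w ^+ 3))).
    by move: (Num.sqrt w) u0 => u u0; field; rewrite u0 y1.
  rewrite e; transitivity (r / (2 * (Num.sqrt w ^+ 2 * Num.sqrt w))); last by rewrite wE.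
  by move: (Num.sqrt w) u0 => u u0; field; rewrite u0 y1.
have d3 := is_derive_addf (is_derive_mulf (is_derive_cstf k v)
  (is_derive_addf d1 (is_derive_oppf d2))) (is_derive_mulf (is_derive_cstf M v) (is_derive_idf v)).
by apply: (is_derive_eqf d3); ring.
Qed.

(** The cut [s < b] becomes [t > t0] with [sin t0 ^+ 2 = (y - sg) / (b - sg)]. In the variable
    [cos t / sin t] the range then runs from [0], at [t = pi / 2], to [sqrt ((b - y) / (y - sg))],
    which is the square root in [f_hard]. The last summand is the contribution of the constant
    weight [M]. *)
Lemma edge_density (k M y : R) : sg < y < b ->
  (forall s, sg < s < b -> 0 <= edge_weight k M s) ->
  (\int[leb]_(t in quarter) (edge_weight0 k M (sg + (y - sg) / sin t ^+ 2) / sin t ^+ 2)%:E =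
  (halfpi * (k * f_hard al sg b y + M * (2 / pi * Num.sqrt ((b - y) / (y - sg)))))%:E)%E.
Proof.
move=> /andP[sgy yb] w0.
have ys0 : 0 < y - sg by rewrite subr_gt0.
have by0 : 0 < b - y by rewrite subr_gt0.
have bs0 : 0 < b - sg by rewrite subr_gt0.
have hp := halfpi_gt0 R; have p0 := pi_gt0 R; have pn : (pi : R) != 0 by rewrite gt_eqF.
pose r := (y - sg) / (b - sg).
have r0 : 0 < r by rewrite divr_gt0.
have r1 : r < 1 by rewrite ltr_pdivrMr// mul1r; lra.
have sr0 : 0 < Num.sqrt r by rewrite sqrtr_gt0.
have sr1 : Num.sqrt r < 1 by rewrite -[ltRHS]sqrtr1 ltr_sqrt.
pose t0 := asin (Num.sqrt r).
have srE : Num.sqrt r ^+ 2 = r by rewrite sqr_sqrtr// ltW.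
have st0 : sin t0 = Num.sqrt r by rewrite asinK// in_itv/= (ltW sr1) andbT; lra.
have t0p : t0 <= halfpi by rewrite asin_lepi2// (ltW sr1) andbT; lra.
have t0n : - halfpi <= t0 by rewrite asin_geNpi2// (ltW sr1) andbT; lra.
have mono := @ltr_sin R.
have t0h : t0 < halfpi.
  rewrite lt_neqAle t0p andbT; apply/eqP => e; move: st0; rewrite e sin_pihalf; lra.
have t00 : 0 < t0.
  by rewrite -mono ?sin0 ?st0// in_itv/=; apply/andP; split; lra.
have qsin t : quarter t -> (sg < sg + (y - sg) / sin t ^+ 2 < b) = (t0 < t).
  move=> tq; have [s0 _] := sin_cos_gt0 tq; move: tq; rewrite /= in_itv/= => /andP[t1 t2].
  have s2 : 0 < sin t ^+ 2 by rewrite exprn_gt0.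
  rewrite ltrDl divr_gt0//= -[X in X = _](ltrD2r (- sg)) addrAC subrr add0r ltr_pdivrMr//.
  rewrite mulrC -ltr_pdivrMr// -/r -srE ltr_pXn2r ?nnegrE ?sqrtr_ge0 ?(ltW s0)//.
  by rewrite -st0 mono// in_itv/=; apply/andP; split; lra.
pose g t := edge_weight0 k M (sg + (y - sg) / sin t ^+ 2) / sin t ^+ 2.
have g0 t : 0 <= g t.
  rewrite /g /edge_weight0; case: ifP => [h|_]; last by rewrite mul0r.
  by rewrite mulr_ge0 ?w0// invr_ge0 sqr_ge0.
have ms2 : measurable_fun setT (fun t : R => (sin t ^+ 2)^-1).
  by apply: measurable_invr; apply: measurable_funX; apply: measurable_sinr; exact: measurable_id.
have mg : measurable_fun setT g.
  apply: measurable_funM => //; apply: (measurableT_comp (measurable_edge_weight0 k M)).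
  by apply: measurable_funD => //; exact: measurable_funM.
rewrite -/(g _) (@ge0_integral_split R g 0 t0 halfpi (ltW t00) t0p mg g0).
rewrite integral0_eq ?add0e; last first.
  move=> t /=; rewrite in_itv/= => /andP[t1 t2]; rewrite /g /edge_weight0 qsin ?ltNge ?(ltW t2)//=.
    by rewrite mul0r.
  by rewrite in_itv/= t1 (lt_trans t2).
pose f t := edge_weight k M (sg + (y - sg) / sin t ^+ 2) / sin t ^+ 2.
transitivity (\int[leb]_(t in `]t0, halfpi[) (f t)%:E)%E.
  apply: eq_integral => t; rewrite inE/= in_itv/= => /andP[t1 t2].
  by rewrite /g /edge_weight0 qsin ?t1//= in_itv/= t2 (lt_trans t00).
rewrite -(@integral_itv_bndoo _ t0 halfpi _ true false); last first.
  apply/measurable_EFinP; apply: measurable_funTS; apply: measurable_funM => //.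
  apply: (measurableT_comp (measurable_edge_weight k M)).
  by apply: measurable_funD => //; exact: measurable_funM.
pose F t := - Lam k M y (cos t / sin t).
have sE t : t0 <= t <= halfpi -> 0 < sin t.
  move=> /andP[t1 t2]; apply: sin_gt0_pi; apply/andP; split; lra.
have ct0 : cos t0 / sin t0 = Num.sqrt ((b - y) / (y - sg)).
  have c0 : 0 <= cos t0 by apply: cos_ge0_pihalf; apply/andP; split; lra.
  rewrite st0; apply/eqP; rewrite -(eqrXn2 (n := 2)) ?sqrtr_ge0 ?divr_ge0 ?(ltW sr0)//.
  rewrite sqr_sqrtr ?divr_ge0 ?(ltW ys0) ?(ltW by0)// expr_div_n cos2sin2 st0 srE /r.
  by apply/eqP; field; rewrite !gt_eqF.
have -> : halfpi * (k * f_hard al sg b y + M * (2 / pi * Num.sqrt ((b - y) / (y - sg)))) =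
    F halfpi - F t0.
  rewrite /F cos_pihalf mul0r ct0.
  set v := Num.sqrt ((b - y) / (y - sg)).
  have v2 : (y - sg) * v ^+ 2 = b - y.
    by rewrite sqr_sqrtr ?divr_ge0 ?(ltW ys0) ?(ltW by0)//; field; rewrite gt_eqF.
  rewrite /Lam /f_hard -/v v2 (_ : y + (b - y) = b); last by ring.
  have -> : 3 * (y - sg) * (v + v ^+ 3 / 3) = v * (3 * (y - sg) + (y - sg) * v ^+ 2) by field.
  rewrite v2; have [->|al1] := eqVneq al 0; first
    by rewrite !(mulr0, mul0r); move: (@pi R) pn => p p1; field.
  have y0 : 0 < y by rewrite (lt_trans (sg0 al1)).
  have b0 : 0 < b by rewrite (lt_trans y0).
  rewrite sqrtrM ?(ltW (sg0 al1))// sqrtrV ?(ltW b0)//.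
  have sb : Num.sqrt b != 0 by rewrite gt_eqF// sqrtr_gt0.
  have y1 : y != 0 by rewrite gt_eqF.
  rewrite !(mul0r, mulr0); move: (@pi R) pn (Num.sqrt b) sb => p p1 u u0.
  by field; rewrite y1 p1 u0.
apply: (@FTC_cc _ F f t0 halfpi t0p) => t tt; have s0 := sE t tt.
  have dcot : is_derive t 1 (fun t => cos t / sin t) (- (sin t ^+ 2)^-1).
    derive_to; first by rewrite gt_eqF.
    have := cos2Dsin2 t; move: (sin t) s0 (cos t) => s s0 c e.
    transitivity (- ((c ^+ 2 + s ^+ 2) / s ^+ 2)); last by rewrite e mul1r.
    by field; rewrite gt_eqF.
  apply: (is_derive_eqf (is_derive_oppf 
    (@is_derive_compf R (Lam k M y) (fun t => cos t / sin t) t _ _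
      (dLam k M (cos t / sin t) sgy) dcot))).
  rewrite mulrN opprK /f; congr (edge_weight _ _ _ * _).
  by rewrite expr_div_n cos2sin2; field; rewrite gt_eqF.
have s2 : 0 < sin t ^+ 2 by rewrite exprn_gt0.
have c1 : {for t, continuous (fun t => sg + (y - sg) / sin t ^+ 2)}.
  by derive_continuous; rewrite gt_eqF.
have c2 : {for t, continuous (fun t => (sin t ^+ 2)^-1)}.
  by derive_continuous; rewrite gt_eqF.
apply: cvgM; last exact: c2.
apply: (continuous_comp c1); apply: edge_weight_continuous.
by rewrite lerDl divr_ge0// ltW.
Qed.

(** Up to [1 / pi], the factor of [f_hard] that remains beside its square root. Its sign at [sg]
    decides between a hard and a soft edge. *)
Definition edge_slope (t : R) : R := (b - sg) / 2 + t - al * (Num.sqrt sg / Num.sqrt b / t).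

Definition ext_slope (t : R) : R := t - al / t.

(** For [sg < t < b] the quotient is negative and its square root is 0, so a single formula serves
    the support and the region to its right. [left_field] carries the opposite orientation, being
    integrated from [t] up to [sg]. *)
Definition right_field (k M t : R) : R :=
  k * ext_slope t + 2 * M - Num.sqrt ((t - b) / (t - sg)) * (k * edge_slope t + 2 * M).

Definition left_field (k M t : R) : R :=
  Num.sqrt ((b - t) / (sg - t)) * (k * edge_slope t + 2 * M) - (k * ext_slope t + 2 * M).

(** [sqrt `|t - s| * G k M t s] is, up to sign, a primitive in [s] of
    [edge_weight k M s / sqrt `|t - s|]. *)
Let G (k M t s : R) : R := k * ((s - sg) / 2 + t - al * (Num.sqrt sg / Num.sqrt s / t)) + 2 * M.

Let GE k M t : G k M t sg = k * ext_slope t + 2 * M.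
Proof.
rewrite /G /ext_slope subrr mul0r add0r; have [->|al1] := eqVneq al 0; first by rewrite !mul0r.
by have [_ s1 _] := al_pos al1 (lexx _); rewrite divff// mul1r.
Qed.

Let GbE k M t : G k M t b = k * edge_slope t + 2 * M. Proof. by []. Qed.

(** The identity is the product rule for [sqrt |t - s| * G], multiplied out so that no square root
    of [t - s] is left; the same form then serves [s < t] and [s > t]. *)
Let dG (k M t s : R) : sg <= s -> (al != 0 -> t != 0) ->
  exists g, is_derive s 1 (G k M t) g /\ G k M t s - 2 * (t - s) * g = 2 * edge_weight k M s.
Proof.
move=> sgs t0; rewrite /G /edge_weight; move: (Num.sqrt sg) => r.
exists (k * (1 / 2 + al * (r / (2 * (s * Num.sqrt s)) / t))); split.
  have d1 : is_derive s 1 (fun s => (s - sg) / 2 + t) (1 / 2) by derive_to => //; field.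
  have d2 : is_derive s 1 (fun s => al * (r / Num.sqrt s / t))
      (al * (- (r / (2 * (s * Num.sqrt s)) / t))).
    apply: scale_derive => al1; have [s0 s1 s2] := al_pos al1 sgs; have t1 := t0 al1.
    derive_to => //; move: (Num.sqrt s) s1 s2 => u u0 <-; field.
    by rewrite u0 t1.
  apply: (is_derive_eqf (is_derive_addf (is_derive_mulf (is_derive_cstf k s)
    (is_derive_addf d1 (is_derive_oppf d2))) (is_derive_cstf (2 * M) s))).
  by ring.
have [->|al1] := eqVneq al 0; first by rewrite !mul0r; field.
have [s0 s1 s2] := al_pos al1 sgs; have t1 := t0 al1.
move: (Num.sqrt s) s1 s2 => u u0 <-; field.
by rewrite u0 t1.
Qed.

Let cG (k M t s : R) : sg <= s -> (al != 0 -> t != 0) -> {for s, continuous (G k M t)}.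
Proof. by move=> sgs t0; have [g [dg _]] := dG k M sgs t0; exact: is_derive_continuous dg. Qed.

Lemma edge_weight0_ge0 k M s : (forall s, sg < s < b -> 0 <= edge_weight k M s) ->
  0 <= edge_weight0 k M s.
Proof. by rewrite /edge_weight0 => w0; case: ifP => // /w0. Qed.

Lemma measurable_edge_weight_field k M t :
  measurable_fun setT (fun s => edge_weight0 k M s * arcsine_field sg s t).
Proof.
apply: measurable_funM; first exact: measurable_edge_weight0.
apply: measurable_invr; apply: measurable_sqrtr; apply: measurable_funM => //.
exact: measurable_funB.
Qed.

(** Only the laws with [s < t] act at [t], hence the cut at [c]. The boundary term at [sg] gives the
    slope of the external field; the one at [c] vanishes if [c = t] and otherwise produces
    [edge_slope]. *)
Lemma edge_right_field k M t : sg < t -> (forall s, sg < s < b -> 0 <= edge_weight k M s) ->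
  (\int[leb]_(s in `]sg, b[) (edge_weight0 k M s * arcsine_field sg s t)%:E =
   (right_field k M t)%:E)%E.
Proof.
move=> sgt w0; pose c := Num.min t b.
have sgc : sg < c by rewrite lt_min sgt.
have cb : c <= b by rewrite ge_min lexx orbT.
have ct : c <= t by rewrite ge_min lexx.
have t0 : al != 0 -> t != 0 by move=> /sg0 g0; rewrite gt_eqF// (lt_trans g0).
have ts0 : 0 < t - sg by rewrite subr_gt0.
pose f s := edge_weight0 k M s * arcsine_field sg s t.
have f0 s : 0 <= f s by rewrite mulr_ge0 ?edge_weight0_ge0// arcsine_field_ge0.
have mf : measurable_fun setT f by exact: measurable_edge_weight_field.
rewrite (@ge0_integral_split R f sg c b (ltW sgc) cb mf f0).
rewrite [X in (_ + X)%E]integral0_eq ?adde0; last first.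
  move=> s /=; rewrite in_itv/= => /andP[cs sb].
  rewrite /f sqrt_arcsine_field_inside ?mulr0// (ltW sgt)/=.
  by move: cs; rewrite gt_min => /orP[/ltW//|/(lt_trans sb)]; rewrite ltxx.
pose w s := edge_weight k M s * (Num.sqrt (t - sg) * Num.sqrt (t - s))^-1.
transitivity (\int[leb]_(s in `]sg, c[) (w s)%:E)%E.
  apply: eq_integral => s; rewrite inE/= in_itv/= => /andP[s1 s2].
  rewrite /f /w /edge_weight0 s1 (lt_le_trans s2 cb)/= /arcsine_field sqrtrM// ltW//.
pose F s := - (Num.sqrt (t - s) * G k M t s / Num.sqrt (t - sg)).
have u0 : Num.sqrt (t - sg) != 0 by rewrite gt_eqF// sqrtr_gt0.
have -> : right_field k M t = F c - F sg.
  have -> : F sg = - (k * ext_slope t + 2 * M) by rewrite /F GE [_ / _]mulrC mulKf.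
  rewrite /F /right_field opprK [RHS]addrC; congr (_ - _).
  have [tb|bt] := leP t b.
    rewrite /c (min_idPl tb) subrr sqrtr0 !mul0r (_ : Num.sqrt _ = 0) ?mul0r//.
    by rewrite ler0_sqrtr// mulr_le0_ge0// ?subr_le0// invr_ge0 ltW.
  by rewrite /c (min_idPr (ltW bt)) GbE sqrtrM ?subr_ge0 ?(ltW bt)// sqrtrV ?(ltW ts0)// mulrAC.
have cF s : sg <= s -> {for s, continuous F}.
  move=> sgs; apply: cvgN; apply: cvgMl; apply: cvgM; last exact: cG.
  apply: (@continuous_comp _ _ _ (fun s => t - s) Num.sqrt); last exact: sqrt_continuous.
  by apply: cvgB; [exact: cvg_cst|exact: cvg_id].
apply: (@ge0_FTC_oo R F w sg c sgc _ _ _ (cF _ (lexx _)) (cF _ (ltW sgc))) => s /andP[s1 s2].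
- have st0 : 0 < t - s by rewrite subr_gt0 (lt_le_trans s2).
  have [g [dg gE]] := dG k M (ltW s1) t0.
  have d1 : is_derive s 1 (fun s => Num.sqrt (t - s)) (- (2 * Num.sqrt (t - s))^-1).
    by derive_to => //; ring.
  apply: (is_derive_eqf (is_derive_oppf (is_derive_mulf (is_derive_mulf d1 dg)
     (is_derive_cstf (Num.sqrt (t - sg))^-1 s)))).
  have v0 : Num.sqrt (t - s) != 0 by rewrite gt_eqF// sqrtr_gt0.
  have v2 : Num.sqrt (t - s) ^+ 2 = t - s by rewrite sqr_sqrtr// ltW.
  have -> : w s = (G k M t s - 2 * Num.sqrt (t - s) ^+ 2 * g) / 2 /
      (Num.sqrt (t - sg) * Num.sqrt (t - s)).
    by rewrite v2 gE mulrC [_ / 2](_ : _ = edge_weight k M s) 1?mulrC//; field.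
  move: (Num.sqrt (t - sg)) (Num.sqrt (t - s)) u0 v0 (G k M t s) => u v u1 v1 g1.
  by field; rewrite u1 v1.
- have st0 : 0 < t - s by rewrite subr_gt0 (lt_le_trans s2).
  apply: cvgM; first by apply: edge_weight_continuous; exact: ltW.
  have v0 : Num.sqrt (t - s) != 0 by rewrite gt_eqF// sqrtr_gt0.
  have : {for s, continuous (fun s => (Num.sqrt (t - sg) * Num.sqrt (t - s))^-1)}.
    by derive_continuous => //; rewrite mulf_neq0.
  exact.
- by rewrite mulr_ge0 ?invr_ge0 ?mulr_ge0 ?sqrtr_ge0// w0// s1 (lt_le_trans s2).
Qed.

Lemma edge_left_field k M t : t < sg -> (al != 0 -> 0 < t) ->
  (forall s, sg < s < b -> 0 <= edge_weight k M s) ->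
  (\int[leb]_(s in `]sg, b[) (edge_weight0 k M s * arcsine_field sg s t)%:E =
   (left_field k M t)%:E)%E.
Proof.
move=> tsg t0' w0; have t0 : al != 0 -> t != 0 by move=> /t0' ?; rewrite gt_eqF.
have ts0 : 0 < sg - t by rewrite subr_gt0.
pose w s := edge_weight k M s * (Num.sqrt (sg - t) * Num.sqrt (s - t))^-1.
transitivity (\int[leb]_(s in `]sg, b[) (w s)%:E)%E.
  apply: eq_integral => s; rewrite inE/= in_itv/= => /andP[s1 s2].
  rewrite /w /edge_weight0 s1 s2/= /arcsine_field -sqrtrM ?(ltW ts0)//.
  by congr (_ * (Num.sqrt _)^-1)%:E; ring.
pose F s := Num.sqrt (s - t) * G k M t s / Num.sqrt (sg - t).
have u0 : Num.sqrt (sg - t) != 0 by rewrite gt_eqF// sqrtr_gt0.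
have -> : left_field k M t = F b - F sg.
  have -> : F sg = k * ext_slope t + 2 * M by rewrite /F GE [_ / _]mulrC mulKf.
  rewrite /F /left_field GbE; congr (_ - _).
  have tb : t <= b by rewrite ltW// (lt_trans tsg).
  by rewrite sqrtrM ?subr_ge0// sqrtrV ?(ltW ts0)// mulrAC.
have cF s : sg <= s -> {for s, continuous F}.
  move=> sgs; apply: cvgMl; apply: cvgM; last exact: cG.
  apply: (@continuous_comp _ _ _ (fun s => s - t) Num.sqrt); last exact: sqrt_continuous.
  by apply: cvgB; [exact: cvg_id|exact: cvg_cst].
apply: (@ge0_FTC_oo R F w sg b sgb _ _ _ (cF _ (lexx _)) (cF _ (ltW sgb))) => s /andP[s1 s2].
- have st0 : 0 < s - t by rewrite subr_gt0 (lt_trans tsg).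
  have [g [dg gE]] := dG k M (ltW s1) t0.
  have d1 : is_derive s 1 (fun s => Num.sqrt (s - t)) ((2 * Num.sqrt (s - t))^-1).
    by derive_to => //; ring.
  apply: (is_derive_eqf (is_derive_mulf (is_derive_mulf d1 dg)
     (is_derive_cstf (Num.sqrt (sg - t))^-1 s))).
  have v0 : Num.sqrt (s - t) != 0 by rewrite gt_eqF// sqrtr_gt0.
  have v2 : Num.sqrt (s - t) ^+ 2 = s - t by rewrite sqr_sqrtr// ltW.
  have -> : w s = (G k M t s + 2 * Num.sqrt (s - t) ^+ 2 * g) / 2 /
      (Num.sqrt (sg - t) * Num.sqrt (s - t)).
    rewrite v2 (_ : _ + _ = 2 * edge_weight k M s); last by rewrite -gE; ring.
    by rewrite /w; congr (_ / _); field.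
  move: (Num.sqrt (sg - t)) (Num.sqrt (s - t)) u0 v0 (G k M t s) => u v u1 v1 g1.
  by field; rewrite u1 v1.
- have st0 : 0 < s - t by rewrite subr_gt0 (lt_trans tsg).
  apply: cvgM; first by apply: edge_weight_continuous; exact: ltW.
  have v0 : Num.sqrt (s - t) != 0 by rewrite gt_eqF// sqrtr_gt0.
  have : {for s, continuous (fun s => (Num.sqrt (sg - t) * Num.sqrt (s - t))^-1)}.
    by derive_continuous => //; rewrite mulf_neq0.
  exact.
- by rewrite mulr_ge0 ?invr_ge0 ?mulr_ge0 ?sqrtr_ge0// w0// s1.
Qed.

Definition mixed_density (k M y : R) : R :=
  k * f_hard al sg b y + M * (2 / pi * Num.sqrt ((b - y) / (y - sg))).

Definition segment (x : R) : set R := if sg <= x then `]sg, x[%classic else `]x, sg[%classic.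

Lemma measurable_segment x : measurable (segment x : set mR).
Proof. by rewrite /segment; case: ifP. Qed.

Definition base_log (s : R) : R := ln (s - sg) * halfpi - 2 * log_csc_mass R.

Lemma arcsine_potential_segment s x : sg < s ->
  (\int[leb]_(t in quarter) (ln `|x - arcsine_node sg s t|)%:E =
   (base_log s)%:E + \int[leb]_(t in segment x) (halfpi * arcsine_field sg s t)%:E)%E.
Proof.
move=> sgs; have [h1 h2 _] := arcsine_potential x sgs.
by rewrite /segment; case: leP => [/h1|/ltW/h2].
Qed.

Implicit Types (h : R -> R) (x y z s t : R).

Lemma halfpi_muleI (u v : \bar R) : (halfpi%:E * u = halfpi%:E * v)%E -> u = v.
Proof.
have hp := halfpi_gt0 R.
move=> /(congr1 (fun e : \bar R => (halfpi^-1)%:E * e)%E).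
by rewrite !muleA -EFinM mulVf ?gt_eqF// !mul1e.
Qed.

Section Weighted.
Variables k M : R.
Hypothesis w0 : forall s, sg < s < b -> 0 <= edge_weight k M s.
Let n := edge_weight0 k M.
Let n0 s : 0 <= n s. Proof. exact: edge_weight0_ge0. Qed.

Lemma measurable_mixed_density : measurable_fun setT (mixed_density k M).
Proof.
have ms : measurable_fun setT (fun y : R => Num.sqrt ((b - y) / (y - sg))).
  apply: measurable_sqrtr; apply: measurable_funM; first exact: measurable_funB.
  by apply: measurable_invr; exact: measurable_funB.
apply: measurable_funD; last by apply: measurable_funM => //; exact: measurable_funM.
apply: measurable_funM => //; apply: measurable_funM; first exact: measurable_funM.
apply: measurable_funB; last by apply: measurable_funM => //; exact: measurable_invr.
by apply: measurable_funB => //; apply: measurable_funD => //; exact: measurable_funM.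
Qed.

Lemma mixed_density_ge0 y : sg < y < b -> 0 <= mixed_density k M y.
Proof.
move=> yb; have := edge_density yb w0; rewrite -/(mixed_density k M y) => e.
rewrite -(pmulr_rge0 _ (halfpi_gt0 R)) -lee_fin -e; apply: integral_ge0 => t _.
by rewrite lee_fin mulr_ge0 ?invr_ge0 ?sqr_ge0// n0.
Qed.

Lemma mixed_density_integral h : measurable_fun setT h -> (forall y, 0 <= h y) ->
  (\int[leb]_(s in `]sg, b[) \int[leb]_(t in quarter) (n s * h (arcsine_node sg s t))%:E =
   halfpi%:E * \int[leb]_(y in `]sg, b[) (h y * mixed_density k M y)%:E)%E.
Proof.
move=> mh h0; rewrite arcsine_mixture//; last 2 first.
- exact: measurable_edge_weight0.
- by move=> s /negbTE ns; rewrite /n /edge_weight0 ns.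
rewrite -ge0_integralZl//; first last.
- by rewrite lee_fin ltW// halfpi_gt0.
- by move=> y yb; rewrite lee_fin mulr_ge0// mixed_density_ge0// -in_itv.
- apply: measurable_funTS; apply/measurable_EFinP; apply: measurable_funM => //.
  exact: measurable_mixed_density.
apply: eq_integral => y; rewrite inE/= in_itv/= => yb.
by rewrite edge_density// -!EFinM; congr EFin; rewrite /mixed_density; ring.
Qed.

Lemma field_segment x (J : R -> R) :
  (forall t, segment x t ->
    (\int[leb]_(s in `]sg, b[) (n s * arcsine_field sg s t)%:E = (J t)%:E)%E) ->
  (\int[leb]_(s in `]sg, b[) ((n s)%:E * \int[leb]_(t in segment x) (halfpi * arcsine_field sg s t)%:E) =
   halfpi%:E * \int[leb]_(t in segment x) (J t)%:E)%E.
Proof.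
move=> JE; have hp := halfpi_gt0 R; have mseg := measurable_segment x.
have mgam2 : measurable_fun setT (fun w : mR * mR => n w.1 * (halfpi * arcsine_field sg w.1 w.2)).
  apply: measurable_funM.
    by apply: (measurableT_comp (measurable_edge_weight0 k M)); exact: measurable_fst.
  apply: measurable_funM => //; apply: measurable_invr; apply: measurable_sqrtr.
  apply: measurable_funM; first by apply: measurable_funB => //; exact: measurable_snd.
  by apply: measurable_funB; [exact: measurable_snd|exact: measurable_fst].
transitivity (\int[leb]_(s in `]sg, b[) \int[leb]_(t in segment x)
    (n s * (halfpi * arcsine_field sg s t))%:E)%E.
  apply: eq_integral => s _; rewrite -ge0_integralZl//.
  - apply: measurable_funTS; apply/measurable_EFinP; apply: measurable_funM => //.
    exact: measurable_arcsine_field.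
  - by move=> t _; rewrite lee_fin mulr_ge0 ?arcsine_field_ge0// ltW.
  - by rewrite lee_fin.
rewrite (@ge0_fubini_set R _ (segment x) (fun s t => n s * (halfpi * arcsine_field sg s t)))//; last first.
  by move=> s t _ _; rewrite mulr_ge0// mulr_ge0 ?arcsine_field_ge0// ltW.
transitivity (\int[leb]_(t in segment x) (halfpi%:E *
   \int[leb]_(s in `]sg, b[) (n s * arcsine_field sg s t)%:E))%E.
  apply: eq_integral => t _; rewrite -ge0_integralZl//.
  - by apply: eq_integral => s _; rewrite -EFinM; congr EFin; ring.
  - by apply: measurable_funTS; apply/measurable_EFinP; exact: measurable_edge_weight_field.
  - by move=> s _; rewrite lee_fin mulr_ge0 ?arcsine_field_ge0 ?n0.
  - by rewrite lee_fin ltW.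
transitivity (\int[leb]_(t in segment x) (halfpi%:E * (fun t =>
   \int[leb]_(s in `]sg, b[) (n s * arcsine_field sg s t)%:E) t))%E; first by [].
rewrite ge0_integralZl//.
- by congr (_ * _)%E; apply: eq_integral => t; rewrite inE => tx; rewrite JE.
- apply: measurable_funTS.
  apply: (@measurable_integral_param _ `]sg, b[ (fun t s => n s * arcsine_field sg s t)) => //.
    apply: measurable_funM.
      by apply: (measurableT_comp (measurable_edge_weight0 k M)); exact: measurable_snd.
    apply: measurable_invr; apply: measurable_sqrtr.
    apply: measurable_funM; first by apply: measurable_funB => //; exact: measurable_fst.
    by apply: measurable_funB; [exact: measurable_fst|exact: measurable_snd].
  by move=> t s; rewrite mulr_ge0 ?arcsine_field_ge0.
- by move=> t _; apply: integral_ge0 => s _; rewrite lee_fin mulr_ge0 ?arcsine_field_ge0 ?n0.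
- by rewrite lee_fin ltW.
Qed.

(** A common nonnegative majorant is added to [ln `|x - y|] and [ln `|sg - y|], so that
    their difference can be integrated by Tonelli alone. *)
Definition log_shift (z x y : R) : R := ln `|z - y| + (`|ln `|x - y| | + `|ln `|sg - y| |).

Lemma measurable_ln_dist z : measurable_fun setT (fun y : R => ln `|z - y|).
Proof. by apply: measurable_lnr; apply: measurable_normr; exact: measurable_funB. Qed.

Lemma measurable_log_shift z x : measurable_fun setT (log_shift z x).
Proof.
apply: measurable_funD; first exact: measurable_ln_dist.
by apply: measurable_funD; apply: measurable_normr; exact: measurable_ln_dist.
Qed.

Lemma log_shift_ge0 z x y : z = x \/ z = sg -> 0 <= log_shift z x y.
Proof.
rewrite /log_shift; set A := ln `|x - y|; set B := ln `|sg - y|.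
have := ler_norm (- A); have := ler_norm (- B); rewrite !normrN => hB hA.
move=> [] ->; rewrite -/A -/B; have := normr_ge0 A; have := normr_ge0 B; lra.
Qed.

(** At the base point [sg] the segment is empty, so the potential there is the constant
    [base_log s], which also occurs at [x]; the majorant hidden in [log_shift] is the same on both
    sides. *)
Lemma node_potential_diff s x : sg < s ->
  (\int[leb]_(t in quarter) (log_shift x x (arcsine_node sg s t))%:E =
   \int[leb]_(t in quarter) (log_shift sg x (arcsine_node sg s t))%:E +
   \int[leb]_(t in segment x) (halfpi * arcsine_field sg s t)%:E)%E.
Proof.
move=> sgs.
have il z : leb.-integrable quarter (EFin \o (fun t => ln `|z - arcsine_node sg s t|)).
  apply/integrableP; split.
    by apply: measurable_funTS; apply/measurable_EFinP; exact: measurable_ln_node.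
  have [_ _ h] := arcsine_potential z sgs; exact: le_lt_trans h (ltry _).
have iA : leb.-integrable quarter (EFin \o (fun t =>
    `|ln `|x - arcsine_node sg s t| | + `|ln `|sg - arcsine_node sg s t| |)).
  by apply: (@integrableD _ _ _ leb _ _ (EFin \o _) (EFin \o _)) => //; exact: integrable_norm.
have hz z : (\int[leb]_(t in quarter) (log_shift z x (arcsine_node sg s t))%:E =
   \int[leb]_(t in quarter) (ln `|z - arcsine_node sg s t|)%:E + \int[leb]_(t in quarter)
    (`|ln `|x - arcsine_node sg s t| | + `|ln `|sg - arcsine_node sg s t| |)%:E)%E.
  by rewrite -(integralD_EFin _ (il z) iA).
rewrite !hz !arcsine_potential_segment// [segment sg](_ : _ = set0); last first.
  by rewrite /segment lexx set_itvoo0.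
by rewrite integral_set0 adde0 addeAC.
Qed.

Lemma measurable_node_integral h : measurable_fun setT h -> (forall y, 0 <= h y) ->
  measurable_fun setT (fun s => \int[leb]_(t in quarter) (h (arcsine_node sg s t))%:E)%E.
Proof.
move=> mh h0; apply: (@measurable_integral_param _ _ (fun s t => h (arcsine_node sg s t))) => //.
exact: (measurableT_comp mh (measurable_node_pair sg)).
Qed.

Lemma node_integralZ h s : measurable_fun setT h -> (forall y, 0 <= h y) ->
  (\int[leb]_(t in quarter) (n s * h (arcsine_node sg s t))%:E =
   (n s)%:E * \int[leb]_(t in quarter) (h (arcsine_node sg s t))%:E)%E.
Proof.
move=> mh h0; rewrite -ge0_integralZl//.
- apply: measurable_funTS; apply/measurable_EFinP; apply: (measurableT_comp mh).
  apply: measurable_funD => //; apply: measurable_funM => //; apply: measurable_funX.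
  by apply: measurable_sinr; exact: measurable_id.
- by move=> t _; rewrite lee_fin.
- by rewrite lee_fin.
Qed.

Lemma mixed_potential_diff x (J : R -> R) :
  (forall t, segment x t ->
    (\int[leb]_(s in `]sg, b[) (n s * arcsine_field sg s t)%:E = (J t)%:E)%E) ->
  (\int[leb]_(y in `]sg, b[) (log_shift x x y * mixed_density k M y)%:E =
   \int[leb]_(y in `]sg, b[) (log_shift sg x y * mixed_density k M y)%:E +
   \int[leb]_(t in segment x) (J t)%:E)%E.
Proof.
move=> JE; have hp := halfpi_gt0 R.
have [mx ms] := (measurable_log_shift x x, measurable_log_shift sg x).
have lx y : 0 <= log_shift x x y by apply: log_shift_ge0; left.
have ls y : 0 <= log_shift sg x y by apply: log_shift_ge0; right.
suff : (halfpi%:E * \int[leb]_(y in `]sg, b[) (log_shift x x y * mixed_density k M y)%:E =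
   halfpi%:E * \int[leb]_(y in `]sg, b[) (log_shift sg x y * mixed_density k M y)%:E +
   halfpi%:E * \int[leb]_(t in segment x) (J t)%:E)%E.
  rewrite -ge0_muleDr; last 2 first.
  - by apply: integral_ge0 => y yb; rewrite lee_fin mulr_ge0// mixed_density_ge0// -in_itv.
  - apply: integral_ge0 => t tx; rewrite -JE//; apply: integral_ge0 => s _.
    by rewrite lee_fin mulr_ge0 ?arcsine_field_ge0 ?n0.
  exact: halfpi_muleI.
rewrite -!mixed_density_integral// -(field_segment JE) -ge0_integralD//=; last 4 first.
- by move=> s _; apply: integral_ge0 => t _; rewrite lee_fin mulr_ge0.
- apply: measurable_funTS; rewrite (_ : (fun _ => _) = fun s => ((n s)%:E *
     \int[leb]_(t in quarter) (log_shift sg x (arcsine_node sg s t))%:E)%E).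
    apply: emeasurable_funM; last exact: measurable_node_integral.
    by apply/measurable_EFinP; exact: measurable_edge_weight0.
  by apply/funext => s; rewrite node_integralZ.
- move=> s _; rewrite mule_ge0 ?lee_fin//; apply: integral_ge0 => t _.
  by rewrite lee_fin mulr_ge0 ?arcsine_field_ge0// ltW.
- apply: measurable_funTS; apply: emeasurable_funM.
    by apply/measurable_EFinP; exact: measurable_edge_weight0.
  apply: (@measurable_integral_param _ (segment x) (fun s t => halfpi * arcsine_field sg s t)).
  - exact: measurable_segment.
  - apply: measurable_funM => //; apply: measurable_invr; apply: measurable_sqrtr.
    apply: measurable_funM; first by apply: measurable_funB => //; exact: measurable_snd.
    by apply: measurable_funB; [exact: measurable_snd|exact: measurable_fst].
  - by move=> s t; rewrite mulr_ge0 ?arcsine_field_ge0// ltW.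
apply: eq_integral => s; rewrite inE/= in_itv/= => /andP[sgs _].
rewrite !node_integralZ// node_potential_diff// ge0_muleDr//.
- by apply: integral_ge0 => t _; rewrite lee_fin.
- by apply: integral_ge0 => t _; rewrite lee_fin mulr_ge0 ?arcsine_field_ge0// ltW.
Qed.

Lemma mixed_log_bound C : (forall s, sg < s < b -> edge_weight k M s <= C) ->
  exists a' b' : R, 0 <= b' /\ forall x,
  (\int[leb]_(y in `]sg, b[) (`|ln `|x - y| | * mixed_density k M y)%:E <= (a' + b' * `|x|)%:E)%E.
Proof.
move=> wC; have hp := halfpi_gt0 R; have hpn : halfpi != 0 by rewrite gt_eqF.
have bs0 : 0 < b - sg by rewrite subr_gt0.
have C0 : 0 <= C.
  have : sg < (sg + b) / 2 < b by apply/andP; split; lra.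
  by move=> h; rewrite (le_trans (w0 h))// wC.
have m0 : 0 <= log_csc_mass R.
  rewrite -lee_fin -log_csc_massE; apply: integral_ge0 => t _.
  by rewrite lee_fin log_csc_ge0.
pose K x := (b - sg) * halfpi + 2 * log_csc_mass R + (`|x| + (2 * `|sg| + `|b|)) * halfpi.
have K0 x : 0 <= K x by rewrite /K; apply: addr_ge0; [apply: addr_ge0; apply: mulr_ge0 => //; exact: ltW|
    apply: mulr_ge0; [rewrite !addr_ge0// mulr_ge0|exact: ltW]].
have mln x : measurable_fun setT (fun y => `|ln `|x - y| |).
  by apply: measurable_normr; exact: measurable_ln_dist.
(* These constants are [F b - F sg] divided by [halfpi], for the primitive [F] below; [K x] is
   affine in [|x|] with slope [halfpi]. *)
exists (halfpi^-1 * (C * (halfpi * (4 * Num.sqrt (b - sg))) + C * K 0 * (b - sg))).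
exists (C * (b - sg)); split=> [|x]; first by rewrite mulr_ge0// ltW.
rewrite -(@lee_pmul2l _ halfpi%:E) ?lte_fin// -mixed_density_integral//.
pose U s := C * (halfpi * (2 * (Num.sqrt (s - sg))^-1) + K x).
apply: (@le_trans _ _ (\int[leb]_(s in `]sg, b[) (U s)%:E)%E).
  apply: ge0_le_integral => //.
  - by move=> s _; apply: integral_ge0 => t _; rewrite lee_fin mulr_ge0.
  - apply: measurable_funTS; rewrite (_ : (fun _ => _) = fun s => ((n s)%:E *
       \int[leb]_(t in quarter) (`|ln `|x - (arcsine_node sg s t)| |)%:E)%E).
      apply: emeasurable_funM; first by apply/measurable_EFinP; exact: measurable_edge_weight0.
      exact: (measurable_node_integral (mln x)).
    by apply/funext => s; rewrite (node_integralZ _ (mln x)).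
  - apply: measurable_funTS; apply/measurable_EFinP; apply: measurable_funM => //.
    apply: measurable_funD => //; apply: measurable_funM => //; apply: measurable_funM => //.
    by apply: measurable_invr; apply: measurable_sqrtr; exact: measurable_funB.
  - move=> s /=; rewrite in_itv/= => /andP[s1 s2].
    rewrite (node_integralZ s (mln x))//.
    have [_ _ le1] := arcsine_potential x s1.
    have d0 : 0 < s - sg by rewrite subr_gt0.
    have le2 : `|ln (s - sg)| * halfpi + 2 * log_csc_mass R + (`|x| + `|sg| + `|s|) * halfpi <=
        halfpi * (2 * (Num.sqrt (s - sg))^-1) + K x.
      have h1 : `|ln (s - sg)| * halfpi <= (2 * (Num.sqrt (s - sg))^-1 + (b - sg)) * halfpi.
        rewrite ler_wpM2r ?(ltW hp)// (le_trans (norm_ln_le_sqrt d0))// lerD2l; lra.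
      have h2 : (`|x| + `|sg| + `|s|) * halfpi <= (`|x| + (2 * `|sg| + `|b|)) * halfpi.
        rewrite ler_wpM2r ?(ltW hp)//.
        suff : `|s| <= `|sg| + `|b| by lra.
        have := ler_norm b; have := ler_norm (- sg); rewrite normrN => g1 b1.
        have := normr_ge0 b; have := normr_ge0 sg => g2 b2.
        by rewrite ler_norml; apply/andP; split; lra.
      by rewrite /K; lra.
    apply: (@le_trans _ _ ((n s)%:E * (halfpi * (2 * (Num.sqrt (s - sg))^-1) + K x)%:E)%E).
      apply: lee_wpmul2l; first by rewrite lee_fin.
      by apply: le_trans le1 _; rewrite lee_fin.
    rewrite -EFinM lee_fin /U ler_wpM2r//.
      by rewrite addr_ge0// mulr_ge0 ?(ltW hp)// mulr_ge0// invr_ge0 sqrtr_ge0.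
    by rewrite /n /edge_weight0 s1 s2/= wC// s1.
pose F s := C * (halfpi * (4 * Num.sqrt (s - sg)) + K x * s).
have cF s : {for s, continuous F}.
  apply: cvgMr; apply: cvgD; last by apply: cvgMr; exact: cvg_id.
  apply: cvgMr; apply: cvgMr.
  apply: (@continuous_comp _ _ _ (fun s : R => s - sg) Num.sqrt); last exact: sqrt_continuous.
  by apply: cvgB; [exact: cvg_id|exact: cvg_cst].
have -> : (\int[leb]_(s in `]sg, b[) (U s)%:E = (F b - F sg)%:E)%E.
  apply: (@ge0_FTC_oo R F U sg b sgb _ _ _ (cF _) (cF _)) => s /andP[s1 s2].
  - have d0 : 0 < s - sg by rewrite subr_gt0.
    have u0 : Num.sqrt (s - sg) != 0 by rewrite gt_eqF// sqrtr_gt0.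
    rewrite /F /U; move: (K x) halfpi => kx p.
    by derive_to => //; field.
  - have d0 : 0 < s - sg by rewrite subr_gt0.
    have u0 : Num.sqrt (s - sg) != 0 by rewrite gt_eqF// sqrtr_gt0.
    rewrite /U; move: (K x) halfpi => kx p.
    by derive_continuous.
  - by rewrite mulr_ge0// addr_ge0// mulr_ge0 ?(ltW hp)// mulr_ge0// invr_ge0 sqrtr_ge0.
rewrite -EFinM lee_fin /F subrr sqrtr0 le_eqVlt; apply/orP; left; apply/eqP.
rewrite /K normr0; move: halfpi hpn => p pn; field.
exact: pn.
Qed.

End Weighted.

(** Here [j] is nonnegative with finite integral but may be unbounded near an endpoint, and [p] is
    continuous but may change sign: together they model a field [right_field 0 M] or
    [left_field 0 M] plus or minus the external slope. *)
Lemma integral_ge0D_cont (u v : R) (j p P : R -> R) : u <= v -> measurable_fun setT j ->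
  (forall t, u < t < v -> 0 <= j t) -> (\int[leb]_(t in `]u, v[) (j t)%:E < +oo)%E ->
  (forall t, u <= t <= v -> is_derive t 1 P (p t)) ->
  (forall t, u <= t <= v -> {for t, continuous p}) -> measurable_fun setT p ->
  (\int[leb]_(t in `]u, v[) (j t + p t)%:E = \int[leb]_(t in `]u, v[) (j t)%:E + (P v - P u)%:E)%E.
Proof.
move=> uv mj j0 jfin dP cp mp.
have Pint : (\int[leb]_(t in `]u, v[) (p t)%:E = (P v - P u)%:E)%E.
  rewrite -(FTC_cc uv dP cp); apply/esym; apply: (@integral_itv_bndoo _ u v _ true false).
  by apply: measurable_funTS; exact/measurable_EFinP.
have ij : leb.-integrable `]u, v[ (EFin \o j).
  apply/integrableP; split; first by apply: measurable_funTS; exact/measurable_EFinP.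
  rewrite (_ : (\int[leb]_(x in _) _ = \int[leb]_(t in `]u, v[) (j t)%:E)%E)//.
  apply: eq_integral => t; rewrite inE/= in_itv/= => tuv.
  by rewrite /= ger0_norm// j0.
have ip : leb.-integrable `]u, v[ (EFin \o p).
  apply: (@integrableS _ _ _ leb `[u, v]%classic) => //.
    by apply: subset_itv; rewrite bnd_simp.
  apply: continuous_compact_integrable; first exact: segment_compact.
  by apply: continuous_in_subspaceT => t; rewrite inE/= in_itv/= => tuv; exact: cp.
by rewrite -Pint -(integralD_EFin _ ij ip).
Qed.

Definition ext_primitive (t : R) : R := t ^+ 2 / 2 - al * ln t.

Lemma ext_primitive_derive t : (al != 0 -> 0 < t) -> is_derive t 1 ext_primitive (ext_slope t).
Proof.
move=> t0; rewrite /ext_primitive /ext_slope.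
have d1 : is_derive t 1 (fun t : R => t ^+ 2 / 2) t by derive_to => //; field.
have d2 : is_derive t 1 (fun t => al * ln t) (al * t^-1).
  by apply: scale_derive => al1; have t1 := t0 al1; apply: is_derive1_ln.
exact: is_derive_addf d1 (is_derive_oppf d2).
Qed.

Lemma ext_slope_continuous t : (al != 0 -> 0 < t) -> {for t, continuous ext_slope}.
Proof.
move=> t0; apply: cvgB; first exact: cvg_id.
apply: scale_continuous => al1; have t1 := t0 al1.
by apply: inv_continuous; rewrite gt_eqF.
Qed.

Lemma measurable_ext_slope : measurable_fun setT ext_slope.
Proof. by apply: measurable_funB => //; apply: measurable_funM => //; exact: measurable_invr. Qed.

Lemma measurable_edge_slope : measurable_fun setT edge_slope.
Proof.
apply: measurable_funB; first exact: measurable_funD.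
by apply: measurable_funM => //; apply: measurable_funM => //; exact: measurable_invr.
Qed.

Lemma measurable_right_field k M : measurable_fun setT (right_field k M).
Proof.
apply: measurable_funB.
  apply: measurable_funD => //; apply: measurable_funM => //; exact: measurable_ext_slope.
apply: measurable_funM.
  apply: measurable_sqrtr; apply: measurable_funM; first exact: measurable_funB.
  by apply: measurable_invr; exact: measurable_funB.
by apply: measurable_funD => //; apply: measurable_funM => //; exact: measurable_edge_slope.
Qed.

Lemma measurable_left_field k M : measurable_fun setT (left_field k M).
Proof.
apply: measurable_funB; last first.
  apply: measurable_funD => //; apply: measurable_funM => //; exact: measurable_ext_slope.
apply: measurable_funM.
  apply: measurable_sqrtr; apply: measurable_funM; first exact: measurable_funB.
  by apply: measurable_invr; exact: measurable_funB.
by apply: measurable_funD => //; apply: measurable_funM => //; exact: measurable_edge_slope.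
Qed.

Lemma edge_slope_homo t t' : (al != 0 -> 0 < t) -> t <= t' -> edge_slope t <= edge_slope t'.
Proof.
move=> t0 tt'; rewrite /edge_slope.
suff : al * (Num.sqrt sg / Num.sqrt b / t') <= al * (Num.sqrt sg / Num.sqrt b / t) by lra.
have [->|al1] := eqVneq al 0; first by rewrite !mul0r.
have t1 := t0 al1.
rewrite ler_wpM2l// ler_wpM2l ?divr_ge0 ?sqrtr_ge0//.
by rewrite lef_pV2// posrE// (lt_le_trans t1).
Qed.

Let f := f_hard al sg b.

Lemma mixed_densityD M y : mixed_density 1 M y = f y + mixed_density 0 M y.
Proof. by rewrite /mixed_density mul1r mul0r add0r. Qed.

Lemma f_hard_slope y : f y = pi^-1 * Num.sqrt ((b - y) / (y - sg)) * edge_slope y.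
Proof.
have pn : (pi : R) != 0 by rewrite gt_eqF// pi_gt0.
rewrite /f /f_hard /edge_slope; set v := Num.sqrt (_ / (_ - _)).
have [->|al1] := eqVneq al 0.
  by rewrite !(mulr0, mul0r); move: (@pi R) pn => p p0; field.
rewrite sqrtrM ?(ltW (sg0 al1))// sqrtrV ?(ltW (lt_trans (sg0 al1) sgb))//.
by move: (@pi R) pn (y^-1) (Num.sqrt b)^-1 => p p0 z w; field.
Qed.

Hypothesis mass :
  3 / 4 * (b - sg) ^+ 2 + sg * (b - sg) + 2 * al * Num.sqrt (sg / b) - 2 * al - 2 = 0.
Hypothesis slope0 : 0 <= edge_slope sg.

Lemma f_hard_ge0 y : sg <= y -> 0 <= f y.
Proof.
move=> sgy; rewrite f_hard_slope mulr_ge0// ?mulr_ge0 ?sqrtr_ge0 ?invr_ge0 ?pi_ge0//.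
by rewrite (le_trans slope0)// edge_slope_homo.
Qed.

Lemma measurable_f_hard : measurable_fun setT f.
Proof.
rewrite (_ : f = mixed_density 1 0); first exact: measurable_mixed_density.
by apply/funext => y; rewrite /mixed_density mul1r mul0r addr0.
Qed.

(** The mixtures for [k = 1] and [k = 0] have masses [1 + M * (b - sg)] and [M * (b - sg)], and [f]
    is the difference of their densities. *)
Lemma f_hard_mass : (\int[leb]_(y in `]sg, b[) (f y)%:E = 1)%E.
Proof.
have [M [M0 wM]] := edge_weight_bounded; have hp := halfpi_gt0 R.
have w0 k : 0 <= k <= 1 -> forall s, sg < s < b -> 0 <= edge_weight k M s.
  by move=> k01 s s1; have /andP[] := wM s s1 k k01.
have k1 : 0 <= (1 : R) <= 1 by rewrite ler01 lexx.
have k0 : 0 <= (0 : R) <= 1 by rewrite lexx ler01.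
have e k : 0 <= k <= 1 ->
    (\int[leb]_(y in `]sg, b[) (mixed_density k M y)%:E = (k + M * (b - sg))%:E)%E.
  move=> k01; have := mixed_density_integral (w0 k k01)
    (@measurable_cst _ _ mR mR setT (1 : R)) (fun=> ler01).
  under eq_integral => s _.
    under eq_integral => t _ do rewrite mulr1.
    rewrite integral_quarter_cst.
    over.
  under [in RHS]eq_integral do rewrite mul1r.
  have -> : (\int[leb]_(s in `]sg, b[) (edge_weight0 k M s * halfpi)%:E =
      halfpi%:E * \int[leb]_(s in `]sg, b[) (edge_weight k M s)%:E)%E.
    rewrite -ge0_integralZl//.
    - apply: eq_integral => s; rewrite inE/= in_itv/= => sI.
      by rewrite /edge_weight0 sI -EFinM mulrC.
    - by apply: measurable_funTS; apply/measurable_EFinP; exact: measurable_edge_weight.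
    - by move=> s /=; rewrite in_itv/= lee_fin; exact: w0.
    - by rewrite lee_fin ltW.
  by rewrite edge_weight_mass// => /halfpi_muleI <-.
have := e 1 k1; under eq_integral do rewrite mixed_densityD EFinD.
rewrite ge0_integralD//; last 4 first.
- by move=> y /=; rewrite in_itv/= => /andP[/ltW sgy _]; rewrite lee_fin f_hard_ge0.
- by apply: measurable_funTS; apply/measurable_EFinP; exact: measurable_f_hard.
- by move=> y /=; rewrite in_itv/= => yI; rewrite lee_fin mixed_density_ge0//; exact: w0.
- by apply: measurable_funTS; apply/measurable_EFinP; exact: measurable_mixed_density.
rewrite (e 0 k0) add0r EFinD => /(congr1 (fun e : \bar R => e - (M * (b - sg))%:E)%E).
by rewrite !addeK.
Qed.

Lemma hard_edge_measure : exists mu : probability R R,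
  has_density mu `]sg, b] f /\
  forall h : R -> R, measurable_fun setT h -> (forall x, 0 <= h x) ->
    (\int[mu]_y (h y)%:E = \int[leb]_(y in `]sg, b[) (h y * f y)%:E)%E.
Proof.
pose D y := f y * \1_(`]sg, b[%classic : set R) y.
have mD : measurable_fun setT D.
  by apply: measurable_funM; [exact: measurable_f_hard|exact: measurable_indic].
have D0 y : 0 <= D y.
  rewrite /D indicE mem_setE in_itv/=.
  have [/andP[/ltW sgy _]|_] := boolP (sg < y < b); last by rewrite mulr0.
  by rewrite mulr1 f_hard_ge0.
have DE (h : R -> R) : (\int[leb]_y (h y * D y)%:E = \int[leb]_(y in `]sg, b[) (h y * f y)%:E)%E.
  rewrite [in RHS]integral_mkcond; apply: eq_integral => y _; rewrite patchE /D indicE.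
  by case: ifP => yI; rewrite ?mulr1// !mulr0.
have D1 : (\int[leb]_y (D y)%:E = 1)%E.
  rewrite -f_hard_mass; have := DE (cst 1).
  under eq_integral do rewrite mul1r.
  by move=> ->; apply: eq_integral => y _; rewrite mul1r.
have [mu [muA muh]] := probability_of_density mD D0 D1.
exists mu; split => [A mA|h mh h0].
  rewrite muA// integral_mkcond [in RHS]integral_mkcond; apply: eq_integral => y _.
  rewrite !patchE in_setI; case: ifPn => //= yA.
  rewrite /D indicE !mem_setE !in_itv/= le_eqVlt.
  (* The right endpoint belongs to the stated support but not to the domain of [D]; there [f_hard]
     is 0. *)
  have [-> /=|_ /=] := eqVneq y b; last by case: ifP => _; rewrite ?mulr1 ?mulr0.
  rewrite ltxx sgb/= mulr0 f_hard_slope subrr mul0r sqrtr0 mulr0 mul0r//.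
rewrite (muh (EFin \o h)) ?DE//; last exact/measurable_EFinP.
Qed.

Section Potential.
Variables (mu : probability R R) (M : R).
Hypothesis muE : forall h : R -> R, measurable_fun setT h -> (forall x, 0 <= h x) ->
    (\int[mu]_y (h y)%:E = \int[leb]_(y in `]sg, b[) (h y * f y)%:E)%E.
Hypothesis wM : forall s, sg < s < b -> forall k, 0 <= k <= 1 -> 0 <= edge_weight k M s <= 2 * M.

Let w1 s : sg < s < b -> 0 <= edge_weight 1 M s.
Proof. by move=> sI; have /andP[] := wM sI (k := 1) (introT andP (conj ler01 (lexx _))). Qed.

Let w0 s : sg < s < b -> 0 <= edge_weight 0 M s.
Proof. by move=> sI; have /andP[] := wM sI (k := 0) (introT andP (conj (lexx _) ler01)). Qed.

Let split_density h : measurable_fun setT h -> (forall x, 0 <= h x) ->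
  (\int[leb]_(y in `]sg, b[) (h y * mixed_density 1 M y)%:E =
   \int[mu]_y (h y)%:E + \int[leb]_(y in `]sg, b[) (h y * mixed_density 0 M y)%:E)%E.
Proof.
move=> mh h0; rewrite muE//.
under eq_integral do rewrite mixed_densityD mulrDr EFinD.
rewrite ge0_integralD//.
- move=> y /=; rewrite in_itv/= => /andP[/ltW sgy _].
  by rewrite lee_fin mulr_ge0// f_hard_ge0.
- apply: measurable_funTS; apply/measurable_EFinP; apply: measurable_funM => //.
  exact: measurable_f_hard.
- by move=> y /=; rewrite in_itv/= => yI; rewrite lee_fin mulr_ge0// mixed_density_ge0.
- apply: measurable_funTS; apply/measurable_EFinP; apply: measurable_funM => //.
  exact: measurable_mixed_density.
Qed.

Lemma hard_edge_log_bound : exists a' b' : R, 0 <= b' /\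
  forall x, (\int[leb]_(y in `]sg, b[) (`|ln `|x - y| | * mixed_density 1 M y)%:E <=
    (a' + b' * `|x|)%:E)%E.
Proof.
apply: (@mixed_log_bound _ _ w1 (2 * M)) => s sI.
by have /andP[] := wM sI (k := 1) (introT andP (conj ler01 (lexx _))).
Qed.

Let mlnx x : measurable_fun setT (fun y : R => `|ln `|x - y| |).
Proof. by apply: measurable_normr; exact: measurable_ln_dist. Qed.

Lemma hard_edge_potential_bound a' b' x :
  (\int[leb]_(y in `]sg, b[) (`|ln `|x - y| | * mixed_density 1 M y)%:E <= (a' + b' * `|x|)%:E)%E ->
  (\int[mu]_y `|(ln `|x - y|)%:E| <= (a' + b' * `|x|)%:E)%E.
Proof.
under [X in (_ -> (X <= _)%E)]eq_integral do rewrite abse_EFin.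
rewrite (split_density (mlnx x))//; apply: le_trans; rewrite leeDl//.
apply: integral_ge0 => y /=; rewrite in_itv/= => yI.
by rewrite lee_fin mulr_ge0// mixed_density_ge0.
Qed.

(** Subtract [mixed_potential_diff] at [k = 0] from the same identity at [k = 1]: the mixed terms
    and the integral of the majorant cancel. The log bound makes the [k = 1] integral at [x] finite,
    and with it all the terms, so that the subtraction takes place in [R]. *)
Lemma hard_edge_potential_diff x (J1 J0 : R -> R) :
  (forall t, segment x t ->
    (\int[leb]_(s in `]sg, b[) (edge_weight0 1 M s * arcsine_field sg s t)%:E = (J1 t)%:E)%E) ->
  (forall t, segment x t ->
    (\int[leb]_(s in `]sg, b[) (edge_weight0 0 M s * arcsine_field sg s t)%:E = (J0 t)%:E)%E) ->
  exists j1 j0 : R, [/\ (\int[leb]_(t in segment x) (J1 t)%:E = j1%:E)%E,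
    (\int[leb]_(t in segment x) (J0 t)%:E = j0%:E)%E &
    log_potential mu x = log_potential mu sg + (j1 - j0)].
Proof.
move=> hJ1 hJ0; have [a' [b' [b'0 bnd]]] := hard_edge_log_bound.
have pb z := hard_edge_potential_bound (bnd z).
have il z : mu.-integrable setT (EFin \o (fun y => ln `|z - y|)).
  apply/integrableP; split; first by apply/measurable_EFinP; exact: measurable_ln_dist.
  exact: le_lt_trans (pb z) (ltry _).
have d1 := mixed_potential_diff w1 hJ1; have d0 := mixed_potential_diff w0 hJ0.
have J1_ge0 : (0 <= \int[leb]_(t in segment x) (J1 t)%:E)%E.
  apply: integral_ge0 => t tx; rewrite -hJ1//; apply: integral_ge0 => s _.
  by rewrite lee_fin mulr_ge0 ?arcsine_field_ge0 ?edge_weight0_ge0.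
have J0_ge0 : (0 <= \int[leb]_(t in segment x) (J0 t)%:E)%E.
  apply: integral_ge0 => t tx; rewrite -hJ0//; apply: integral_ge0 => s _.
  by rewrite lee_fin mulr_ge0 ?arcsine_field_ge0 ?edge_weight0_ge0.
have shift_ge0 k z : (forall s, sg < s < b -> 0 <= edge_weight k M s) -> z = x \/ z = sg ->
    (0 <= \int[leb]_(y in `]sg, b[) (log_shift z x y * mixed_density k M y)%:E)%E.
  move=> wk zx; apply: integral_ge0 => y /=; rewrite in_itv/= => yI.
  by rewrite lee_fin mulr_ge0 ?mixed_density_ge0// log_shift_ge0.
have addfin (u v : R -> R) : measurable_fun (setT : set mR) u -> measurable_fun (setT : set mR) v ->
    (forall y, 0 <= u y) -> (forall y, 0 <= v y) ->
    (\int[leb]_(y in `]sg, b[) (u y * mixed_density 1 M y)%:E < +oo)%E ->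
    (\int[leb]_(y in `]sg, b[) (v y * mixed_density 1 M y)%:E < +oo)%E ->
    (\int[leb]_(y in `]sg, b[) ((u y + v y) * mixed_density 1 M y)%:E < +oo)%E.
  move=> mu' mv u0 v0 fu fv; under eq_integral do rewrite mulrDl EFinD.
  have mm := @measurable_mixed_density 1 M.
  rewrite ge0_integralD//; first exact: lte_add_pinfty.
  - by move=> y; rewrite /= in_itv/= => yI; rewrite lee_fin mulr_ge0// mixed_density_ge0.
  - by apply: measurable_funTS; apply/measurable_EFinP; exact: measurable_funM.
  - by move=> y; rewrite /= in_itv/= => yI; rewrite lee_fin mulr_ge0// mixed_density_ge0.
  - by apply: measurable_funTS; apply/measurable_EFinP; exact: measurable_funM.
have fz z : (\int[leb]_(y in `]sg, b[) (`|ln `|z - y| | * mixed_density 1 M y)%:E < +oo)%E.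
  exact: le_lt_trans (bnd z) (ltry _).
have fin1 : (\int[leb]_(y in `]sg, b[) (log_shift x x y * mixed_density 1 M y)%:E < +oo)%E.
  apply: (@le_lt_trans _ _ (\int[leb]_(y in `]sg, b[)
     ((`|ln `|x - y| | + (`|ln `|x - y| | + `|ln `|sg - y| |)) * mixed_density 1 M y)%:E)%E).
    apply: ge0_le_integral => //.
    - move=> y /=; rewrite in_itv/= => yI.
      by rewrite lee_fin mulr_ge0 ?mixed_density_ge0// log_shift_ge0//; left.
    - apply: measurable_funTS; apply/measurable_EFinP; apply: measurable_funM.
        exact: measurable_log_shift.
      exact: measurable_mixed_density.
    - apply: measurable_funTS; apply/measurable_EFinP; apply: measurable_funM.
        by apply: measurable_funD; [exact: mlnx|apply: measurable_funD; exact: mlnx].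
      exact: measurable_mixed_density.
    - move=> y /=; rewrite in_itv/= => yI; rewrite lee_fin.
      by rewrite ler_wpM2r ?mixed_density_ge0// /log_shift lerD2r ler_norm.
  refine (addfin _ _ _ _ _ _ _ _); [exact: mlnx| |by []|by move=> y; rewrite addr_ge0|exact: fz|].
    by apply: measurable_funD; exact: mlnx.
  by refine (addfin _ _ _ _ _ _ _ _); [exact: mlnx|exact: mlnx|by []|by []|exact: fz|exact: fz].
have [lx0 ls0] : (forall y, 0 <= log_shift x x y) /\ (forall y, 0 <= log_shift sg x y).
  by split => y; apply: log_shift_ge0; [left|right].
have s1 := split_density (measurable_log_shift x x) lx0.
have s2 := split_density (measurable_log_shift sg x) ls0.
have iA : mu.-integrable setT (EFin \o (fun y => `|ln `|x - y| | + `|ln `|sg - y| |)).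
  apply: (@integrableD _ _ _ mu _ _ (EFin \o (fun y => `|ln `|x - y| |))
    (EFin \o (fun y => `|ln `|sg - y| |))) => //; exact: integrable_norm.
have muA (z : R) : (\int[mu]_y (log_shift z x y)%:E = (log_potential mu z)%:E +
    \int[mu]_y (`|ln `|x - y| | + `|ln `|sg - y| |)%:E)%E.
  rewrite /log_potential fineK; first by rewrite -(integralD_EFin _ (il z) iA).
  exact: integrable_fin_num (il z).
have Afin : (\int[mu]_y (`|ln `|x - y| | + `|ln `|sg - y| |)%:E \is a fin_num)%E.
  exact: integrable_fin_num iA.
rewrite s1 s2 !muA d0 in d1.
have c2 := shift_ge0 0 sg w0 (or_intror erefl).
rewrite s1 muA d0 in fin1.
move: Afin c2 J0_ge0 J1_ge0 fin1 d1.
set A := (\int[mu]_y _)%E; set c := (\int[leb]_(y in `]sg, b[) _)%E.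
set i0 := (\int[leb]_(t in segment x) (J0 t)%:E)%E; set i1 := (\int[leb]_(t in segment x) (J1 t)%:E)%E.
clearbody A c i0 i1.
case: A => [A| |] // _; case: c => [c| |]; case: i0 => [i0| |]; case: i1 => [i1| |] //= _ _ _ _.
by move=> [e]; exists i1, i0; split => //; lra.
Qed.

End Potential.

Lemma right_fieldD M t : right_field 1 M t =
  right_field 0 M t + ext_slope t - Num.sqrt ((t - b) / (t - sg)) * edge_slope t.
Proof. by rewrite /right_field; ring. Qed.

Lemma left_fieldD M t : left_field 1 M t =
  left_field 0 M t + - ext_slope t + Num.sqrt ((b - t) / (sg - t)) * edge_slope t.
Proof. by rewrite /left_field; ring. Qed.

Lemma measurable_Qalpha : measurable_fun setT (Qalpha al : R -> \bar R).
Proof.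
rewrite /Qalpha; apply: measurable_fun_ifT => //.
- apply: measurable_or => //; exact: measurable_fun_ltr.
- apply/measurable_EFinP; apply: measurable_funB; first exact: measurable_funX.
  by apply: measurable_funM => //; exact: measurable_lnr.
Qed.

(** From [ln x <= x] and completing the square, [(x - 2 * al) ^+ 2 >= 0]. *)
Lemma Qalpha_ge x : ((x ^+ 2 / 2 - 2 * al ^+ 2)%:E <= Qalpha al x)%E.
Proof.
rewrite /Qalpha; case: ifPn => [h|_]; last by rewrite leey.
rewrite lee_fin; have x2 := sqr_ge0 x; have a2 := sqr_ge0 al.
have [->|al1] := eqVneq al 0; first by rewrite mulr0 mul0r; lra.
move: h; rewrite (negbTE al1)/= => x0; have := ln_le_self x0.
move=> /(ler_wpM2l al0) h; have := sqr_ge0 (x - 2 * al).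
by rewrite (_ : (x - 2 * al) ^+ 2 = x ^+ 2 - 4 * (al * x) + 4 * al ^+ 2); [lra|ring].
Qed.

Lemma QalphaE x : (al != 0 -> 0 < x) -> Qalpha al x = (2 * ext_primitive x)%:E.
Proof.
move=> x0; rewrite /Qalpha; have -> : (al == 0) || (0 < x).
  by have [//|al1] := eqVneq al 0; rewrite x0.
by congr EFin; rewrite /ext_primitive; field.
Qed.

(** The edge [s'] of the domain is separate from the edge [sg] of the support, so that one statement
    covers both regimes: [s' = sg] is the hard edge, and for [s' < sg] the two sign conditions on
    [edge_slope sg] force it to vanish. *)
Theorem hard_edge_equilibrium (s' : R) : s' <= sg -> (al != 0 -> 0 <= s') ->
  (s' < sg -> edge_slope sg <= 0) ->
  exists mu : probability R R, has_density mu `]sg, b] (f_hard al sg b) /\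
    is_equilibrium_measure (Sigma s') (Qalpha al) mu /\
    forall nu, is_equilibrium_measure (Sigma s') (Qalpha al) nu ->
      forall A : set R, measurable A -> nu A = mu A.
Proof.
move=> s'sg s'0 soft.
have [mu [mud muE]] := hard_edge_measure.
have [M [M0 wM]] := edge_weight_bounded.
exists mu; split => //.
have [a' [b' [b'0 bnd]]] := hard_edge_log_bound wM.
have pb x := hard_edge_potential_bound muE wM (bnd x).
have w1 s : sg < s < b -> 0 <= edge_weight 1 M s.
  by move=> sI; have /andP[] := wM s sI 1 (introT andP (conj ler01 (lexx _))).
have w0 s : sg < s < b -> 0 <= edge_weight 0 M s.
  by move=> sI; have /andP[] := wM s sI 0 (introT andP (conj (lexx _) ler01)).
have outside (A : set R) : measurable A -> (forall x, sg < x < b -> ~ A x) -> mu A = 0%E.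
  move=> mA Aout; rewrite mud//; apply: null_set_integral => //.
  - exact: measurableI.
  - by apply: measurable_funTS; apply/measurable_EFinP; exact: measurable_f_hard.
  apply: (@subset_measure0 _ _ _ leb _ [set b]) => //.
  - exact: measurableI.
  - move=> x [Ax] /=; rewrite in_itv/= => /andP[x1]; rewrite le_eqVlt => /predU1P[//|x2].
    by case: (Aout x); rewrite ?x1.
  - exact: lebesgue_measure_set1.
have ae_inside (P : R -> Prop) : (forall x, sg < x < b -> P x) -> {ae mu, forall x, P x}.
  move=> Pin; exists (~` `]sg, b[%classic); split.
  - by apply: measurableC; exact: measurable_itv.
  - apply: outside; first by apply: measurableC; exact: measurable_itv.
    by move=> x xI /=; rewrite in_itv/=.
  - by move=> x /= nPx; rewrite in_itv/= => xI; apply: nPx; exact: Pin.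
(* On the support the field of the mixture equals the external slope. Beyond [b] it is smaller,
   since [edge_slope] is increasing and already nonnegative at [sg]. *)
have u_right x : sg <= x ->
    log_potential mu x <= log_potential mu sg + (ext_primitive x - ext_primitive sg) /\
    (x <= b -> log_potential mu x = log_potential mu sg + (ext_primitive x - ext_primitive sg)).
  move=> sgx; have segE : segment x = `]sg, x[%classic by rewrite /segment sgx.
  have pos t : sg <= t -> al != 0 -> 0 < t by move=> h /sg0 g0; exact: lt_le_trans h.
  have [t st|t st|j1 [j0 [h1 h0 uE]]] :=
    @hard_edge_potential_diff mu M muE wM x (right_field 1 M) (right_field 0 M).
  - by apply: edge_right_field => //; move: st; rewrite segE /= in_itv/= => /andP[].
  - by apply: edge_right_field => //; move: st; rewrite segE /= in_itv/= => /andP[].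
  rewrite segE in h1 h0.
  have J0ge t : sg < t -> 0 <= right_field 0 M t.
    move=> sgt; rewrite -lee_fin -edge_right_field//; apply: integral_ge0 => s _.
    by rewrite lee_fin mulr_ge0 ?arcsine_field_ge0 ?edge_weight0_ge0.
  have J1ge t : sg < t -> 0 <= right_field 1 M t.
    move=> sgt; rewrite -lee_fin -edge_right_field//; apply: integral_ge0 => s _.
    by rewrite lee_fin mulr_ge0 ?arcsine_field_ge0 ?edge_weight0_ge0.
  have main : (\int[leb]_(t in `]sg, x[) (right_field 0 M t + ext_slope t)%:E =
      (j0 + (ext_primitive x - ext_primitive sg))%:E)%E.
    have dP t : sg <= t <= x -> is_derive t 1 ext_primitive (ext_slope t).
      by move=> /andP[h _]; apply: ext_primitive_derive; exact: pos.
    have cp t : sg <= t <= x -> {for t, continuous ext_slope}.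
      by move=> /andP[h _]; apply: ext_slope_continuous; exact: pos.
    have jge t : sg < t < x -> 0 <= right_field 0 M t by move=> /andP[+ _]; exact: J0ge.
    have jfin : (\int[leb]_(t in `]sg, x[) (right_field 0 M t)%:E < +oo)%E by rewrite h0 ltry.
    rewrite EFinD -h0.
    exact: (integral_ge0D_cont sgx (measurable_right_field 0 M) jge jfin dP cp measurable_ext_slope).
  have slope_ge t : sg <= t -> 0 <= edge_slope t.
    by move=> h; rewrite (le_trans slope0)// edge_slope_homo//; apply: pos.
  split.
    suff : j1 <= j0 + (ext_primitive x - ext_primitive sg) by rewrite uE; lra.
    rewrite -lee_fin -main -h1; apply: ge0_le_integral => //.
    - by move=> t /=; rewrite in_itv/= lee_fin => /andP[/J1ge].
    - by apply: measurable_funTS; apply/measurable_EFinP; exact: measurable_right_field.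
    - apply: measurable_funTS; apply/measurable_EFinP.
      by apply: measurable_funD; [exact: measurable_right_field|exact: measurable_ext_slope].
    - move=> t /=; rewrite in_itv/= lee_fin => /andP[h _].
      by rewrite right_fieldD gerBl mulr_ge0 ?sqrtr_ge0// slope_ge// ltW.
  move=> xb; suff : j1 = j0 + (ext_primitive x - ext_primitive sg) by rewrite uE; lra.
  apply: EFin_inj; rewrite -main -h1; apply: eq_integral => t.
  rewrite inE/= in_itv/= => /andP[t1 t2]; rewrite right_fieldD.
  rewrite (_ : Num.sqrt _ = 0) ?mul0r ?subr0// ler0_sqrtr// mulr_le0_ge0//.
    by rewrite subr_le0 (le_trans (ltW t2)).
  by rewrite invr_ge0 subr_ge0 ltW.
(* To the left of [sg] monotonicity makes [edge_slope] nonpositive, so its term lowers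
   [left_field 1 M] and the potential grows no faster than half the external field. *)
have u_left x : s' <= x -> x < sg -> (al != 0 -> 0 < x) ->
    log_potential mu x <= log_potential mu sg + (ext_primitive x - ext_primitive sg).
  move=> s'x xsg x0; have segE : segment x = `]x, sg[%classic by rewrite /segment leNgt xsg.
  have slope_le0 := soft (le_lt_trans s'x xsg).
  have pos t : x <= t -> al != 0 -> 0 < t by move=> h /x0 g0; exact: lt_le_trans h.
  have [t st|t st|j1 [j0 [h1 h0 uE]]] :=
    @hard_edge_potential_diff mu M muE wM x (left_field 1 M) (left_field 0 M).
  - move: st; rewrite segE /= in_itv/= => /andP[/ltW xt tsg].
    by apply: edge_left_field => //; exact: pos.
  - move: st; rewrite segE /= in_itv/= => /andP[/ltW xt tsg].
    by apply: edge_left_field => //; exact: pos.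
  rewrite segE in h1 h0.
  have Jge k t : (forall s, sg < s < b -> 0 <= edge_weight k M s) -> x < t < sg ->
      0 <= left_field k M t.
    move=> wk /andP[/ltW xt tsg]; rewrite -lee_fin -edge_left_field//; last exact: pos.
    by apply: integral_ge0 => s _; rewrite lee_fin mulr_ge0 ?arcsine_field_ge0 ?edge_weight0_ge0.
  have main : (\int[leb]_(t in `]x, sg[) (left_field 0 M t + - ext_slope t)%:E =
      (j0 + (- ext_primitive sg - - ext_primitive x))%:E)%E.
    have dP t : x <= t <= sg -> is_derive t 1 (fun t => - ext_primitive t) (- ext_slope t).
      by move=> /andP[h _]; apply: is_derive_oppf; apply: ext_primitive_derive; exact: pos.
    have cp t : x <= t <= sg -> {for t, continuous (fun t => - ext_slope t)}.
      by move=> /andP[h _]; apply: cvgN; apply: ext_slope_continuous; exact: pos.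
    have jfin : (\int[leb]_(t in `]x, sg[) (left_field 0 M t)%:E < +oo)%E by rewrite h0 ltry.
    rewrite EFinD -h0.
    exact: (integral_ge0D_cont (ltW xsg) (measurable_left_field 0 M) (fun t => @Jge 0 t w0)
      jfin dP cp (measurable_funN measurable_ext_slope)).
  suff : j1 <= j0 + (- ext_primitive sg - - ext_primitive x) by rewrite uE; lra.
  rewrite -lee_fin -main -h1; apply: ge0_le_integral => //.
  - by move=> t /=; rewrite in_itv/= lee_fin; exact: Jge.
  - by apply: measurable_funTS; apply/measurable_EFinP; exact: measurable_left_field.
  - apply: measurable_funTS; apply/measurable_EFinP.
    apply: measurable_funD; first exact: measurable_left_field.
    by apply: measurable_funN; exact: measurable_ext_slope.
  - move=> t /=; rewrite in_itv/= lee_fin => /andP[/ltW xt tsg].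
    rewrite left_fieldD gerDl mulr_ge0_le0 ?sqrtr_ge0//.
    by rewrite (le_trans _ slope_le0)// edge_slope_homo ?(ltW tsg)//; exact: pos.
have mSig : measurable (Sigma s').
  rewrite /Sigma (_ : [set x | _] = `[s', +oo[%classic); first exact: measurable_itv.
  by apply/seteqP; split => x /=; rewrite in_itv/= andbT.
(* The Euler-Lagrange constant, read off at the base point [sg]. *)
pose C := 2 * ext_primitive sg - 2 * log_potential mu sg.
apply: (@equilibrium_measure_unique R (Sigma s') (Qalpha al) (2 * al ^+ 2) a' b' (`|sg| + `|b|) C mu).
- exact: mSig.
- exact: measurable_Qalpha.
- exact: Qalpha_ge.
- rewrite /supported_on; apply: outside.
    exact: measurableC.
  by move=> x /andP[x1 _] /=; apply; rewrite /Sigma/= (le_trans s'sg)// ltW.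
- move=> x; rewrite mud//; apply: null_set_integral.
  + by apply: measurableI => //; exact: measurable_set1.
  + by apply: measurable_funTS; apply/measurable_EFinP; exact: measurable_f_hard.
  + apply: (@subset_measure0 _ _ _ leb _ [set x]) => //.
    * by apply: measurableI => //; exact: measurable_set1.
    * exact: lebesgue_measure_set1.
- apply: ae_inside => x /andP[x1 x2].
  have := ler_norm b; have := ler_norm (- sg); rewrite normrN => g1 g2.
  have := normr_ge0 b; have := normr_ge0 sg => g3 g4.
  by rewrite ler_norml; apply/andP; split; lra.
- exact: pb.
- move=> x; rewrite /Sigma/= => s'x.
  have [x0|] := boolP ((al == 0) || (0 < x)); last first.
    by move=> h; rewrite /Qalpha (negbTE h) leey.
  have x0' : al != 0 -> 0 < x by move=> al1; move: x0; rewrite (negbTE al1).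
  rewrite QalphaE// -EFinB lee_fin /C.
  have [sgx|xsg] := leP sg x; first by have [+ _] := u_right x sgx; lra.
  by have := u_left x s'x xsg x0'; lra.
- apply: ae_inside => x /andP[x1 x2].
  have x0' : al != 0 -> 0 < x by move=> /sg0 g0; exact: lt_trans x1.
  have [_ h] := u_right x (ltW x1); have {}h := h (ltW x2).
  by rewrite QalphaE// -EFinB /C h; congr EFin; ring.
Qed.

End HardEdgeWeight.

(** * Edges of the support *)

Section Densities.
Variable R : realType.
Local Notation leb := (@lebesgue_measure R).
Implicit Types (mu nu : probability R R) (S : set R) (f : R -> R) (al a b sg x : R).

Lemma has_density_eq mu S S' f f' :
  (forall x, S x -> S' x /\ f x = f' x) ->
  (forall x, S' x -> ~ S x -> f' x = 0) ->
  has_density mu S f -> has_density mu S' f'.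
Proof.
move=> SS' S'S muf A mA; rewrite muf// integral_mkcond [RHS]integral_mkcond.
apply: eq_integral => x _; rewrite !patchE !in_setI; case: (x \in A) => //=.
have [|nS] := boolP (x \in S).
  by rewrite inE => /SS'[S'x ->]; rewrite mem_set.
case: ifPn => //; rewrite inE => /S'S ->//.
by move/negP: nS; rewrite inE.
Qed.

Lemma density_integral_gt0 f u v : u < v -> measurable_fun setT f ->
  (forall x, u < x < v -> 0 < f x) ->
  (\int[leb]_(x in `]u, v[) (f x)%:E != 0)%E.
Proof.
move=> uv mf f0; apply/eqP => int0.
have mfE : measurable_fun `]u, v[ (EFin \o f).
  by apply: measurable_funTS; exact/measurable_EFinP.
have : (\int[leb]_(x in `]u, v[) `|(EFin \o f) x| = 0)%E.
  rewrite -int0; apply: eq_integral => x; rewrite inE/= in_itv/= => xI.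
  by rewrite /= gtr0_norm// f0.
move/(ae_eq_integral_abs leb (measurable_itv _) mfE) => [N [mN N0 NE]].
have uvN : `]u, v[%classic `<=` N.
  move=> x xI; apply: NE => /= h; have := h xI; move: xI; rewrite /= in_itv/= => xI [fx].
  by have := f0 x xI; rewrite fx ltxx.
have : (leb `]u, v[ <= leb N)%E by apply: le_measure => //; rewrite inE.
rewrite lebesgue_measure_itv/= lte_fin uv; case: N0 => -> /=.
by rewrite -EFinB lee_fin leNgt subr_gt0 uv.
Qed.

(** A piece of []a, b[] outside [[a', b']] would have positive mass under the first density and none
    under the second. *)
Lemma density_support_le mu f f' a b a' b' : a < b ->
  measurable_fun setT f -> (forall x, a < x < b -> 0 < f x) ->
  has_density mu `[a, b] f -> has_density mu `[a', b'] f' -> a' <= a /\ b <= b'.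
Proof.
move=> ab mf f0 d d'.
have key u v : u < v -> a <= u -> v <= b -> (v <= a' \/ b' <= u) -> False.
  move=> uv au vb out.
  have muI : mu `]u, v[%classic = (\int[leb]_(x in `]u, v[) (f x)%:E)%E.
    rewrite d//; congr (integral _ _ _); apply/seteqP; split => x /=; first by case.
    move=> xI; split => //; move: xI; rewrite !in_itv/= => /andP[x1 x2].
    by rewrite (le_trans au (ltW x1)) (le_trans (ltW x2) vb).
  have mu0 : mu `]u, v[%classic = 0%E.
    rewrite d'// (_ : _ `&` _ = set0) ?integral_set0//; apply/seteqP; split => x //= -[].
    rewrite !in_itv/= => /andP[x1 x2] /andP[x3 x4]; case: out => h.
      by have := lt_le_trans x2 (le_trans h x3); rewrite ltxx.
    by have := lt_le_trans (lt_le_trans x1 x4) h; rewrite ltxx.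
  have f0' x : u < x < v -> 0 < f x.
    by move=> /andP[x1 x2]; apply: f0; rewrite (le_lt_trans au)//= (lt_le_trans x2).
  by have := density_integral_gt0 uv mf f0'; rewrite -muI mu0 eqxx.
split; rewrite leNgt; apply/negP => h.
  apply: (key a (Num.min a' b)) => //; first by rewrite lt_min h.
    by rewrite ge_min lexx orbT.
  by left; rewrite ge_min lexx.
apply: (key (Num.max a b') b) => //; first by rewrite gt_max ab.
  by rewrite le_max lexx.
by right; rewrite le_max lexx orbT.
Qed.

Lemma measurable_f_soft al a b : measurable_fun setT (f_soft al a b).
Proof.
apply: measurable_funM.
  apply: measurable_funM => //; apply: measurable_sqrtr; apply: measurable_funM.
    exact: measurable_funB.
  exact: measurable_funB.
by apply: measurable_funD => //; apply: measurable_funM => //; exact: measurable_invr.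
Qed.

Lemma f_soft_gt0 al a b x : 0 <= al -> 0 < a -> a < x < b -> 0 < f_soft al a b x.
Proof.
move=> al0 a0 /andP[ax xb]; have x0 := lt_trans a0 ax.
rewrite /f_soft mulr_gt0//.
  by rewrite mulr_gt0 ?invr_gt0 ?pi_gt0// sqrtr_gt0 mulr_gt0// subr_gt0.
by rewrite ltr_pwDl// mulr_ge0 ?divr_ge0 ?sqrtr_ge0 ?invr_ge0// ltW.
Qed.

Lemma edge_slopeE al sg b : 0 < sg -> 0 < b ->
  2 * edge_slope al sg b sg = sg + b - 2 * al / Num.sqrt (sg * b).
Proof.
move=> sg0 b0; rewrite /edge_slope sqrtrM ?(ltW sg0)//.
have s0 : Num.sqrt sg != 0 by rewrite gt_eqF// sqrtr_gt0.
have c0 : Num.sqrt b != 0 by rewrite gt_eqF// sqrtr_gt0.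
have key (u v s : R) : u != 0 -> v != 0 -> u ^+ 2 = s -> u / v / s = (u * v)^-1.
  by move=> u0 v0 <-; field; rewrite u0 v0.
by rewrite (key _ _ _ s0 c0 (sqr_sqrtr (ltW sg0))); field; rewrite s0 c0.
Qed.

Lemma hard_edge_has_density al sg b s' : 0 <= al -> (al != 0 -> 0 < sg) -> sg < b ->
  3 / 4 * (b - sg) ^+ 2 + sg * (b - sg) + 2 * al * Num.sqrt (sg / b) - 2 * al - 2 = 0 ->
  0 <= edge_slope al sg b sg -> s' <= sg -> (al != 0 -> 0 <= s') ->
  (s' < sg -> edge_slope al sg b sg <= 0) ->
  equilibrium_has_density (Sigma s') (Qalpha al) `]sg, b] (f_hard al sg b).
Proof.
move=> al0 sg0 sgb mass slope s'sg s'0 soft.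
have [mu [mud [mue muu]]] := hard_edge_equilibrium al0 sg0 sgb mass slope s'sg s'0 soft.
split; first by exists mu.
by move=> nu /muu h A mA; rewrite h// mud.
Qed.

Lemma equilibrium_has_density_eq (Sig : set R) (Q : R -> \bar R) S S' f f' :
  (forall x, S x -> S' x /\ f x = f' x) ->
  (forall x, S' x -> ~ S x -> f' x = 0) ->
  equilibrium_has_density Sig Q S f -> equilibrium_has_density Sig Q S' f'.
Proof. by move=> h1 h2 [ex d]; split => // mu /d; exact: has_density_eq. Qed.

(** The mass and edge conditions for the support [[a, b]]; in terms of
    [S = (a + b) ^+ 2] and [p = a * b] they read [S * p = 4 * al ^+ 2] and
    [3 * S - 4 * p = 8 * (1 + al)]. *)
Definition soft_pair al a b := [/\ 0 < a, a < b, (a + b) * Num.sqrt (a * b) = 2 * al &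
  3 * a ^+ 2 + 3 * b ^+ 2 + 2 * a * b = 8 * (1 + al)].

Lemma soft_pair_exists al : 0 < al -> exists a b : R,
  [/\ soft_pair al a b, a < Num.sqrt al & Num.sqrt al < b].
Proof.
(* Eliminating [p] from the two conditions leaves [3 * S ^+ 2 - 8 * (1 + al) * S - 16 * al ^+ 2 =
   0], whose positive root is the [S] below; [r] comes from its discriminant. *)
move=> al0; pose r := Num.sqrt ((1 + al) ^+ 2 + 3 * al ^+ 2).
have r2 : r ^+ 2 = (1 + al) ^+ 2 + 3 * al ^+ 2 
  by rewrite sqr_sqrtr// addr_ge0 ?sqr_ge0// mulr_ge0 ?sqr_ge0.
have r0 : 0 <= r by exact: sqrtr_ge0.
have rl : 2 * al < r.
  rewrite -(ltr_pXn2r (n := 2)) ?nnegrE//; last by rewrite mulr_ge0// ltW.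
  by rewrite r2; nra.
pose S := 4 / 3 * ((1 + al) + r).
(* This bound makes [p < al], so [S - 4 * p] is positive and is the square of [b - a]. It also
   places [sqrt al] between the roots: [a ^+ 2 < a * b < al] and [b ^+ 2 > S / 2 - p > al]. *)
have S4 : 4 * al < S by rewrite /S; lra.
have S0 : 0 < S by rewrite (lt_trans _ S4)// mulr_gt0.
have SE : 3 * S ^+ 2 = 8 * (1 + al) * S + 16 * al ^+ 2.
  have -> : 3 * S ^+ 2 = 16 / 3 * ((1 + al) ^+ 2 + 2 * (1 + al) * r + r ^+ 2) by rewrite /S; field.
  by rewrite r2 /S; field.
pose p := 4 * al ^+ 2 / S.
have p0 : 0 < p by rewrite divr_gt0// mulr_gt0// exprn_gt0.
have pal : p < al.
  rewrite /p ltr_pdivrMr// expr2 mulrA mulrC.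
  by rewrite ltr_pM2l.
have Sp : S * p = 4 * al ^+ 2 by rewrite /p mulrC divfK// gt_eqF.
pose w := Num.sqrt S; have w0 : 0 < w by rewrite sqrtr_gt0.
have w2 : w ^+ 2 = S by rewrite sqr_sqrtr// ltW.
have D0 : 0 < S - 4 * p by lra.
pose d := Num.sqrt (S - 4 * p); have d0 : 0 < d by rewrite sqrtr_gt0.
have d2 : d ^+ 2 = S - 4 * p by rewrite sqr_sqrtr// ltW.
have dw : d < w by rewrite /d /w ltr_sqrt//; lra.
pose a := (w - d) / 2; pose b := (w + d) / 2.
have a0 : 0 < a by rewrite divr_gt0// subr_gt0.
have ab : a < b by rewrite /a /b; lra.
have b0 := lt_trans a0 ab.
have abE : a * b = p.
  have -> : a * b = (w ^+ 2 - d ^+ 2) / 4 by rewrite /a /b; field.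
  by rewrite w2 d2; field.
have sE : a + b = w by rewrite /a /b; field.
have sal : Num.sqrt al ^+ 2 = al by rewrite sqr_sqrtr// ltW.
exists a, b; split.
- split => //.
    rewrite sE abE /w -sqrtrM ?(ltW S0)// Sp.
    have -> : 4 * al ^+ 2 = (2 * al) ^+ 2 by ring.
    by rewrite sqrtr_sqr ger0_norm// mulr_ge0// ltW.
  have -> : 3 * a ^+ 2 + 3 * b ^+ 2 + 2 * a * b = 3 * (a + b) ^+ 2 - 4 * (a * b) by ring.
  rewrite sE abE w2; apply: (mulfI (lt0r_neq0 S0)).
  have -> : S * (3 * S - 4 * p) = 3 * S ^+ 2 - 4 * (S * p) by ring.
  by rewrite SE Sp; ring.
- rewrite -(ltr_pXn2r (n := 2)) ?nnegrE ?sqrtr_ge0 ?(ltW a0)// sal (lt_trans _ pal)//.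
  by rewrite -abE expr2 ltr_pM2l.
- rewrite -(ltr_pXn2r (n := 2)) ?nnegrE ?sqrtr_ge0 ?(ltW b0)// sal.
  have : b ^+ 2 = (w ^+ 2 + 2 * w * d + d ^+ 2) / 4 by rewrite /b; field.
  move=> ->; rewrite w2 d2; have := mulr_gt0 w0 d0; lra.
Qed.

Lemma soft_pair_sqrt al a b : soft_pair al a b ->
  2 * al * Num.sqrt (a / b) = a * (a + b).
Proof.
move=> [a0 ab e _]; have b0 := lt_trans a0 ab; rewrite -e.
rewrite sqrtrM ?(ltW a0)// sqrtrM ?(ltW a0)// sqrtrV ?(ltW b0)//.
have b1 : Num.sqrt b != 0 by rewrite gt_eqF// sqrtr_gt0.
transitivity ((a + b) * Num.sqrt a ^+ 2).
  by move: (Num.sqrt a) (Num.sqrt b) b1 => u v v0; field.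
by rewrite sqr_sqrtr ?(ltW a0)//; ring.
Qed.

Lemma soft_pair_mass al a b : soft_pair al a b ->
  3 / 4 * (b - a) ^+ 2 + a * (b - a) + 2 * al * Num.sqrt (a / b) - 2 * al - 2 = 0.
Proof. by move=> h; rewrite (soft_pair_sqrt h); case: h => _ _ _ e; nra. Qed.

Lemma soft_pair_slope al a b : soft_pair al a b -> edge_slope al a b a = 0.
Proof.
move=> [a0 ab e _]; have b0 := lt_trans a0 ab.
suff : 2 * edge_slope al a b a = 0 by lra.
rewrite edge_slopeE// -e mulfK ?subrr//.
by rewrite gt_eqF// sqrtr_gt0 mulr_gt0.
Qed.

Lemma soft_pair_formula al a b : soft_pair al a b ->
  b = 2 / 3 * (Num.sqrt (6 * (al + 1) - 2 * a ^+ 2) - a / 2).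
Proof.
move=> [a0 ab _ e].
have -> : 6 * (al + 1) - 2 * a ^+ 2 = ((a + 3 * b) / 2) ^+ 2.
  have -> : 6 * (al + 1) = 3 / 4 * (8 * (1 + al)) by field.
  by rewrite -e; field.
rewrite sqrtr_sqr ger0_norm; first by field.
by rewrite divr_ge0// addr_ge0 ?mulr_ge0 ?(ltW a0)// ltW// (lt_trans a0).
Qed.

(** For a soft pair the slope factor vanishes at [a]: [2 * x + b - a - a * (a + b) / x = (x - a) *
    (2 + (a + b) / x)]. The factor [x - a] turns the inverse square-root singularity into a
    square-root zero. *)
Lemma f_hard_soft al a b x : soft_pair al a b -> a < x -> f_hard al a b x = f_soft al a b x.
Proof.
move=> h ax; rewrite /f_hard (soft_pair_sqrt h) /f_soft; case: h => a0 ab e _.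
have x0 := lt_trans a0 ax; have xa : 0 < x - a by rewrite subr_gt0.
have b0 := lt_trans a0 ab.
have s0 : Num.sqrt (a * b) != 0 by rewrite gt_eqF// sqrtr_gt0 mulr_gt0.
have -> : al / Num.sqrt (a * b) = (a + b) / 2.
  have -> : al = (a + b) * Num.sqrt (a * b) / 2 by rewrite e; field.
  by field.
have -> : Num.sqrt ((b - x) * (x - a)) = Num.sqrt ((b - x) / (x - a)) * (x - a).
  rewrite [RHS]mulrC -[X in _ = X * _](ger0_norm (ltW xa)) -sqrtr_sqr -sqrtrM ?sqr_ge0//.
  by congr Num.sqrt; field; rewrite gt_eqF.
have pn : (pi : R) != 0 by rewrite gt_eqF// pi_gt0.
move: (Num.sqrt ((b - x) / (x - a))) (@pi R) pn => v p p0; field.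
by rewrite p0 gt_eqF.
Qed.

(** The same density for every domain edge between [0] and [a]: the wall is not felt until it
    reaches the support. *)
Lemma soft_equilibrium al a b s' : 0 < al -> soft_pair al a b -> 0 <= s' -> s' <= a ->
  equilibrium_has_density (Sigma s') (Qalpha al) `[a, b] (f_soft al a b).
Proof.
move=> al0 h s'0 s'a; have slope := soft_pair_slope h; have [a0 ab _ _] := h.
have := @hard_edge_has_density al a b s' (ltW al0) (fun=> a0) ab (soft_pair_mass h).
rewrite slope => /(_ (lexx _) s'a (fun=> s'0) (fun=> lexx _)).
apply: equilibrium_has_density_eq => x /=; rewrite !in_itv/=.
  by move=> /andP[ax xb]; rewrite (ltW ax) xb f_hard_soft.
move=> /andP[ax xb] /negP; rewrite xb andbT -leNgt => xa.
have -> : x = a by apply/eqP; rewrite eq_le xa.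
by rewrite /f_soft subrr mulr0 sqrtr0 mulr0 mul0r.
Qed.

(** * Solving for the right endpoint at a hard edge *)

Definition mass_defect al sg b :=
  3 / 4 * (b - sg) ^+ 2 + sg * (b - sg) + 2 * al * Num.sqrt (sg / b) - 2 * al - 2.

Definition slope_at_edge al sg b := sg + b - 2 * al / Num.sqrt (sg * b).

(** The slope condition at the smaller endpoint bounds [al], so that the loss in the [al] term is at
    most [(b' - b) * sg], the gain in the linear term; the quadratic term increases strictly. Only
    the smaller endpoint has to satisfy the condition, which is what uniqueness uses. *)
Lemma mass_defect_lt al sg b b' : 0 < al -> 0 < sg -> sg <= b -> b < b' ->
  0 <= slope_at_edge al sg b -> mass_defect al sg b < mass_defect al sg b'.
Proof.
move=> al0 sg0 sgb bb'; rewrite /slope_at_edge /mass_defect.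
have b0 := lt_le_trans sg0 sgb; have b'0 := lt_trans b0 bb'.
rewrite sqrtrM ?(ltW sg0)// !sqrtrM ?(ltW sg0)// !sqrtrV ?(ltW b0) ?(ltW b'0)//.
set w := Num.sqrt sg; set u := Num.sqrt b; set v := Num.sqrt b'.
have w0 : 0 < w by rewrite sqrtr_gt0.
have u0 : 0 < u by rewrite sqrtr_gt0.
have uv : u < v by rewrite ltr_sqrt.
have v0 := lt_trans u0 uv.
have w2 : w ^+ 2 = sg by rewrite sqr_sqrtr// ltW.
have u2 : u ^+ 2 = b by rewrite sqr_sqrtr// ltW.
have v2 : v ^+ 2 = b' by rewrite sqr_sqrtr// ltW.
have wu : w <= u by rewrite ler_wsqrtr.
move=> h.
have al2 : 2 * al <= (sg + b) * (w * u).
  by move: h; rewrite subr_ge0 ler_pdivrMr ?mulr_gt0.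
have step : 2 * al * (w / u) - 2 * al * (w / v) <= (b' - b) * sg.
  have -> : 2 * al * (w / u) - 2 * al * (w / v) = 2 * al * w * (v - u) / (u * v).
    by field; rewrite !gt_eqF.
  rewrite ler_pdivrMr ?mulr_gt0//.
  apply: (@le_trans _ _ ((sg + b) * (w * u) * w * (v - u))).
    by rewrite ler_wpM2r ?subr_ge0 ?(ltW uv)// ler_wpM2r ?(ltW w0).
  have -> : (sg + b) * (w * u) * w * (v - u) = sg * (v - u) * (u * (sg + b)).
    by rewrite -w2; ring.
  have -> : (b' - b) * sg * (u * v) = sg * (v - u) * (u * ((v + u) * v)).
    by rewrite -u2 -v2; ring.
  rewrite ler_wpM2l ?mulr_ge0 ?subr_ge0 ?(ltW uv) ?(ltW sg0)// ler_wpM2l ?(ltW u0)//.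
  have : b <= v * u by rewrite -u2 expr2 ler_wpM2r// ltW.
  have : b <= v ^+ 2 by rewrite v2 ltW.
  by move=> h1 h2; rewrite mulrDl -expr2 [u * v]mulrC; lra.
have h1 : 0 < (b' - b) * (b + b' - 2 * sg) by rewrite mulr_gt0 ?subr_gt0//; lra.
have -> : 3 / 4 * (b' - sg) ^+ 2 + sg * (b' - sg) + 2 * al * (w / v) - 2 * al - 2 =
  3 / 4 * (b - sg) ^+ 2 + sg * (b - sg) + 2 * al * (w / u) - 2 * al - 2 +
  (3 / 4 * ((b' - b) * (b + b' - 2 * sg)) + (b' - b) * sg -
   (2 * al * (w / u) - 2 * al * (w / v))) by field; rewrite !gt_eqF.
by rewrite ltrDl; lra.
Qed.

Lemma slope_at_edge_le al sg b b' : 0 <= al -> 0 < sg -> 0 < b -> b <= b' ->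
  slope_at_edge al sg b <= slope_at_edge al sg b'.
Proof.
move=> al0 sg0 b0 bb'; rewrite /slope_at_edge.
suff : 2 * al / Num.sqrt (sg * b') <= 2 * al / Num.sqrt (sg * b) by lra.
rewrite ler_wpM2l ?mulr_ge0// lef_pV2 ?posrE ?sqrtr_gt0 ?mulr_gt0//.
  by rewrite ler_wsqrtr// ler_wpM2l// ltW.
exact: lt_le_trans bb'.
Qed.

Lemma mass_defect_continuous al sg b : 0 < sg -> 0 < b ->
  {for b, continuous (mass_defect al sg)}.
Proof.
move=> sg0 b0; rewrite /mass_defect.
have h : 0 < sg / b by rewrite divr_gt0.
by derive_continuous => //; rewrite gt_eqF.
Qed.

Lemma slope_at_edge_continuous al sg b : 0 < sg -> 0 < b ->
  {for b, continuous (slope_at_edge al sg)}.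
Proof.
move=> sg0 b0; rewrite /slope_at_edge.
have h : 0 < sg * b by rewrite mulr_gt0.
by derive_continuous => //; rewrite gt_eqF// sqrtr_gt0.
Qed.

Lemma root_above (f : R -> R) (u v : R) : u <= v -> (forall x, u <= x <= v -> {for x, continuous f}) ->
  f u <= 0 -> 0 <= f v -> exists2 x, u <= x <= v & f x = 0.
Proof.
move=> uv cf fu fv; have [||x xI fx] := @IVT R f u v 0 uv.
- by apply: continuous_in_subspaceT => x; rewrite inE/= in_itv/= => xI; exact: cf.
- by rewrite ge_min fu le_max fv orbT.
by exists x => //; move: xI; rewrite in_itv.
Qed.

(** If [al <= sg ^+ 2] the slope condition holds already at [b0 = sg], where the defect is [-2].
    Otherwise [b0] is a zero of the slope. Then the pairs [(sg, b0)] and [(a, c)] have the same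
    value of [(sum) ^+ 2 * product], and [a < sg] forces a smaller sum and a larger product. The
    defect is [3 / 4] of the squared sum minus the product, compared with its value for the soft
    pair, hence negative. *)
Lemma hard_endpoint_start al a c sg : 0 < al -> soft_pair al a c -> a < sg ->
  exists b0, [/\ sg <= b0, 0 <= slope_at_edge al sg b0 & mass_defect al sg b0 < 0].
Proof.
move=> al0 [a0 ac e1 e2] asg; have sg0 := lt_trans a0 asg; have c0 := lt_trans a0 ac.
have [alsg|sgal] := leP al (sg ^+ 2).
  exists sg; split => //.
    rewrite /slope_at_edge -expr2 sqrtr_sqr gtr0_norm// subr_ge0 ler_pdivrMr//.
    have -> : (sg + sg) * sg = 2 * sg ^+ 2 by ring.
    lra.
  by rewrite /mass_defect subrr divff ?gt_eqF// sqrtr1 expr0n/=; lra.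
(* The endpoint [2 * al / sg] makes [sg * b] equal to [2 * al], whose square root is at least [sg];
   the slope is thus nonnegative there, and it is nonpositive at [sg]. *)
have hi : sg <= 2 * al / sg.
  by rewrite ler_pdivlMr// -expr2; lra.
have [||||b0 /andP[b1 b2] b0E] := @root_above (slope_at_edge al sg) sg (2 * al / sg).
- exact: hi.
- by move=> x /andP[x1 _]; apply: slope_at_edge_continuous => //; exact: lt_le_trans x1.
- rewrite /slope_at_edge -expr2 sqrtr_sqr gtr0_norm// subr_le0 ler_pdivlMr//.
  have -> : (sg + sg) * sg = 2 * sg ^+ 2 by ring.
    lra.
- rewrite /slope_at_edge subr_ge0 (_ : sg * (2 * al / sg) = 2 * al); last by field; rewrite gt_eqF.
  have h : sg <= Num.sqrt (2 * al).
    rewrite -[leLHS](ger0_norm (ltW sg0)) -sqrtr_sqr ler_wsqrtr//; lra.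
  apply: (@le_trans _ _ (2 * al / sg)); last by rewrite lerDr ltW.
  by rewrite ler_wpM2l ?mulr_ge0 ?(ltW al0)// lef_pV2// posrE// (lt_le_trans sg0).
have bp : 0 < b0 := lt_le_trans sg0 b1.
have sE : (sg + b0) * Num.sqrt (sg * b0) = 2 * al.
  have r0 : Num.sqrt (sg * b0) != 0 by rewrite gt_eqF// sqrtr_gt0 mulr_gt0.
  by move: b0E => /eqP; rewrite /slope_at_edge subr_eq0 => /eqP ->; rewrite divfK.
exists b0; split; [exact: b1|by rewrite b0E|].
have mE : 2 * al * Num.sqrt (sg / b0) = sg * (sg + b0).
  rewrite -sE !sqrtrM ?(ltW sg0)// sqrtrV ?(ltW bp)//.
  have r0 : Num.sqrt b0 != 0 by rewrite gt_eqF// sqrtr_gt0.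
  transitivity ((sg + b0) * Num.sqrt sg ^+ 2).
    by move: (Num.sqrt sg) (Num.sqrt b0) r0 => u v v0; field.
  by rewrite sqr_sqrtr ?(ltW sg0)//; ring.
rewrite /mass_defect mE.
have prod : (sg + b0) ^+ 2 * (sg * b0) = (a + c) ^+ 2 * (a * c).
  have p1 : 0 <= sg * b0 by rewrite mulr_ge0// ltW.
  have p2 : 0 <= a * c by rewrite mulr_ge0// ltW.
  by rewrite -[sg * b0](sqr_sqrtr p1) -[a * c](sqr_sqrtr p2) -!exprMn sE e1.
have sac : 0 < a + c by rewrite addr_gt0.
have ssb : 0 < sg + b0 by rewrite addr_gt0.
suff lts : (sg + b0) ^+ 2 < (a + c) ^+ 2.
  have ltp : a * c < sg * b0.
    rewrite ltNge; apply/negP => hp.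
    have : (sg + b0) ^+ 2 * (sg * b0) < (a + c) ^+ 2 * (a * c).
      apply: (@lt_le_trans _ _ ((a + c) ^+ 2 * (sg * b0))).
        by rewrite ltr_pM2r ?mulr_gt0.
      by rewrite ler_pM2l ?exprn_gt0.
    by rewrite prod ltxx.
  have -> : 3 / 4 * (b0 - sg) ^+ 2 + sg * (b0 - sg) + sg * (sg + b0) - 2 * al - 2 =
     3 / 4 * (sg + b0) ^+ 2 - sg * b0 - (3 * a ^+ 2 + 3 * c ^+ 2 + 2 * a * c) / 4.
    by rewrite e2; field.
  have -> : 3 * a ^+ 2 + 3 * c ^+ 2 + 2 * a * c = 3 * (a + c) ^+ 2 - 4 * (a * c) by ring.
  lra.
(* If the sum were not smaller, the product would be at most [a * c], hence the gap [b0 - sg] at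
   least [c - a]. Adding sum and gap gives [c <= b0], and with [a < sg] the product exceeds [a * c]
   after all. *)
rewrite ltNge; apply/negP => hs.
have hp : sg * b0 <= a * c.
  rewrite leNgt; apply/negP => hp.
  have : (a + c) ^+ 2 * (a * c) < (sg + b0) ^+ 2 * (sg * b0).
    apply: (@lt_le_trans _ _ ((a + c) ^+ 2 * (sg * b0))).
      by rewrite ltr_pM2l ?exprn_gt0.
    by rewrite ler_pM2r ?mulr_gt0.
  by rewrite prod ltxx.
have hsum : a + c <= sg + b0.
  by rewrite -(@ler_pXn2r _ 2) ?nnegrE// ltW.
have hdiff : c - a <= b0 - sg.
  rewrite -(@ler_pXn2r _ 2) ?nnegrE ?subr_ge0 ?(ltW ac)//.
  have -> : (c - a) ^+ 2 = (a + c) ^+ 2 - 4 * (a * c) by ring.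
  have -> : (b0 - sg) ^+ 2 = (sg + b0) ^+ 2 - 4 * (sg * b0) by ring.
  by lra.
have hc : c <= b0 by lra.
have : a * c < sg * b0.
  by apply: (@lt_le_trans _ _ (sg * c)); rewrite ?ltr_pM2r// ler_pM2l.
by rewrite ltNge hp.
Qed.

Lemma hard_endpoint_exists al a c sg : 0 < al -> soft_pair al a c -> a < sg ->
  exists b, [/\ sg < b, 0 <= slope_at_edge al sg b & mass_defect al sg b = 0].
Proof.
move=> al0 h asg; have [a0 _ _ _] := h; have sg0 := lt_trans a0 asg.
have [b0 [b1 s0 m0]] := hard_endpoint_start al0 h asg.
have bp := lt_le_trans sg0 b1.
(* Then [B - sg >= 2 * al + 4], and the quadratic term alone exceeds [2 * al + 2]. *)
pose B := b0 + 2 * (al + 1) + 2.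
have B0 : b0 <= B by rewrite /B; lra.
have [||||b /andP[bb _] bE] := @root_above (mass_defect al sg) b0 B.
- exact: B0.
- by move=> x /andP[x1 _]; apply: mass_defect_continuous => //; exact: lt_le_trans x1.
- exact: ltW.
- rewrite /mass_defect; set X := B - sg.
  have X2 : 2 * (al + 1) + 2 <= X by rewrite /X /B; lra.
  have h1 : 0 <= sg * X by rewrite mulr_ge0//; lra.
  have h2 : 0 <= 2 * al * Num.sqrt (sg / B) by rewrite !mulr_ge0 ?sqrtr_ge0// ltW.
  have h3 : 0 <= (X - 2) * X by rewrite mulr_ge0//; lra.
  by move: h3; rewrite mulrBl -expr2; lra.
exists b; split => //.
  rewrite (le_lt_trans b1)// lt_neqAle bb andbT; apply/eqP => e.
  by move: m0; rewrite e bE ltxx.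
by rewrite (le_trans s0)// slope_at_edge_le// ltW.
Qed.

End Densities.

Unset Implicit Arguments.
Set Strict Implicit.
Set Printing Implicit Defensive.

Theorem theorem2p4 (R : realType) :
  (* alpha > 0 : parts (1), (2), (3) *)
  (forall alpha : R, 0 < alpha ->
    exists ac bc : R,
      (* (1) *)
      [/\ (0 < ac /\ ac < Num.sqrt alpha /\ Num.sqrt alpha < bc),
          bc = 2 / 3 * (Num.sqrt (6 * (alpha + 1) - 2 * ac ^+ 2) - ac / 2),
          equilibrium_has_density (Sigma 0) (Qalpha alpha)
            `[ac, bc] (f_soft alpha ac bc) &
          (forall a b : R,
             0 < a -> a < Num.sqrt alpha -> Num.sqrt alpha < b ->
             equilibrium_has_density (Sigma 0) (Qalpha alpha)
               `[a, b] (f_soft alpha a b) ->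
             a = ac /\ b = bc)] /\
      (* (2) *)
      (forall sigma : R, 0 < sigma -> sigma <= ac ->
         same_equilibrium (Sigma sigma) (Sigma 0) (Qalpha alpha)) /\
      (* (3) *)
      (forall sigma : R, ac < sigma ->
         exists b : R,
           [/\ sigma < b,
               0 <= sigma + b - 2 * alpha / Num.sqrt (sigma * b),
               3 / 4 * (b - sigma) ^+ 2 + sigma * (b - sigma)
                 + 2 * alpha * Num.sqrt (sigma / b) - 2 * alpha - 2 = 0,
               (forall b' : R, sigma < b' ->
                  0 <= sigma + b' - 2 * alpha / Num.sqrt (sigma * b') ->
                  3 / 4 * (b' - sigma) ^+ 2 + sigma * (b' - sigma)
                    + 2 * alpha * Num.sqrt (sigma / b') - 2 * alpha - 2 = 0 ->
                  b' = b) &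
               equilibrium_has_density (Sigma sigma) (Qalpha alpha)
                 `]sigma, b] (f_hard alpha sigma b)])) /\
  (* alpha = 0 : part (4) *)
  (forall sigma : R,
     (* (a) *)
     (- Num.sqrt 2 <= sigma ->
        let b := 2 / 3 * (Num.sqrt (sigma ^+ 2 + 6) + sigma / 2) in
        equilibrium_has_density (Sigma sigma) (Qalpha 0)
          `]sigma, b] (f_hard0 sigma b)) /\
     (* (b) *)
     (sigma <= - Num.sqrt 2 ->
        equilibrium_has_density (Sigma sigma) (Qalpha 0)
          `[- Num.sqrt 2, Num.sqrt 2] (@semicircle R))).
Proof.
split=> [alpha al0|sigma].
  have [ac [bc [h h1 h2]]] := soft_pair_exists al0; have [a0 ab _ _] := h.
  exists ac, bc; split; [split => //|split].
  - exact: soft_pair_formula h.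
  - exact: soft_equilibrium (lexx _) (ltW a0).
  - move=> a b a1 a2 b1 [[mu mue] d].
    (* Uniqueness of the support: one equilibrium measure carries both densities, each positive
       inside its own interval, so each interval contains the other. *)
    have ab' : a < b := lt_trans a2 b1.
    have [[nu _] d0] := soft_equilibrium al0 h (lexx _) (ltW a0).
    have [e1 e2] := density_support_le ab' (measurable_f_soft alpha a b)
      (fun x => @f_soft_gt0 R alpha a b x (ltW al0) a1) (d mu mue) (d0 mu mue).
    have [e3 e4] := density_support_le ab (measurable_f_soft alpha ac bc)
      (fun x => @f_soft_gt0 R alpha ac bc x (ltW al0) a0) (d0 mu mue) (d mu mue).
    by split; apply/eqP; rewrite eq_le ?e1 ?e2 ?e3 ?e4.
  - move=> sigma s0 sac.
    have [ex1 d1] := soft_equilibrium al0 h (ltW s0) sac.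
    have [ex2 d2] := soft_equilibrium al0 h (lexx _) (ltW a0).
    split => //; split => // mu nu /d1 mud /d2 nud A mA.
    by rewrite mud// nud.
  - move=> sigma asg; have sg0 : 0 < sigma := lt_trans a0 asg.
    have [b [sb slope mass]] := hard_endpoint_exists al0 h asg.
    have b0 : 0 < b := lt_trans sg0 sb.
    exists b; split => //.
      move=> b' sb' slope' mass'.
      (* Whichever root is smaller satisfies the slope condition, so the defect is strictly larger
         at the other one. *)
      have [bb'|b'b|//] := ltgtP b b'.
        by have := mass_defect_lt al0 sg0 (ltW sb) bb' slope; rewrite mass /mass_defect mass' ltxx.
      by have := mass_defect_lt al0 sg0 (ltW sb') b'b slope'; rewrite mass /mass_defect mass' ltxx.
    apply: hard_edge_has_density => //; [exact: ltW| |by move=> _; exact: ltW|by rewrite ltxx].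
    by have := edge_slopeE alpha sg0 b0; move: slope; rewrite /slope_at_edge => s1 s2; lra.
have slopeE (sg b : R) : edge_slope 0 sg b sg = (sg + b) / 2.
  by rewrite /edge_slope mul0r; field.
have hard0E (sg b x : R) : f_hard 0 sg b x = f_hard0 sg b x.
  by rewrite /f_hard /f_hard0 mulr0 !mul0r subr0.
have s22 : Num.sqrt (2 : R) ^+ 2 = 2 by rewrite sqr_sqrtr.
have s20 : 0 < Num.sqrt (2 : R) by rewrite sqrtr_gt0.
split=> [sge|sle].
  move=> b; set r := Num.sqrt (sigma ^+ 2 + 6) in b *.
  have q0 : 0 <= sigma ^+ 2 + 6 by rewrite addr_ge0 ?sqr_ge0.
  have r2 : r ^+ 2 = sigma ^+ 2 + 6 by rewrite sqr_sqrtr.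
  have r0 : 0 <= r by exact: sqrtr_ge0.
  have sr : sigma < r.
    have [s0|s0] := ltP sigma 0; first exact: lt_le_trans r0.
    by rewrite -(@ltr_pXn2r _ 2) ?nnegrE// r2; lra.
  have sb : sigma < b by rewrite /b; lra.
  have slope : 0 <= sigma + b.
    (* For negative [sigma], squaring turns this into [4 * sigma ^+ 2 <= sigma ^+ 2 + 6], that is
       [sigma ^+ 2 <= 2]: the threshold [- sqrt 2]. *)
    suff : - (2 * sigma) <= r by rewrite /b; lra.
    have [s0|s0] := leP 0 sigma; first by rewrite (le_trans _ r0)// oppr_le0 mulr_ge0.
    rewrite -(@ler_pXn2r _ 2) ?nnegrE//; last by rewrite oppr_ge0 mulr_ge0_le0// ltW.
    have : (- sigma) ^+ 2 <= Num.sqrt 2 ^+ 2.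
      by rewrite ler_pXn2r ?nnegrE ?(ltW s20)//; lra.
    by rewrite s22 sqrrN r2 sqrrN exprMn; lra.
  apply: (@equilibrium_has_density_eq _ _ _ `]sigma, b] _ (f_hard 0 sigma b)) => //.
  apply: hard_edge_has_density => //; try by rewrite ?eqxx ?ltxx.
    rewrite !mulr0 mul0r addr0 subr0.
    have -> : 3 / 4 * (b - sigma) ^+ 2 + sigma * (b - sigma) - 2 = (r ^+ 2 - sigma ^+ 2) / 3 - 2.
      by rewrite /b; field.
    by rewrite r2; field.
  by rewrite slopeE divr_ge0.
have f0E (x : R) : - Num.sqrt 2 < x -> f_hard 0 (- Num.sqrt 2) (Num.sqrt 2) x = semicircle x.
  move=> xs; have x0 : 0 < x - - Num.sqrt 2 by rewrite subr_gt0.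
  rewrite hard0E /f_hard0 /semicircle.
  have -> : Num.sqrt (2 - x ^+ 2) =
      (x - - Num.sqrt 2) * Num.sqrt ((Num.sqrt 2 - x) / (x - - Num.sqrt 2)).
    rewrite -[X in _ = X * _](ger0_norm (ltW x0)) -sqrtr_sqr -sqrtrM ?sqr_ge0//.
    congr Num.sqrt; rewrite -[X in X - _]s22; field.
    by rewrite gt_eqF// -[Num.sqrt 2]opprK.
  have pn : (pi : R) != 0 by rewrite gt_eqF// pi_gt0.
  move: (Num.sqrt ((Num.sqrt 2 - x) / _)) (@pi R) pn => v p p0; field.
  exact: p0.
(* For [al = 0] the slope at the edge is [(sg + b) / 2], so the soft edge is the symmetric one, and
   the semicircle law is the hard-edge measure with [sg = - sqrt 2] and [b = sqrt 2]. *)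
apply: (@equilibrium_has_density_eq _ _ _ `]- Num.sqrt 2, Num.sqrt 2] _
   (f_hard 0 (- Num.sqrt 2) (Num.sqrt 2))).
- by move=> x /=; rewrite !in_itv/= => /andP[x1 x2]; rewrite (ltW x1) x2 f0E.
- move=> x /=; rewrite !in_itv/= => /andP[x1 x2] /negP; rewrite x2 andbT -leNgt => x3.
  have -> : x = - Num.sqrt 2 by apply/eqP; rewrite eq_le x3.
  by rewrite /semicircle sqrrN s22 subrr sqrtr0 mulr0.
apply: hard_edge_has_density => //; try by rewrite ?eqxx ?slopeE ?addNr ?mul0r.
- lra.
- rewrite !mulr0 mul0r addr0 subr0 opprK.
  have -> : 3 / 4 * (Num.sqrt 2 + Num.sqrt 2) ^+ 2 + - Num.sqrt 2 * (Num.sqrt 2 + Num.sqrt 2) - 2 =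
     Num.sqrt (2 : R) ^+ 2 - 2 by field.
  by rewrite s22 subrr.
Qed.
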